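(* Let $\Bbbk$ be a field of characteristic zero, $t\in\Bbbk$ and $n\in\mathbb N\cup\{\infty\}$. Set $I=\Lambda(n)_t$ and $\Lambda=\Lambda^+(n)_t$, both equipped with the dominance order $\preceq$. Then $\mathbb S(n,t)=\bigoplus_{\delta,\beta\in I}1_\delta\mathbb S(n,t)1_\beta$, with the anti-involution $\tau:\xi_q\mapsto\xi_{q^*}$ and the sets $X(\lambda,\mu)_t$, $Y(\mu,\lambda)_t$ ($\mu\in I$, $\lambda\in\Lambda$), $X(\lambda)_t=\bigcup_{\mu\in I}X(\lambda,\mu)_t$ and $Y(\lambda)_t=\bigcup_{\mu\in I}Y(\mu,\lambda)_t$, is an upper finite symmetrically based quasi-hereditary algebra in the sense of Brundan and Stroppel.
   Context: Upper finite symmetrically based quasi-hereditary algebra: a locally unital $\Bbbk$-algebra $A=\bigoplus_{i,j\in I}1_iA1_j$ (with $\{1_i\}_{i\in I}$ mutually orthogonal idempotents) together with: (1) a subset $\Lambda\subseteq I$ (indexing special idempotents); (2) a partial order $\le$ on $\Lambda$ that is upper finite, i.e. $\{\mu\in\Lambda\mid\mu\ge\lambda\}$ is finite for every $\lambda$; (3) sets $X(\lambda,i)\subseteq1_\lambda A1_i$ and $Y(i,\lambda)\subseteq1_iA1_\lambda$ for $\lambda\in\Lambda$, $i\in I$, with $X(\lambda)=\bigcup_iX(\lambda,i)$, $Y(\lambda)=\bigcup_iY(i,\lambda)$; such that (4) the products $yx$ for $(y,x)\in\bigcup_{\lambda\in\Lambda}Y(\lambda)\times X(\lambda)$ form a basis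 of $A$; (5) for $\lambda,\mu\in\Lambda$, $X(\lambda,\mu)$ and $Y(\mu,\lambda)$ are empty unless $\mu\le\lambda$; (6) $X(\lambda,\lambda)=Y(\lambda,\lambda)=\{1_\lambda\}$ for $\lambda\in\Lambda$; and (symmetric) an anti-involution $\tau$ of $A$ with $\tau(1_i)=1_i$ and $\tau(X(\lambda,i))=Y(i,\lambda)$ for all $i\in I$, $\lambda\in\Lambda$. Combinatorics. $\mathbb N=\{1,2,\dots\}$ and $[1,n]=\{1,\dots,n\}$ ($[1,\infty]=\mathbb N$). $\Lambda(n)_t$ is the set of sequences $\beta=(\beta_i)_{i\in[1,n]}$ with $\beta_1\in t-\mathbb Z$, $\beta_i\in\mathbb Z_{\ge 0}$ for $i\ge 2$ (all but finitely many equal to $0$), and $\sum_i\beta_i=t$. $\Lambda^+(n)_t=\{\beta\in\Lambda(n)_t\mid\beta_2\ge\beta_3\ge\cdots\}$. Dominance order: $\beta\preceq\delta$ iff the integer $\sum_{i=1}^k(\delta_i-\beta_i)\ge0$ for all $k\in[1,n]$. For $\beta,\delta\in\Lambda(n)_t$, $\mathcal{M}at_n(\delta,\beta)_t$ is the set of matrices $q=(q_{i,j})_{i,j\in[1,n]}$ with $q_{1,1}\in t-\mathbb Z$, all other $q_{i,j}\in\mathbb Z_{\ge0}$, $\sum_{i,j}q_{i,j}=t$, column sums $\sum_i q_{i,j}=\beta_j$ and row sums $\sum_j q_{i,j}=\delta_i$. $\mathcal{M}at_n(t)$ is the union of these; $q^*$ denotes the transpose. Semistandard matrices. For an integer $d$,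 $\lambda(d)$ (resp. $q(d)$) is obtained from $\lambda\in\Lambda(n)_t$ (resp. a matrix $q$) by adding $d-t$ to $\lambda_1$ (resp. $q_{1,1}$). Let $\lambda\in\Lambda^+(n)_t$ and $q\in\mathcal{M}at_n(\lambda,\beta)_t$. For $d$ large, $\lambda(d)$ is a partition of $d$ and $q(d)$ has nonnegative integer entries; the filling of the Young diagram $Y^{\lambda(d)}$ (with $\lambda(d)_i$ left-justified boxes in row $i$) by $q(d)$ is the tableau whose $i$th row contains $q(d)_{i,j}$ entries equal to $j$ for each $j$, arranged weakly increasingly. $q$ is called semistandard if, for all sufficiently large $d$, this filling is strictly increasing down columns. Set $X(\lambda,\beta)_t=\{\xi_r\mid r\in\mathcal{M}at_n(\lambda,\beta)_t\text{ semistandard}\}$ and $Y(\delta,\lambda)_t=\{\xi_q\mid q\in\mathcal{M}at_n(\delta,\lambda)_t,\ q^*\text{ semistandard}\}$. The category. $\mathfrak S_\infty$ is the group of all bijections of $\Omega=\mathbb N$, with the topology in which the pointwise stabilizers of finite subsets of $\Omega$ form a base of open neighborhoods of the identity. An action of an open subgroup $U$ on a set is smooth if all point stabilizers are open. A finitary $\widehat{\mathfrak S}_\infty$-set is a set with a smooth action of some open subgroup $U\subseteq\mathfrak S_\infty$ having finitely many orbits (one may shrink $U$); a finitary $\mathfrak S_\infty$-set is a smooth $\mathfrak S_\infty$-set with finitely many orbits. Let $\mathfrak S(p)$ be the pointwise stabilizer of $\{1,\dots,p\}$. For a finitary $\widehat{\mathfrak S}_\infty$-set $X$ there is a unique polynomial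 $p_X\in\mathbb Q[T]$ with $p_X(p)=|X^{\mathfrak S(p)}|$ for all sufficiently large integers $p$; set $\mu_t(X)=p_X(t)$. If $f:X\to\Bbbk$ is constant on the orbits of such an open subgroup, put $\int_X f(x)\,dx=\sum_c c\,\mu_t(f^{-1}(c))$, the sum being over the finitely many values $c$ of $f$. The category $\operatorname{Perm}(\mathfrak S_\infty;\mu_t)$ has as objects the finitary $\mathfrak S_\infty$-sets; $\operatorname{Hom}(X,Y)$ is the space of functions $Y\times X\to\Bbbk$ constant on the diagonal $\mathfrak S_\infty$-orbits; composition is $(g\circ f)(z,x)=\int_Y g(z,y)f(y,x)\,dy$. The algebra. For $\beta\in\Lambda(n)_t$ and $k\ge2$ let $\{\beta\}_k=[1+\sum_{i=2}^{k-1}\beta_i,\ \sum_{i=2}^{k}\beta_i]\subset\Omega$ and $\{\beta\}_1=\Omega\setminus\bigcup_{k\ge2}\{\beta\}_k$. $\mathfrak S_\beta\le\mathfrak S_\infty$ is the subgroup preserving each $\{\beta\}_k$, and $\mathcal X^\beta=\mathfrak S_\infty/\mathfrak S_\beta$. $\mathbb S(n,t)=\bigoplus_{\beta,\delta\in\Lambda(n)_t}\operatorname{Hom}_{\operatorname{Perm}(\mathfrak S_\infty;\mu_t)}(\mathcal X^\beta,\mathcal X^\delta)$, with product given by composition (zero if not composable). For $q\in\mathcal{M}at_n(\delta,\beta)_t$, $\xi_q\in\operatorname{Hom}(\mathcal X^\beta,\mathcal X^\delta)$ is the indicator function of the $\mathfrak S_\infty$-orbit of $(\mathfrak S_\delta,\sigma\mathfrak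 S_\beta)$ in $\mathcal X^\delta\times\mathcal X^\beta$, where $\sigma$ is any element with $|\{\delta\}_i\cap\sigma(\{\beta\}_j)|=q_{i,j}$ for all $(i,j)\ne(1,1)$. The $\xi_q$, $q\in\mathcal{M}at_n(t)$, form a basis of $\mathbb S(n,t)$. $1_\beta$ is the identity morphism of $\mathcal X^\beta$. *)

(* Defs.v *)
From HB Require Import structures.
From mathcomp Require Import all_boot all_order all_algebra.
From mathcomp Require Import finmap.
From mathcomp Require Import all_classical.

Set Implicit Arguments.
Unset Strict Implicit.
Unset Printing Implicit Defensive.

Import GRing.Theory.

Local Open Scope classical_set_scope.
Local Open Scope card_scope.
Local Open Scope ring_scope.

(** * Based quasi-hereditary algebras *)

Section BasedQuasiHereditary.
Variables (k : fieldType) (A : lmodType k) (mul : A -> A -> A).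
Variables (I : choiceType) (e : I -> A).

Definition is_basis (J : choiceType) (D : set J) (v : J -> A) : Prop :=
  forall a : A, exists! c : J -> k,
    [/\ forall j, ~ D j -> c j = 0,
        finite_set [set j | c j != 0]
      & a = \sum_(j \in D) c j *: v j].

Definition peirce (i j : I) : set A :=
  [set mul (mul (e i) a) (e j) | a in [set: A]].

Record locally_unital_algebra : Prop := LocallyUnitalAlgebra {
  lua_linearl : forall b, linear (mul^~ b);
  lua_linearr : forall a, linear (mul a);
  lua_mulA : associative mul;
  lua_idem : forall i, mul (e i) (e i) = e i;
  lua_orth : forall i j, i != j -> mul (e i) (e j) = 0;
  lua_direct : forall a : A, exists! c : I * I -> A,
    [/\ forall p, peirce p.1 p.2 (c p),
        finite_set [set p | c p != 0]
      & a = \sum_(p \in [set: I * I]) c p]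
}.

Record upper_finite_poset_on (L : set I) (le : I -> I -> Prop) : Prop :=
  UpperFinitePosetOn {
  ufp_refl : forall l, L l -> le l l;
  ufp_anti : forall l m, L l -> L m -> le l m -> le m l -> l = m;
  ufp_trans : forall l m p, L l -> L m -> L p -> le l m -> le m p -> le l p;
  ufp_finite : forall l, L l -> finite_set [set m | L m /\ le l m]
}.

Record anti_involution (tau : A -> A) : Prop := AntiInvolution {
  ainv_linear : linear tau;
  ainv_invol : involutive tau;
  ainv_mul : forall a b, tau (mul a b) = mul (tau b) (tau a)
}.

(* [X l i] is X(l, i) and [Y i l] is Y(i, l); both matter only for [L l]. *)
Record upper_finite_based_quasi_hereditary (L : set I) (le : I -> I -> Prop)
    (X Y : I -> I -> set A) : Prop := UpperFiniteBasedQuasiHereditary {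
  bqh_alg : locally_unital_algebra;
  bqh_order : upper_finite_poset_on L le;
  bqh_X : forall l i, L l -> X l i `<=` peirce l i;
  bqh_Y : forall l i, L l -> Y i l `<=` peirce i l;
  bqh_basis : is_basis
    (\bigcup_(l in L)
       ((\bigcup_(i in [set: I]) Y i l) `*` (\bigcup_(i in [set: I]) X l i)))
    (fun yx : A * A => mul yx.1 yx.2);
  bqh_triang : forall l m, L l -> L m -> ~ le m l ->
    X l m = set0 /\ Y m l = set0;
  bqh_diag : forall l, L l -> X l l = [set e l] /\ Y l l = [set e l]
}.

Record upper_finite_symmetrically_based_quasi_hereditary
    (L : set I) (le : I -> I -> Prop) (X Y : I -> I -> set A)
    (tau : A -> A) : Prop := UpperFiniteSymmetricallyBasedQuasiHereditary {
  sbqh_bqh : upper_finite_based_quasi_hereditary L le X Y;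
  sbqh_ainv : anti_involution tau;
  sbqh_idem : forall i, tau (e i) = e i;
  sbqh_XY : forall l i, L l -> tau @` X l i = Y i l
}.

End BasedQuasiHereditary.

(** * Direct sums of vector spaces *)

Section DirectSum.
Variables (k : fieldType) (J : choiceType) (V : J -> lmodType k).

Record dsum : Type := Dsum {
  dsum_val :> forall j, V j;
  dsum_fin : finite_set [set j | dsum_val j != 0]
}.

Lemma dsum_eq (a b : dsum) : (forall j, a j = b j) -> a = b.
Proof.
case: a b => [a fa] [b fb] /= ab.
have E : a = b by apply/functional_extensionality_dep.
move: fb; rewrite -E => fb; congr Dsum; exact: Prop_irrelevance.
Qed.

Lemma dsum_zero_fin : finite_set [set j | (0 : V j) != 0].
Proof. by apply: (sub_finite_set _ (finite_set0 J)) => j /=; rewrite eqxx. Qed.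
Definition dsum_zero := @Dsum (fun=> 0) dsum_zero_fin.

Lemma dsum_opp_fin (a : dsum) : finite_set [set j | - a j != 0].
Proof. by apply: (sub_finite_set _ (dsum_fin a)) => j /=; rewrite oppr_eq0. Qed.
Definition dsum_opp (a : dsum) := @Dsum (fun j => - a j) (dsum_opp_fin a).

Lemma dsum_add_fin (a b : dsum) : finite_set [set j | a j + b j != 0].
Proof.
have F : finite_set ([set j | a j != 0] `|` [set j | b j != 0]).
  by rewrite finite_setU; split; exact: dsum_fin.
apply: (sub_finite_set _ F) => j /=.
have [->|a0] := eqVneq (a j) 0; last by left.
by rewrite add0r; right.
Qed.
Definition dsum_add (a b : dsum) := @Dsum (fun j => a j + b j) (dsum_add_fin a b).

Lemma dsum_scale_fin c (a : dsum) : finite_set [set j | c *: a j != 0].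
Proof.
apply: (sub_finite_set _ (dsum_fin a)) => j /=.
by apply: contra_neq => ->; rewrite scaler0.
Qed.
Definition dsum_scale c (a : dsum) := @Dsum (fun j => c *: a j) (dsum_scale_fin c a).

HB.instance Definition _ := gen_eqMixin dsum.
HB.instance Definition _ := gen_choiceMixin dsum.

Fact dsum_addA : associative dsum_add.
Proof. by move=> a b c; apply: dsum_eq => j /=; rewrite addrA. Qed.
Fact dsum_addC : commutative dsum_add.
Proof. by move=> a b; apply: dsum_eq => j /=; rewrite addrC. Qed.
Fact dsum_add0 : left_id dsum_zero dsum_add.
Proof. by move=> a; apply: dsum_eq => j /=; rewrite add0r. Qed.
Fact dsum_addN : left_inverse dsum_zero dsum_opp dsum_add.
Proof. by move=> a; apply: dsum_eq => j /=; rewrite addNr. Qed.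

HB.instance Definition _ :=
  GRing.isZmodule.Build dsum dsum_addA dsum_addC dsum_add0 dsum_addN.

Fact dsum_scaleA a b (v : dsum) :
  dsum_scale a (dsum_scale b v) = dsum_scale (a * b) v.
Proof. by apply: dsum_eq => j /=; rewrite scalerA. Qed.
Fact dsum_scale1 : left_id 1 dsum_scale.
Proof. by move=> a; apply: dsum_eq => j /=; rewrite scale1r. Qed.
Fact dsum_scaleDr : right_distributive dsum_scale +%R.
Proof. by move=> c a b; apply: dsum_eq => j /=; rewrite scalerDr. Qed.
Fact dsum_scaleDl v : {morph dsum_scale^~ v : a b / a + b}.
Proof. by move=> a b; apply: dsum_eq => j /=; rewrite scalerDl. Qed.

HB.instance Definition _ := GRing.Zmodule_isLmodule.Build k dsum
  dsum_scaleA dsum_scale1 dsum_scaleDr dsum_scaleDl.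

Lemma dsum_in_fin j (v : V j) :
  finite_set [set i | dfwith (fun i => 0 : V i) j v i != 0].
Proof.
apply: (sub_finite_set _ (finite_set1 j)) => i /=.
have [->//|ij] := eqVneq i j.
by rewrite dfwithout ?eqxx// eq_sym.
Qed.
Definition dsum_in j (v : V j) : dsum := Dsum (dsum_in_fin v).

End DirectSum.

(** * The infinite symmetric group and its smooth actions *)

(* Omega is [nat]; the point i of {1, 2, ...} is encoded as i - 1. *)
Record Sinf : Type := MkSinf {
  sinf_fun :> nat -> nat;
  sinf_inv : nat -> nat;
  sinf_funK : cancel sinf_fun sinf_inv;
  sinf_invK : cancel sinf_inv sinf_fun
}.

Lemma sinf_eq (g h : Sinf) : g =1 h -> g = h.
Proof.
case: g h => [g g' gK g'K] [h h' hK h'K] /= /funext E.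
case: h / E hK h'K => hK h'K.
have E : g' = h' by apply/funext => x; rewrite -{1}(h'K x) gK.
case: h' / E hK h'K => hK h'K.
by rewrite (Prop_irrelevance gK hK) (Prop_irrelevance g'K h'K).
Qed.

HB.instance Definition _ := gen_eqMixin Sinf.
HB.instance Definition _ := gen_choiceMixin Sinf.

Definition sinf_one : Sinf := @MkSinf id id (fun=> erefl) (fun=> erefl).
Definition sinf_mul (g h : Sinf) : Sinf :=
  MkSinf (can_comp (sinf_funK g) (sinf_funK h))
         (can_comp (sinf_invK h) (sinf_invK g)).
Definition sinf_V (g : Sinf) : Sinf := MkSinf (sinf_invK g) (sinf_funK g).

Fact sinf_mulA : associative sinf_mul.
Proof. by move=> f g h; apply: sinf_eq. Qed.
Fact sinf_mul1 : left_id sinf_one sinf_mul.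
Proof. by move=> f; apply: sinf_eq. Qed.
Fact sinf_mulr1 : right_id sinf_one sinf_mul.
Proof. by move=> f; apply: sinf_eq. Qed.
Fact sinf_mulV : left_inverse sinf_one sinf_V sinf_mul.
Proof. by move=> f; apply: sinf_eq => x /=; rewrite sinf_funK. Qed.
Fact sinf_mulrV : right_inverse sinf_one sinf_V sinf_mul.
Proof. by move=> f; apply: sinf_eq => x /=; rewrite sinf_invK. Qed.

HB.instance Definition _ := isGroup.Build Sinf
  sinf_mulA sinf_mul1 sinf_mulr1 sinf_mulV sinf_mulrV.

Definition pt_stab (F : set nat) : set Sinf :=
  [set g | forall x, F x -> g x = x].

(* The group written S(p) in the literature. *)
Definition Sfix (p : nat) : set Sinf := pt_stab `I_p.

Definition sinf_open (U : set Sinf) : Prop :=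
  forall g, U g -> exists2 F : set nat, finite_set F &
    forall h, pt_stab F h -> U (g * h)%g.

Record finitary_set : Type := FinitarySet {
  fs_car :> Type;
  fs_act : Sinf -> fs_car -> fs_car;
  fs_act1 : forall x, fs_act 1%g x = x;
  fs_actM : forall g h x, fs_act (g * h)%g x = fs_act g (fs_act h x);
  fs_smooth : forall x, sinf_open [set g | fs_act g x = x];
  fs_finite : exists2 F : set fs_car, finite_set F &
    forall x, exists2 y, F y & exists g, fs_act g y = x
}.

(** * The measure mu_t and the category Perm *)

Section Measure.
Variables (k : fieldType) (t : k) (Y : finitary_set).

Definition fixed_points (A : set Y) (p : nat) : set Y :=
  A `&` [set y | forall g, Sfix p g -> fs_act g y = y].

Definition counting_poly (A : set Y) (P : {poly rat}) : Prop :=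
  exists N : nat, forall p : nat, (N <= p)%N ->
    exists2 m : nat, fixed_points A p #= `I_m & P.[p%:R] = m%:R.

(* Meaningful when A, a subset of Y stable under an open subgroup, is
   regarded as a finitary set for that subgroup: the counting polynomial then
   exists and is unique. *)
Definition mu (A : set Y) : k :=
  (map_poly ratr (xget 0 (counting_poly A))).[t].

Definition integral (f : Y -> k) : k :=
  \sum_(c \in range f) c * mu (f @^-1` [set c]).

End Measure.

Section MeasureInvariance.
Variables (k : fieldType) (t : k) (Y : finitary_set).
Implicit Types (g h : Sinf) (A : set Y).

Lemma fs_actK g : cancel (@fs_act Y g) (@fs_act Y g^-1%g).
Proof. by move=> y; rewrite -fs_actM mulVg fs_act1. Qed.

Lemma fs_actKV g : cancel (@fs_act Y g^-1%g) (@fs_act Y g).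
Proof. by move=> y; rewrite -fs_actM mulgV fs_act1. Qed.

Lemma sinf_inj g : injective g.
Proof. exact: can_inj (sinf_funK g). Qed.

Definition swap_fun (a b x : nat) : nat :=
  if x == a then b else if x == b then a else x.
Lemma swap_funK a b : involutive (swap_fun a b).
Proof.
move=> x; rewrite /swap_fun.
case: (eqVneq x a) => [->|xa]; first by rewrite eqxx; case: eqVneq.
case: (eqVneq x b) => [->|xb]; first by rewrite eqxx.
by rewrite (negPf xa) (negPf xb).
Qed.
Definition swap a b : Sinf := MkSinf (swap_funK a b) (swap_funK a b).

Lemma sinf_dense h N : exists h' : Sinf,
  (forall x, (x < N)%N -> h' x = h x) /\
  exists M, forall x, (M <= x)%N -> h' x = x.
Proof.
elim: N => [|N [h' [h'h [M h'M]]]].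
  by exists 1%g; split => //; exists 0.
exists (swap (h' N) (h N) * h')%g; split => [x|].
  rewrite ltnS leq_eqVlt => /predU1P[->|xN] /=.
    by rewrite /swap_fun eqxx.
  rewrite /swap_fun (inj_eq (@sinf_inj h')) (ltn_eqF xN) h'h//.
  by rewrite (inj_eq (@sinf_inj h)) (ltn_eqF xN).
exists (M + (h' N).+1 + (h N).+1)%N => x xM /=.
have Mx : (M <= x)%N by apply: leq_trans xM; rewrite -addnA leq_addr.
rewrite (h'M x Mx).
rewrite /swap_fun !gtn_eqF//.
  by apply: leq_trans xM; rewrite leq_addl.
by apply: leq_trans xM; rewrite addnAC leq_addl.
Qed.

Lemma finite_sinf_Sfix h M : (forall x, (M <= x)%N -> h x = x) ->
  forall p g, (M <= p)%N -> Sfix p g -> Sfix p (h * g * h^-1)%g.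
Proof.
move=> hM p g Mp gp x /= xp; rewrite gp ?sinf_invK//=.
rewrite ltnNge; apply/negP => px.
have := hM _ (leq_trans Mp px); rewrite sinf_invK => E.
by move: px; rewrite -E leqNgt xp.
Qed.

Lemma mu_act_finite h M A : (forall x, (M <= x)%N -> h x = x) ->
  mu t [set y | A (fs_act h^-1%g y)] = mu t A.
Proof.
move=> hM.
have hVM x : (M <= x)%N -> (h^-1)%g x = x.
  by move=> Mx; apply: (@sinf_inj h); rewrite [LHS]sinf_invK hM.
have fpE p : (M <= p)%N ->
    fixed_points [set y | A (fs_act h^-1%g y)] p #= fixed_points A p.
  move=> Mp.
  have -> : fixed_points [set y | A (fs_act h^-1%g y)] p =
            fs_act h @` fixed_points A p.
    apply/seteqP; split => [y [/= Ay yfix]|_ [y [Ay yfix] <-]].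
      exists (fs_act h^-1%g y); last exact: fs_actKV.
      split => // g gp; rewrite -fs_actM.
      have := yfix _ (finite_sinf_Sfix hM Mp gp).
      by rewrite !fs_actM => /(congr1 (fs_act h^-1%g)); rewrite fs_actK -fs_actM.
    split => /=; first by rewrite fs_actK.
    move=> g gp; have := yfix _ (finite_sinf_Sfix hVM Mp gp).
    by rewrite invgK !fs_actM => /(congr1 (fs_act h)); rewrite fs_actKV.
  by apply: inj_card_eq => x y _ _; apply: can_inj (fs_actK h) _ _.
rewrite /mu; congr (map_poly _ (xget _ _)).[_].
apply/funext => P; apply/propext; split => -[N PN];
  exists (maxn M N) => p; rewrite geq_max => /andP[Mp Np];
  have [m mE Pm] := PN _ Np; exists m => //; apply: card_eq_trans mE.
  by rewrite card_eq_sym fpE.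
exact: fpE.
Qed.

Lemma sinf_open_Sfix (U : set Sinf) : sinf_open U -> U 1%g ->
  exists N, Sfix N `<=` U.
Proof.
move=> oU /oU[F finF FU].
have [N FN] : exists N, F `<=` `I_N.
  case/finite_seqP: finF => s ->; exists (\max_(i <- s) i).+1 => i /= si.
  by rewrite ltnS; apply: (@leq_bigmax_seq _ _ predT id).
by exists N => g gN; rewrite -[g]mul1g; apply: FU => x /FN; apply: gN.
Qed.

Lemma integral_act (f : Y -> k) h :
  (exists N, forall g y, Sfix N g -> f (fs_act g y) = f y) ->
  integral t (fun y => f (fs_act h^-1%g y)) = integral t f.
Proof.
move=> [N fN].
have [h' [h'h [M h'M]]] := sinf_dense h N.
have E : (fun y => f (fs_act h^-1%g y)) = (fun y => f (fs_act h'^-1%g y)).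
  apply/funext => y; rewrite -(@fN (h'^-1 * h)%g); last first.
    by move=> x /= xN; rewrite -h'h// sinf_funK.
  by rewrite -fs_actM -mulgA mulgV mulg1.
rewrite E /integral; congr (\big[_/_]_(_ <- _) _).
  congr finite_support.
    apply/seteqP; split => [_ [y _ <-]|_ [y _ <-]].
      by exists (fs_act h'^-1%g y).
    by exists (fs_act h' y) => //=; rewrite fs_actK.
  by apply/funext => c; rewrite (mu_act_finite (f @^-1` [set c]) h'M).
by apply/funext => c; rewrite (mu_act_finite (f @^-1` [set c]) h'M).
Qed.

End MeasureInvariance.

Section Hom.
Variables (k : fieldType).

Section HomSpace.
Variables (X Y : finitary_set).

Definition hom_pred : {pred (Y * X -> k^o)} := fun f =>
  `[< forall g y x, f (fs_act g y, fs_act g x) = f (y, x) >].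

(* Hom(X, Y) in Perm: functions on Y * X (target first). *)
Record perm_hom : Type := PermHom {
  hom_fun :> Y * X -> k^o;
  hom_funP : hom_fun \in hom_pred
}.

HB.instance Definition _ := [isSub of perm_hom for hom_fun].
HB.instance Definition _ := [Choice of perm_hom by <:].

Fact hom_submod : submod_closed hom_pred.
Proof.
split=> [|a u v]; first by rewrite unfold_in; apply/asboolP.
rewrite !unfold_in => /asboolP uP /asboolP vP; apply/asboolP => g y x.
by rewrite -[LHS]/(a * u _ + v _) uP vP.
Qed.
HB.instance Definition _ := GRing.isSubmodClosed.Build k (Y * X -> k^o) hom_pred
  hom_submod.
HB.instance Definition _ := [SubChoice_isSubLmodule of perm_hom by <:].

Lemma hom_act (f : perm_hom) g y x : f (fs_act g y, fs_act g x) = f (y, x).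
Proof. by case: f => f /= /asboolP ->. Qed.

End HomSpace.

Variable t : k.

Section Comp.
Variables (X Y Z : finitary_set) (g : perm_hom Y Z) (f : perm_hom X Y).

Fact hom_comp_subproof :
  (fun zx : Z * X => integral t (fun y : Y => g (zx.1, y) * f (y, zx.2)))
    \in @hom_pred X Z.
Proof.
rewrite unfold_in; apply/asboolP => h z x /=.
transitivity (integral t
  (fun y : Y => g (z, fs_act h^-1%g y) * f (fs_act h^-1%g y, x))).
  congr integral; apply/funext => y.
  by rewrite -(hom_act g h z) -(hom_act f h _ x) !fs_actKV.
apply: (@integral_act _ t Y (fun y => g (z, y) * f (y, x))).
have [N1 zN] := sinf_open_Sfix (@fs_smooth Z z) (fs_act1 z).
have [N2 xN] := sinf_open_Sfix (@fs_smooth X x) (fs_act1 x).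
exists (maxn N1 N2) => u y uN.
have uz : fs_act u z = z.
  by apply: zN => i /= iN; apply: uN => /=; rewrite leq_max iN.
have ux : fs_act u x = x.
  by apply: xN => i /= iN; apply: uN => /=; rewrite leq_max iN orbT.
by rewrite -[in LHS]uz -[in LHS]ux !hom_act.
Qed.

Definition hom_comp : perm_hom X Z := PermHom hom_comp_subproof.

End Comp.

Fact hom_id_subproof (X : finitary_set) :
  (fun yx : X * X => (`[< yx.1 = yx.2 >])%:R : k) \in @hom_pred X X.
Proof.
rewrite unfold_in; apply/asboolP => g y x /=; congr (_%:R).
congr (nat_of_bool _); apply: asbool_equiv_eq.
by split => [/(can_inj (fs_actK g))|->].
Qed.
Definition hom_id (X : finitary_set) : perm_hom X X :=
  PermHom (hom_id_subproof X).

Lemma hom_compEl0 X Y Z (f : perm_hom X Y) : hom_comp (0 : perm_hom Y Z) f = 0.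
Proof.
apply/val_inj/funext => -[z x] /=; rewrite /integral fsbig1// => _ [y _ <-].
by rewrite !mul0r.
Qed.

Lemma hom_compEr0 X Y Z (g : perm_hom Y Z) : hom_comp g (0 : perm_hom X Y) = 0.
Proof.
apply/val_inj/funext => -[z x] /=; rewrite /integral fsbig1// => _ [y _ <-].
by rewrite mulr0 mul0r.
Qed.

End Hom.

(** * Weights and matrices *)

(* The range [1, n] with n in N or n = oo ([None]); index i is encoded as i - 1.
   Sequences and matrices are extended by zero outside the range. *)
Definition in_range (n : option nat) (i : nat) : bool :=
  if n is Some m then (i < m)%N else true.

Section Combinatorics.
Variables (k : fieldType) (n : option nat) (t : k).

(* The natural number equal to x, when there is one (it is unique in
   characteristic 0), and 0 otherwise. *)
Definition natval (x : k) : nat :=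
  if pselect (exists m : nat, m%:R == x) is left ex then ex_minn ex else 0%N.

Record weight : Type := Weight {
  weight_val :> nat -> k;
  weight_range : forall i, ~~ in_range n i -> weight_val i = 0;
  weight_head : exists z : int, weight_val 0%N = t - z%:~R;
  weight_nat : forall i, (0 < i)%N -> exists m : nat, weight_val i = m%:R;
  weight_fin : finite_set [set i | weight_val i != 0];
  weight_sum : \sum_(i \in [set: nat]) weight_val i = t
}.

HB.instance Definition _ := gen_eqMixin weight.
HB.instance Definition _ := gen_choiceMixin weight.

Definition dominant : set weight :=
  [set b | forall i, (0 < i)%N -> (natval (b i.+1) <= natval (b i))%N].

Definition dominance (b d : weight) : Prop :=
  forall i, in_range n i ->
    exists m : nat, \sum_(j < i.+1) (d j - b j) = m%:R.

Record is_mat (d b : weight) (q : nat -> nat -> k) : Prop := IsMat {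
  mat_range : forall i j, ~~ (in_range n i && in_range n j) -> q i j = 0;
  mat_head : exists z : int, q 0%N 0%N = t - z%:~R;
  mat_nat : forall i j, (i, j) != (0%N, 0%N) -> exists m : nat, q i j = m%:R;
  mat_fin : finite_set [set p : nat * nat | q p.1 p.2 != 0];
  mat_sum : \sum_(p \in [set: nat * nat]) q p.1 p.2 = t;
  mat_col : forall j, \sum_(i \in [set: nat]) q i j = b j;
  mat_row : forall i, \sum_(j \in [set: nat]) q i j = d i
}.

Definition transpose (q : nat -> nat -> k) : nat -> nat -> k :=
  fun i j => q j i.

(* lambda(d) and q(d), as natural numbers. *)
Definition weight_at (l : weight) (d : nat) (i : nat) : nat :=
  natval (l i + (if i == 0%N then d%:R - t else 0)).
Definition mat_at (q : nat -> nat -> k) (d : nat) (i j : nat) : nat :=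
  natval (q i j + (if (i, j) == (0%N, 0%N) then d%:R - t else 0)).

(* [T i c] is the entry of box (i, c), a box when [c < l i]. *)
Definition is_filling (l : nat -> nat) (q : nat -> nat -> nat)
    (T : nat -> nat -> nat) : Prop :=
  (forall i c c', (c <= c')%N -> (c' < l i)%N -> (T i c <= T i c')%N) /\
  (forall i j, count_mem j (mkseq (T i) (l i)) = q i j).

Definition column_strict (l : nat -> nat) (T : nat -> nat -> nat) : Prop :=
  forall i i' c, (i < i')%N -> (c < l i)%N -> (c < l i')%N ->
    (T i c < T i' c)%N.

Definition semistandard (l : weight) (q : nat -> nat -> k) : Prop :=
  exists D : nat, forall d : nat, (D <= d)%N ->
    exists2 T, is_filling (weight_at l d) (mat_at q d) T
             & column_strict (weight_at l d) T.

(** * The orbits X^beta *)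

Definition tail_block (b : weight) (i : nat) : set nat :=
  [set x | (\sum_(1 <= j < i) natval (b j) <= x)%N /\
           (x < \sum_(1 <= j < i.+1) natval (b j))%N].

Definition block (b : weight) (i : nat) : set nat :=
  if i == 0%N then ~` (\bigcup_(j in [set j | (0 < j)%N]) tail_block b j)
  else tail_block b i.

Definition young (b : weight) : set Sinf :=
  [set g | forall i, g @` block b i = block b i].

Lemma natval0 : natval 0 = 0%N.
Proof.
rewrite /natval; case: pselect => // ex.
by case: ex_minnP => m _ /(_ 0%N (eqxx _)); rewrite leqn0 => /eqP.
Qed.

Lemma tail_block_bounded (b : weight) :
  exists M, forall i, (0 < i)%N -> tail_block b i `<=` `I_M.
Proof.
have [K bK] : exists K, forall i, (K <= i)%N -> b i = 0.
  have /finite_seqP[s sE] := weight_fin b.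
  exists (\max_(i <- s) i).+1 => i iK; apply/eqP/negPn/negP => bi.
  have : [set` s] i by rewrite -sE.
  move=> /= si; have := @leq_bigmax_seq _ s predT id i si isT.
  by move=> /(leq_trans iK); rewrite ltnn.
exists (\sum_(1 <= j < K.+1) natval (b j))%N => i i0 x [_ /= xi].
apply: leq_trans xi _; have [iK|Ki] := leqP i K.
  by rewrite [leqRHS](@big_cat_nat _ _ _ i.+1)//= leq_addr.
rewrite (@big_cat_nat _ _ _ K.+1)//=; last by rewrite ltnS ltnW.
have -> : (\sum_(K.+1 <= j < i.+1) natval (b j) = 0)%N; last by rewrite addn0.
apply: big1_seq => j; rewrite mem_index_iota => /andP[_ /andP[Kj _]].
by rewrite bK ?natval0// ltnW.
Qed.

Lemma young_Sfix (b : weight) : exists M, Sfix M `<=` young b.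
Proof.
have [M bM] := tail_block_bounded b; exists M => g gM.
have gx i x : (0 < i)%N -> tail_block b i x -> g x = x.
  by move=> i0 /(bM i i0); exact: gM.
have gN i x : (0 < i)%N -> tail_block b i (g x) -> g x = x.
  by move=> i0 /(gx i _ i0)/sinf_inj.
move=> i; rewrite /block; case: (posnP i) => [_|i0]; last first.
  apply/seteqP; split => [_ [x xi <-]|x xi]; first by rewrite (gx i).
  by exists x => //; rewrite (gx i).
apply/seteqP; split => [_ [x xi <-] [j /= j0 gxj]|x xi].
  by apply: xi; exists j => //=; rewrite -(gN j x).
have gV : g (g^-1%g x) = x by exact: sinf_invK.
exists (g^-1%g x) => // -[j /= j0 xj]; apply: xi; exists j => //=.
by rewrite -gV (gx j).
Qed.

Lemma young1 (b : weight) : young b 1%g.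
Proof. by move=> i; rewrite image_id. Qed.

Lemma youngM (b : weight) g h : young b g -> young b h -> young b (g * h)%g.
Proof. by move=> gb hb i; rewrite -[in RHS]gb -[in RHS]hb -image_comp. Qed.

Lemma youngV (b : weight) g : young b g -> young b g^-1%g.
Proof.
move=> gb i; rewrite -[in LHS]gb image_comp -[RHS]image_id.
by congr image; apply/funext => x; exact: sinf_funK.
Qed.

Definition lcoset (g : Sinf) (A : set Sinf) : set Sinf :=
  [set (g * a)%g | a in A].

Record coset (H : set Sinf) : Type := Coset {
  coset_val :> set Sinf;
  coset_valP : exists g, coset_val = lcoset g H
}.

Lemma lcoset1 A : lcoset 1%g A = A.
Proof.
by rewrite /lcoset -[RHS]image_id; congr image; apply/funext => x; rewrite mul1g.
Qed.

Lemma lcosetM g h A : lcoset (g * h)%g A = lcoset g (lcoset h A).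
Proof.
by rewrite /lcoset image_comp; congr image; apply/funext => x; rewrite /= mulgA.
Qed.

Lemma coset_eq H (a b : coset H) : coset_val a = coset_val b -> a = b.
Proof.
case: a b => [a aP] [b bP] /= ab; move: bP; rewrite -ab => bP.
by congr Coset; exact: Prop_irrelevance.
Qed.

Fact coset_act_subproof H g (a : coset H) :
  exists h, lcoset g a = lcoset h H.
Proof.
by case: a => _ /= [h ->]; exists (g * h)%g; rewrite lcosetM.
Qed.
Definition coset_act H g (a : coset H) : coset H :=
  Coset (coset_act_subproof g a).

Definition coset_base H : coset H := @Coset H H (ex_intro _ 1%g (esym (lcoset1 H))).

Section YoungCosets.
Variable b : weight.
Let H := young b.

Fact young_act1 (a : coset H) : coset_act 1%g a = a.
Proof. by apply: coset_eq; exact: lcoset1. Qed.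

Fact young_actM g h (a : coset H) :
  coset_act (g * h)%g a = coset_act g (coset_act h a).
Proof. by apply: coset_eq; exact: lcosetM. Qed.

Lemma young_lcoset h : H h -> lcoset h H = H.
Proof.
move=> hH; apply/seteqP; split => x; last move=> xH.
  by move=> [y yH <-]; exact: youngM hH yH.
exists (h^-1 * x)%g; first by apply: youngM => //; exact: youngV.
by rewrite mulgA mulgV mul1g.
Qed.

Fact young_act_smooth (a : coset H) : sinf_open [set g | coset_act g a = a].
Proof.
case: a => a [s aE] g /= ga; have [M HM] := young_Sfix b.
exists (s @` `I_M) => [|h hM /=]; first exact/finite_image/finite_II.
rewrite young_actM -[RHS]ga; congr coset_act.
apply: coset_eq => /=; rewrite aE -lcosetM.
have -> : (h * s = s * (s^-1 * h * s))%g by rewrite !mulgA mulgV mul1g.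
rewrite lcosetM young_lcoset//; apply: HM => x xM /=.
by rewrite hM ?sinf_funK//; exists x.
Qed.

Fact young_act_finite : exists2 F : set (coset H), finite_set F &
  forall x, exists2 y, F y & exists g, coset_act g y = x.
Proof.
exists [set coset_base H] => [|x]; first exact: finite_set1.
exists (coset_base H) => //; case: x => x [g xE]; exists g.
by apply: coset_eq; rewrite /= xE.
Qed.

Definition orbit_set : finitary_set :=
  FinitarySet young_act1 young_actM young_act_smooth young_act_finite.

End YoungCosets.

(** * The algebra S(n, t) *)

(* The summand of index (d, b) is Hom(X^b, X^d). *)
Definition schur : Type :=
  dsum (fun p : weight * weight => perm_hom k (orbit_set p.2) (orbit_set p.1)).

Definition schur_mul_val (g f : schur) (p : weight * weight) :
    perm_hom k (orbit_set p.2) (orbit_set p.1) :=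
  \sum_(c \in [set: weight])
    (hom_comp t (g (p.1, c)) (f (c, p.2)) :
       perm_hom k (orbit_set p.2) (orbit_set p.1)).

Fact schur_mul_subproof (g f : schur) :
  finite_set [set p | schur_mul_val g f p != 0].
Proof.
have F : finite_set (((fst @` [set p | g p != 0])
    `*` (snd @` [set p | f p != 0])) : set (weight * weight)).
  by apply: finite_setX; apply/finite_image/dsum_fin.
apply: (sub_finite_set _ F) => -[d b] /= S0.
have [c cN0] : exists c, (hom_comp t (g (d, c)) (f (c, b)) :
    perm_hom k (orbit_set b) (orbit_set d)) != 0.
  apply: contrapT => /forallNP c0; case/eqP: S0; apply: fsbig1 => c _.
  by apply/eqP/negPn/negP/c0.
split; [exists (d, c) => //|exists (c, b) => //];
  by apply: contra_neq cN0 => ->; rewrite ?hom_compEl0 ?hom_compEr0.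
Qed.
Definition schur_mul (g f : schur) : schur := Dsum (schur_mul_subproof g f).

Definition schur_one (b : weight) : schur :=
  dsum_in (j := (b, b)) (hom_id k (orbit_set b)).

(* The elements sigma that define the orbit attached to q. *)
Definition realizes (d b : weight) (q : nat -> nat -> k) : set Sinf :=
  [set s | forall i j, (i, j) != (0%N, 0%N) ->
    exists2 m : nat, block d i `&` (s @` block b j) #= `I_m & q i j = m%:R].

Definition young_coset (b : weight) (s : Sinf) : orbit_set b :=
  fs_act s (coset_base (young b) : orbit_set b).

Definition xi_fun (d b : weight) (q : nat -> nat -> k)
    (yx : orbit_set d * orbit_set b) : k :=
  (`[< exists2 s, realizes d b q s & exists g : Sinf,
       yx.1 = fs_act g (young_coset d 1%g) /\
       yx.2 = fs_act g (young_coset b s) >])%:R.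

Fact xi_subproof d b q :
  @xi_fun d b q \in @hom_pred k (orbit_set b) (orbit_set d).
Proof.
rewrite unfold_in; apply/asboolP => h y x; congr (_%:R).
congr (nat_of_bool _); apply: asbool_equiv_eq; rewrite [_.1]/= [_.2]/=.
split => -[s sq [g [yE xE]]]; exists s => //.
  exists (h^-1 * g)%g; split.
    by rewrite fs_actM -[X in fs_act _ X]yE fs_actK.
  by rewrite fs_actM -[X in fs_act _ X]xE fs_actK.
by exists (h * g)%g; split; rewrite fs_actM; [rewrite [y]yE|rewrite [x]xE].
Qed.

(* xi_q in the summand Hom(X^b, X^d), for q with row sums d, column sums b. *)
Definition xi (d b : weight) (q : nat -> nat -> k) : schur :=
  dsum_in (j := (d, b)) (PermHom (xi_subproof d b q)).

Definition Xset (l b : weight) : set schur :=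
  [set xi l b r | r in [set r | is_mat l b r /\ semistandard l r]].

Definition Yset (d l : weight) : set schur :=
  [set xi d l q | q in [set q | is_mat d l q /\ semistandard l (transpose q)]].

End Combinatorics.

(* Main.v *)
From HB Require Import structures.
From mathcomp Require Import all_boot all_order all_algebra fingroup perm.
Require Import Defs.
From mathcomp Require Import all_classical.
From mathcomp Require Import zify ring.

(* A point of [X^b] is a labelling of the natural numbers with finitely many
   nonzero labels and prescribed numbers of labels [1, 2, ...], and a morphism
   is a function of the matrix that counts the pairs of labels. Integrals are
   values at [t] of polynomials whose values at large integers [p] are finite
   sums over the labellings supported in [[0, p)], so associativity of the
   composition reduces to an exchange of finite sums.

   Spanning: a matrix [T] that is not semistandard in the rows [a] and [a+1]
   satisfies [sum_(j <= r) T (a+1) j > sum_(j < r) T a j] for some [r]. Moving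
   the entries [>= r] of row [a] and the entries [<= r] of row [a+1] to a new
   row (to row 0 if [a = 0]) factors [xi_T] through a larger weight, up to
   matrices with a larger [sum i * j * T i j]; the coefficients do not
   involve [t], because row 0 is never split.

   Independence: antisymmetrize over the column stabilizer of the diagram of a
   weight [l] of maximal depth [sum i * l i] in the relation. Only labellings
   that are injective on columns survive, which kills all other weights and
   makes the contribution of [l] a tensor product of two matrices that are
   unitriangular for [sum i * j * T i j] by the rearrangement inequality. *)

Set Implicit Arguments.
Unset Strict Implicit.
Unset Printing Implicit Defensive.

Import GRing.Theory.
Local Open Scope classical_set_scope.
Local Open Scope card_scope.
Local Open Scope ring_scope.

(** * Labellings of the natural numbers *)

(** The entry (0, 0) of a matrix counts infinitely many points, so counting matrices hold 0 there
    and the true entry is recovered from [t]; row 0 likewise has weight 0 in every statistic. The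
    row created by straightening may lie outside [1, n], so the spanning argument passes through
    weights of unlimited range [None]. Nothing is lost: a semistandard matrix is upper triangular,
    hence the middle weight of a semistandard pair has no rows outside the range of the outer
    weights. Straightening is applied to arbitrary composites, since f = f o id makes every morphism
    a composite and since the two factors are treated in turn, the second by transposition.
    Termination: the middle weight either loses size, or keeps it and gains [wpow], which is bounded
    in terms of the size; a middle weight that is not dominant is sorted by swaps of adjacent rows,
    which lower its depth. Depth also drives independence: labels that are distinct within each
    column sum to at least the depth of [l], with equality only for column permutations of the base
    labelling. *)

Lemma sum_iota (F : nat -> nat) p :
  (\sum_(0 <= u < p) F u = \sum_(u <- iota 0 p) F u)%N.
Proof. by rewrite /index_iota subn0. Qed.

Lemma sum_nat_widen (F : nat -> nat) p p' : (p <= p')%N ->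
  (forall u, p <= u -> F u = 0)%N -> (\sum_(0 <= u < p') F u = \sum_(0 <= u < p) F u)%N.
Proof.
move=> pp' F0; rewrite (@big_cat_nat _ _ _ p)//=.
by rewrite [X in (_ + X)%N]big1_seq ?addn0// => u; rewrite mem_index_iota => /andP[_ /andP[/F0]].
Qed.

(** Only nonzero terms are matched, so [g] need not carry the first initial segment to the second
    and the two bounds are independent. *)
Lemma sum_nat_transport (F F' : nat -> nat) p p' (g : Sinf) :
  (forall u, p <= u -> F u = 0)%N -> (forall u, p' <= u -> F' u = 0)%N ->
  (forall u, F' (g u) = F u) -> (\sum_(0 <= u < p) F u = \sum_(0 <= u < p') F' u)%N.
Proof.
move=> F0 F'0 gF; rewrite !sum_iota.
rewrite (bigID (fun u => F u == 0%N)) [RHS](bigID (fun u => F' u == 0%N)) /=.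
rewrite big1 => [|u /eqP//]; rewrite [in RHS]big1 => [|u /eqP//]; rewrite !add0n.
rewrite -[LHS]big_filter -[RHS]big_filter.
have P : perm_eq (map g [seq u <- iota 0 p | F u != 0%N]) [seq u <- iota 0 p' | F' u != 0%N].
  apply: uniq_perm; rewrite ?filter_uniq ?iota_uniq//.
    by rewrite (map_inj_uniq (@sinf_inj g)) filter_uniq ?iota_uniq.
  move=> u; rewrite mem_filter mem_iota add0n; apply/mapP/idP => [[v]|/andP[F'u /= u'] ].
    rewrite mem_filter mem_iota => /andP[Fv _] ->; rewrite gF Fv /= ltnNge.
    by apply: contra_neqN Fv => /F'0; rewrite gF.
  exists (g^-1%g u); last by rewrite [RHS](sinf_invK g).
  have F'E : F (g^-1%g u) = F' u by rewrite -gF; congr F'; apply: (sinf_invK g).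
  rewrite mem_filter mem_iota F'E F'u /= add0n ltnNge.
  by apply: contra_neqN F'u => /F0; rewrite F'E.
by rewrite -(perm_big _ P) big_map; apply: eq_bigr => u _; rewrite gF.
Qed.

Lemma sinf_of_iota p0 m Is : perm_eq Is (iota 0 m) -> exists g : Sinf,
  forall u, g u = if (p0 <= u < p0 + m)%N then (p0 + nth 0 Is (u - p0))%N else u.
Proof.
move=> P; have sI : size Is = m by rewrite (perm_size P) size_iota.
have uI : uniq Is by rewrite (perm_uniq P) iota_uniq.
have mI x : (x \in Is) = (x < m)%N by rewrite (perm_mem P) mem_iota.
pose f u := if (p0 <= u < p0 + m)%N then (p0 + nth 0 Is (u - p0))%N else u.
pose f' u := if (p0 <= u < p0 + m)%N then (p0 + index (u - p0)%N Is)%N else u.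
have fK : cancel f f'.
  move=> u; rewrite /f; case: ifPn => [/andP[h1 h2]|h]; last by rewrite /f' (negPf h).
  have h3 : (u - p0 < size Is)%N by lia.
  have : nth 0 Is (u - p0) \in Is by apply: mem_nth.
  rewrite mI => h4; rewrite /f' leq_addr ltn_add2l h4 /= addKn index_uniq//; lia.
have f'K : cancel f' f.
  move=> u; rewrite /f'; case: ifPn => [/andP[h1 h2]|h]; last by rewrite /f (negPf h).
  have h3 : (u - p0)%N \in Is by rewrite mI; lia.
  have h4 : (index (u - p0)%N Is < m)%N by rewrite -sI index_mem.
  by rewrite /f leq_addr ltn_add2l h4 /= addKn nth_index//; lia.
by exists (MkSinf fK f'K).
Qed.

(** The multiplicity of [c0] is forced by the common length. In the applications [c0] is the label
    that occurs infinitely often. *)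
Lemma perm_eq_off (C : eqType) (c0 : C) (s t : seq C) : size s = size t ->
  (forall c, c != c0 -> count_mem c s = count_mem c t) -> perm_eq s t.
Proof.
move=> st E.
have P : perm_eq [seq c <- s | c != c0] [seq c <- t | c != c0].
  apply/allP => c _ /=; rewrite !count_filter.
  have [->|cc0] := eqVneq c c0.
    by rewrite !(eq_count (a2 := pred0)) ?count_pred0// => x /=; case: eqVneq.
  rewrite !(eq_count (a2 := pred1 c)) ?E// => x /=;
    by case: eqVneq => // ->; rewrite cc0.
apply/allP => c _ /=; have [->|/E->//] := eqVneq c c0.
have E' : count (predC (pred1 c0)) s = count (predC (pred1 c0)) t.
  by have := perm_size P; rewrite !size_filter.
apply/eqP/(@addIn (count (predC (pred1 c0)) s)).
by rewrite /= {2}E' [LHS]count_predC [RHS]count_predC.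
Qed.

Lemma count_mem_map_iota (C : eqType) (L : nat -> C) c p :
  count_mem c (map L (iota 0 p)) = (\sum_(0 <= u < p) (L u == c))%N.
Proof.
rewrite count_map sum_iota -sum1_count big_mkcond /=.
by apply: eq_bigr => u _; case: (_ == _).
Qed.

(** Source of all conjugacy statements below. With natural numbers as labels it describes the orbits
    of [Sfix p0] on one set of labellings; with pairs of labels it classifies the orbits on
    pairs. *)
Lemma sinf_rearrange (C : eqType) (c0 : C) (L L' : nat -> C) p0 p :
  (p0 <= p)%N ->
  (forall u, (p <= u)%N -> L u = c0) -> (forall u, (p <= u)%N -> L' u = c0) ->
  (forall u, (u < p0)%N -> L u = L' u) ->
  (forall c, c != c0 -> \sum_(0 <= u < p) (L u == c) = \sum_(0 <= u < p) (L' u == c))%N ->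
  exists g : Sinf, [/\ forall u, (u < p0)%N -> g u = u,
    forall u, (p <= u)%N -> g u = u & forall u, L' (g u) = L u].
Proof.
move=> p0p L0 L'0 LL' E.
pose s := map L (iota p0 (p - p0)); pose t := map L' (iota p0 (p - p0)).
have : perm_eq s t.
  apply: (@perm_eq_off _ c0); first by rewrite !size_map.
  move=> c /E; rewrite -!count_mem_map_iota.
  have -> : iota 0 p = iota 0 p0 ++ iota p0 (p - p0) by rewrite -iotaD subnKC.
  rewrite !map_cat !count_cat.
  have -> : map L (iota 0 p0) = map L' (iota 0 p0).
    by apply/eq_in_map => u; rewrite mem_iota => /andP[_ /LL'].
  by move=> /addnI.
move=> /(perm_iotaP c0)[Is]; rewrite size_map size_iota => P sE.
have [g gE] := sinf_of_iota p0 P.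
have sI : size Is = (p - p0)%N by rewrite (perm_size P) size_iota.
exists g; split=> u.
- by move=> u0; rewrite gE; case: ifP => //; lia.
- by move=> u0; rewrite gE; case: ifP => //; lia.
rewrite gE; case: ifP => [/andP[h1 h2]|h].
  have h3 : (u - p0 < p - p0)%N by lia.
  have : nth c0 s (u - p0) = nth c0 t (nth 0 Is (u - p0)).
    by rewrite sE (nth_map 0) ?sI.
  have : nth 0 Is (u - p0) \in Is by rewrite mem_nth ?sI.
  rewrite (perm_mem P) mem_iota add0n /= => h4.
  by rewrite !(nth_map 0) ?size_iota// !nth_iota// subnKC.
have [u0|u0] := ltnP u p0; first by rewrite LL'.
by rewrite L0 ?L'0//; lia.
Qed.

Definition supp_le p (L : nat -> nat) := forall u, (p <= u)%N -> L u = 0%N.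

Lemma supp_leW p p' L : (p <= p')%N -> supp_le p L -> supp_le p' L.
Proof. by move=> pp' Lp u /(leq_trans pp')/Lp. Qed.

Lemma sum_interval a b p : (a <= b <= p)%N ->
  (\sum_(0 <= u < p) (a <= u < b) = b - a)%N.
Proof.
move=> /andP[ab bp]; rewrite (@big_cat_nat _ _ _ a) ?(leq_trans ab bp)//=.
rewrite (@big_cat_nat _ _ _ b _ p)//=.
rewrite big1_seq => [|u]; last by rewrite mem_index_iota => /andP[_]; case: leqP => //; lia.
rewrite [X in (_ + (_ + X))%N]big1_seq => [|u]; last first.
  by rewrite mem_index_iota => /andP[_]; case: (ltnP u b); lia.
rewrite (eq_big_nat _ _ (F2 := fun=> 1%N)) => [|u ->//].
by rewrite sum_nat_const_nat; lia.
Qed.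

(** * Points of the orbits as labellings *)

Section Labels.
Variables (k : fieldType) (char0 : [pchar k] =i pred0) (t : k).

Lemma natr_inj (m p : nat) : (m%:R : k) = p%:R -> m = p.
Proof.
have N0 (q : nat) : (q%:R == 0 :> k) = (q == 0)%N by move/pcharf0P: char0 => ->.
wlog mp : m p / (m <= p)%N.
  by move=> H E; case: (leqP m p) => [|/ltnW] h; [exact: H|exact/esym/H].
move=> E; apply/eqP; rewrite eqn_leq mp /=.
by rewrite -subn_eq0 -N0 natrB// E subrr.
Qed.

Lemma natvalE (m : nat) : natval (m%:R : k) = m.
Proof.
rewrite /natval; case: pselect => [ex|]; last by case; exists m.
by case: ex_minnP => p /eqP/natr_inj.
Qed.

Section Weight.
Variable n : option nat.
Implicit Types b : weight n t.

Definition tw b i := natval (b i).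

Lemma twE b i : (0 < i)%N -> b i = (tw b i)%:R.
Proof. by move=> /(weight_nat b)[m mE]; rewrite /tw mE natvalE. Qed.

Lemma weight_bound b : exists K, (0 < K)%N /\ forall i, (K <= i)%N -> b i = 0.
Proof.
have /finite_seqP[s sE] := weight_fin b.
exists (\max_(i <- s) i).+1; split=> // i iK; apply/eqP/negPn/negP => bi.
have : [set` s] i by rewrite -sE.
move=> /= si; have := @leq_bigmax_seq _ s predT id i si isT.
by move=> /(leq_trans iK); rewrite ltnn.
Qed.
Definition wK b := sval (cid (weight_bound b)).
Lemma wK_gt0 b : (0 < wK b)%N. Proof. by have [] := svalP (cid (weight_bound b)). Qed.
Lemma wKP b i : (wK b <= i)%N -> b i = 0.
Proof. by have [_] := svalP (cid (weight_bound b)); apply. Qed.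
Lemma tw_wK b i : (wK b <= i)%N -> tw b i = 0%N.
Proof. by rewrite /tw => /wKP ->; rewrite natval0. Qed.

Definition off b i := (\sum_(1 <= j < i) tw b j)%N.

Lemma offS b i : (0 < i)%N -> off b i.+1 = (off b i + tw b i)%N.
Proof. by move=> i0; rewrite /off big_nat_recr. Qed.

Lemma off_mono b i j : (i <= j)%N -> (off b i <= off b j)%N.
Proof.
move=> ij; case: i ij => [|i] ij; first by rewrite /off big_geq.
by rewrite [leqRHS](@big_cat_nat _ _ _ i.+1)//= leq_addr.
Qed.

(** The number of points with a nonzero base label; they are exactly the points below [wM b]. *)
Definition wM b := off b (wK b).

Lemma off_le_wM b i : (off b i <= wM b)%N.
Proof.
have [/off_mono//|Ki] := leqP i (wK b).
rewrite /off (@big_cat_nat _ _ _ (wK b)) ?wK_gt0 ?(ltnW Ki)//=.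
rewrite [X in (_ + X)%N]big1_seq ?addn0// => j.
by rewrite mem_index_iota => /andP[_ /andP[/tw_wK]].
Qed.

Lemma tail_blockE b i u : tail_block b i u <-> (off b i <= u < off b i.+1)%N.
Proof. by split => [[h1 h2]|/andP[h1 h2]]; [apply/andP|]. Qed.

(** The index of the block containing [u]; the default value 0 is the correct answer on the infinite
    block. *)
Definition lab0 b u : nat := xget 0%N [set i | (0 < i)%N /\ tail_block b i u].

Lemma lab0_off b i u : (0 < i)%N -> (off b i <= u < off b i.+1)%N -> lab0 b u = i.
Proof.
move=> i0 iu; apply: xget_unique; first by split=> //; apply/tail_blockE.
move=> j [j0 /tail_blockE] ju.
case: (ltngtP i j) => // ij; [have := off_mono b ij|have := off_mono b ij]; lia.
Qed.

Lemma lab0P b i u : (0 < i)%N -> (lab0 b u == i) = (off b i <= u < off b i.+1)%N.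
Proof.
move=> i0; apply/eqP/idP => [|/lab0_off]; last exact.
rewrite /lab0; case: xgetP => [j _ [j0 /tail_blockE h] <-//|_ i0'].
by rewrite -i0' in i0.
Qed.

Lemma blockE b i u : block b i u <-> lab0 b u = i.
Proof.
rewrite /block; case: (posnP i) => [->|i0].
  split=> h; last first.
    case=> j j0 /tail_blockE ju; have := lab0_off j0 ju; rewrite h => j0'.
    by move: j0; rewrite -j0' /= ltnn.
  have [//|l0] := posnP (lab0 b u).
  exfalso; apply: h; exists (lab0 b u) => //.
  by apply/tail_blockE; rewrite -lab0P.
by split=> [/tail_blockE/lab0_off->//|/eqP]; rewrite lab0P// => /tail_blockE.
Qed.

Lemma lab0_mem b u : (0 < lab0 b u)%N ->
  (off b (lab0 b u) <= u < off b (lab0 b u).+1)%N.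
Proof. by move=> l0; rewrite -lab0P. Qed.

Lemma lab0_supp b : supp_le (wM b) (lab0 b).
Proof.
move=> u Mu; have [//|l0] := posnP (lab0 b u).
have /andP[_] := lab0_mem l0; by have := off_le_wM b (lab0 b u).+1; lia.
Qed.

Lemma lab0_lt b u : (u < wM b)%N -> (0 < lab0 b u)%N.
Proof.
suff H K : (u < off b K)%N -> (0 < lab0 b u)%N by apply: H.
elim: K => [|K IH]; first by rewrite /off big_geq.
have [->|K0] := posnP K; first by rewrite /off big_geq.
have [/IH//|uK u'K] := ltnP u (off b K).
by rewrite (lab0_off K0) ?uK.
Qed.

Lemma lab0_count b i p : (wM b <= p)%N -> (0 < i)%N ->
  (\sum_(0 <= u < p) (lab0 b u == i) = tw b i)%N.
Proof.
move=> Mp i0; under eq_bigr do rewrite lab0P//.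
rewrite sum_interval ?offS ?addKn// leq_addr -offS//=.
exact: leq_trans (off_le_wM b i.+1) Mp.
Qed.

Lemma youngE b g : young b g <-> forall u, lab0 b (g u) = lab0 b u.
Proof.
split=> [gb u|gb i].
  by apply/blockE; rewrite -gb; exists u => //; apply/blockE.
apply/seteqP; split=> [_ [u /blockE ui <-]|u /blockE ui].
  by apply/blockE; rewrite gb.
exists (g^-1%g u); last exact: (sinf_invK g).
by apply/blockE; rewrite -gb [g _](sinf_invK g).
Qed.

(** The coset of g labels [u] by the block of its preimage under g. The representative is chosen,
    and [lab_coset] shows that any other gives the same label. *)
Definition lab b (y : orbit_set b) u : nat :=
  lab0 b ((sval (cid (coset_valP y)))^-1%g u).

Lemma lab_coset b (y : orbit_set b) g u : coset_val y = lcoset g (young b) ->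
  lab y u = lab0 b (g^-1%g u).
Proof.
rewrite /lab; case: cid => g' /= -> E.
have : lcoset g (young b) g by exists 1%g; [exact: young1|rewrite mulg1].
rewrite -E => -[h /youngV/youngE hb <-].
exact: esym (hb _).
Qed.

Lemma lab_young_coset b g u : lab (young_coset b g) u = lab0 b (g^-1%g u).
Proof. exact: lab_coset. Qed.

Lemma lab_act b (y : orbit_set b) g u : lab (fs_act g y) u = lab y (g^-1%g u).
Proof.
have [h hE] := coset_valP y.
rewrite (lab_coset _ hE) (@lab_coset _ _ (g * h)%g) ?invgM//.
by rewrite lcosetM -hE.
Qed.

Lemma lab_inj b (y y' : orbit_set b) : lab y =1 lab y' -> y = y'.
Proof.
have [g gE] := coset_valP y; have [g' g'E] := coset_valP y' => E.
apply: coset_eq; rewrite gE g'E.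
have : young b (g^-1 * g')%g.
  apply/youngE => u; rewrite -[LHS]/(lab0 b (g^-1%g (g' u))).
  by rewrite -(lab_coset _ gE) E (lab_coset _ g'E) [_ (g' u)](sinf_funK g').
by move=> /young_lcoset h; rewrite -{1}h -lcosetM mulgA mulgV mul1g.
Qed.

Lemma lab_supp_ex b (y : orbit_set b) : exists p, supp_le p (lab y).
Proof.
have [g gE] := coset_valP y.
exists (\max_(u < wM b) (g u)).+1 => u; rewrite (lab_coset _ gE) => up.
apply: lab0_supp; rewrite leqNgt; apply/negP => h.
have := @leq_bigmax _ (fun v : 'I_(wM b) => g v) (Ordinal h).
by rewrite /= [g _](sinf_invK g) => /(leq_trans up); rewrite ltnn.
Qed.

Definition bnd b (y : orbit_set b) := sval (cid (lab_supp_ex y)).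
Lemma bndP b (y : orbit_set b) p : (bnd y <= p)%N -> supp_le p (lab y).
Proof. by move=> /supp_leW; apply; exact: svalP (cid (lab_supp_ex y)). Qed.

Lemma lab_count b (y : orbit_set b) p i : supp_le p (lab y) -> (0 < i)%N ->
  (\sum_(0 <= u < p) (lab y u == i) = tw b i)%N.
Proof.
have [g gE] := coset_valP y => py i0.
rewrite -(@lab0_count b i (wM b))//; apply/esym/(@sum_nat_transport _ _ _ _ g) => u.
- by move=> /lab0_supp ->; rewrite eq_sym eqn0Ngt i0.
- by move=> /py ->; rewrite eq_sym eqn0Ngt i0.
by rewrite (lab_coset _ gE) [_ (g u)](sinf_funK g).
Qed.

Lemma lab_lt_wK b (y : orbit_set b) u : (lab y u < wK b)%N.
Proof.
have [g gE] := coset_valP y; rewrite (lab_coset _ gE).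
have [->|l0] := posnP (lab0 b (g^-1%g u)); first exact: wK_gt0.
have := lab0_mem l0; rewrite ltnNge; case: leqP => // /tw_wK z; rewrite offS// z; lia.
Qed.

(** Converse of [lab_count]: together with [lab_inj] it identifies the orbit with the labellings
    that have the prescribed multiplicities. *)
Lemma lab_exists b (L : nat -> nat) p : supp_le p L ->
  (forall i, (0 < i)%N -> \sum_(0 <= u < p) (L u == i) = tw b i)%N ->
  exists y : orbit_set b, lab y =1 L.
Proof.
move=> pL Lb; pose q := maxn p (wM b).
have [| | | | |g [_ _ gE]] := @sinf_rearrange _ 0%N L (lab0 b) 0 q.
- by [].
- exact: supp_leW (leq_maxl _ _) pL.
- exact: supp_leW (leq_maxr _ _) (@lab0_supp b).
- by [].
- move=> i; rewrite -lt0n => i0; rewrite lab0_count ?leq_maxr// -Lb//.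
  apply: sum_nat_widen; first exact: leq_maxl.
  by move=> u /pL ->; rewrite eq_sym eqn0Ngt i0.
by exists (young_coset b g^-1%g) => u; rewrite lab_young_coset invgK.
Qed.

(** The conjugating permutation moves only points of [p0, p). The lower bound puts it in [Sfix p0],
    the upper bound lets it act on sums over labellings supported below [p]. *)
Lemma orbit_conj b (y y' : orbit_set b) p0 p : (p0 <= p)%N ->
  supp_le p (lab y) -> supp_le p (lab y') ->
  (forall u, (u < p0)%N -> lab y u = lab y' u) ->
  exists g : Sinf, [/\ Sfix p0 g, forall u, (p <= u)%N -> g u = u & y' = fs_act g y].
Proof.
move=> p0p py py' E.
have [| | | | |g [g1 g2 g3]] := @sinf_rearrange _ 0%N (lab y) (lab y') p0 p => //.
  by move=> i; rewrite -lt0n => i0; rewrite !lab_count.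
exists g; split=> //; apply: lab_inj => u.
by rewrite lab_act -g3 [g _](sinf_invK g).
Qed.

Lemma lab_coset_base b u : lab (coset_base (young b) : orbit_set b) u = lab0 b u.
Proof. by rewrite (@lab_coset _ _ 1%g) ?invg1// lcoset1. Qed.

Lemma orbit_transitive b (y y' : orbit_set b) : exists g, y' = fs_act g y.
Proof.
have [| | |//|g [_ _ ->]] := @orbit_conj b y y' 0 (maxn (bnd y) (bnd y')).
- by [].
- by apply: bndP; rewrite leq_maxl.
- by apply: bndP; rewrite leq_maxr.
by exists g.
Qed.

End Weight.

(** * Counting matrices and orbits on pairs *)

Section Cmat.
Variables (n1 n2 : option nat).
Implicit Types (d : weight n1 t) (b : weight n2 t).

(* The entry (0, 0), which would be infinite, is set to 0. *)
Definition cmat d b (y : orbit_set d) (x : orbit_set b) i j : nat :=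
  if (i, j) == (0, 0)%N then 0%N else
  (\sum_(0 <= u < maxn (bnd y) (bnd x)) ((lab y u == i) && (lab x u == j)))%N.

Lemma cmat00 d b (y : orbit_set d) (x : orbit_set b) : cmat y x 0 0 = 0%N.
Proof. by []. Qed.

Lemma supp_pair (L L' : nat -> nat) p i j : supp_le p L -> supp_le p L' ->
  (i, j) != (0, 0)%N -> forall u, (p <= u)%N ->
  nat_of_bool ((L u == i) && (L' u == j)) = 0%N.
Proof. by move=> pL pL' ij u pu; rewrite pL// pL'//; case: i j ij => [|?] [|?]. Qed.

Lemma cmatE d b (y : orbit_set d) (x : orbit_set b) p i j :
  supp_le p (lab y) -> supp_le p (lab x) -> (i, j) != (0, 0)%N ->
  cmat y x i j = (\sum_(0 <= u < p) ((lab y u == i) && (lab x u == j)))%N.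
Proof.
move=> py px ij; rewrite /cmat (negPf ij); set q := maxn _ _.
have qy : supp_le q (lab y) by apply: bndP; rewrite leq_maxl.
have qx : supp_le q (lab x) by apply: bndP; rewrite leq_maxr.
case: (leqP p q) => [pq|/ltnW qp].
  by apply: sum_nat_widen => //; apply: supp_pair.
by apply/esym/sum_nat_widen => //; apply: supp_pair.
Qed.

Lemma cmat_act d b (y : orbit_set d) (x : orbit_set b) g :
  cmat (fs_act g y) (fs_act g x) = cmat y x.
Proof.
apply/funext => i; apply/funext => j.
have [/eqP[-> ->]|ij] := boolP ((i, j) == (0, 0)%N); first by rewrite !cmat00.
rewrite (@cmatE _ _ (fs_act g y) _ (maxn (bnd (fs_act g y)) (bnd (fs_act g x))))//;
  try by apply: bndP; rewrite ?leq_maxl ?leq_maxr.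
rewrite (@cmatE _ _ y _ (maxn (bnd y) (bnd x)))//;
  try by apply: bndP; rewrite ?leq_maxl ?leq_maxr.
apply/esym/(@sum_nat_transport _ _ _ _ g).
- by apply: supp_pair ij; apply: bndP; rewrite ?leq_maxl ?leq_maxr.
- by apply: supp_pair ij; apply: bndP; rewrite ?leq_maxl ?leq_maxr.
by move=> u; rewrite !lab_act [_ (g u)](sinf_funK g).
Qed.

(** The matrix lists the multiplicities of all pairs of labels except (0, 0), which is what
    [sinf_rearrange] needs for the labelling by pairs. *)
Lemma cmat_conj d b (y y' : orbit_set d) (x x' : orbit_set b) :
  cmat y x = cmat y' x' -> exists g, y' = fs_act g y /\ x' = fs_act g x.
Proof.
move=> E; pose p := maxn (maxn (bnd y) (bnd x)) (maxn (bnd y') (bnd x')).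
have [py px py' px'] : [/\ supp_le p (lab y), supp_le p (lab x),
    supp_le p (lab y') & supp_le p (lab x')].
  by split; apply: bndP; rewrite !leq_max leqnn ?orbT.
have [| | | | |g [_ _ gE]] := @sinf_rearrange _ (0, 0)%N
  (fun u => (lab y u, lab x u)) (fun u => (lab y' u, lab x' u)) 0 p.
- by [].
- by move=> u pu; rewrite py// px.
- by move=> u pu; rewrite py'// px'.
- by [].
- move=> [i j] ij; have := congr1 (fun m => m i j) E.
  by rewrite !(@cmatE _ _ _ _ p).
exists g; split; apply: lab_inj => u; rewrite lab_act;
  by have := gE (g^-1%g u); rewrite [g _](sinf_invK g) => -[].
Qed.

Lemma cmat_eq0 d b (y : orbit_set d) (x : orbit_set b) i j : (i, j) != (0, 0)%N ->
  cmat y x i j = 0%N <-> forall u, ~ (lab y u = i /\ lab x u = j).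
Proof.
move=> ij; pose p := maxn (bnd y) (bnd x).
have [py px] : supp_le p (lab y) /\ supp_le p (lab x).
  by split; apply: bndP; rewrite ?leq_maxl ?leq_maxr.
rewrite (cmatE py px ij); split=> [/eqP|H]; last first.
  rewrite big1// => u _; case: andP => // -[/eqP h1 /eqP h2].
  by case: (H u).
rewrite sum_nat_seq_eq0 => /allP H u [ui uj].
case: (leqP p u) => [pu|up].
  by have := supp_pair py px ij pu; rewrite ui uj !eqxx.
by have := H u; rewrite mem_index_iota up ui uj !eqxx => /(_ isT).
Qed.

End Cmat.

Lemma cmat_tr n1 n2 (d : weight n1 t) (b : weight n2 t) (y : orbit_set d)
  (x : orbit_set b) i j : cmat x y j i = cmat y x i j.
Proof.
rewrite /cmat maxnC !xpair_eqE andbC; case: ifP => // _.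
by apply: eq_bigr => u _; rewrite andbC.
Qed.

(** The weights may differ in their range: this compares a weight of range [n] with its copy of
    range [None]. *)
Lemma eq_cmat n1 n1' n2 n2' (d : weight n1 t) (d' : weight n1' t) (b : weight n2 t)
    (b' : weight n2' t) (y : orbit_set d) (y' : orbit_set d') (x : orbit_set b)
    (x' : orbit_set b') :
  lab y =1 lab y' -> lab x =1 lab x' -> cmat y x = cmat y' x'.
Proof.
move=> yy' xx'; apply/funext => i; apply/funext => j.
have [/eqP[-> ->]|ij] := boolP ((i, j) == (0, 0)%N); first by rewrite !cmat00.
pose p := maxn (bnd y) (bnd x).
have [py px] : supp_le p (lab y) /\ supp_le p (lab x).
  by split; apply: bndP; rewrite ?leq_maxl ?leq_maxr.
rewrite (cmatE py px ij) (@cmatE _ _ _ _ y' x' p)//.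
- by apply: eq_bigr => u _; rewrite yy' xx'.
- by move=> u; rewrite -yy'; apply: py.
by move=> u; rewrite -xx'; apply: px.
Qed.

Lemma sum_delta (K a : nat) : (a < K)%N -> (\sum_(0 <= j < K) (a == j) = 1)%N.
Proof.
move=> aK; rewrite (bigD1_seq a) ?mem_index_iota ?iota_uniq//= eqxx big1// => j.
by rewrite eq_sym => /negPf ->.
Qed.

Lemma cmat_row n1 n2 (d : weight n1 t) (b : weight n2 t) (y : orbit_set d)
  (x : orbit_set b) i K : (0 < i)%N -> (wK b <= K)%N ->
  (\sum_(0 <= j < K) cmat y x i j = tw d i)%N.
Proof.
move=> i0 bK; pose p := maxn (bnd y) (bnd x).
have [py px] : supp_le p (lab y) /\ supp_le p (lab x).
  by split; apply: bndP; rewrite ?leq_maxl ?leq_maxr.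
rewrite -(lab_count py i0); under eq_bigr => j _.
  rewrite (cmatE py px); last by case: (i) i0.
  over.
rewrite exchange_big /=; apply: eq_bigr => u _.
case: eqP => _ /=; last by rewrite big1.
by apply: sum_delta; apply: leq_trans bK; apply: lab_lt_wK.
Qed.

Lemma cmat_col n1 n2 (d : weight n1 t) (b : weight n2 t) (y : orbit_set d)
  (x : orbit_set b) j K : (0 < j)%N -> (wK d <= K)%N ->
  (\sum_(0 <= i < K) cmat y x i j = tw b j)%N.
Proof.
by move=> j0 dK; under eq_bigr do rewrite -cmat_tr; apply: cmat_row.
Qed.

End Labels.

(** * Counting polynomials *)

Definition bin_poly (j : nat) : {poly rat} :=
  (j`!%:R)^-1 *: \prod_(0 <= i < j) ('X - (i%:R)%:P).

Lemma ffact_poly (j m : nat) :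
  (\prod_(0 <= i < j) ('X - (i%:R)%:P) : {poly rat}).[m%:R] = (m ^_ j)%:R.
Proof.
elim: j => [|j IH]; first by rewrite big_geq// hornerC.
rewrite big_nat_recr//= hornerM IH !hornerE ffactnSr natrM.
have [jm|mj] := leqP j m; first by rewrite natrB.
by rewrite ffact_small// !mul0r.
Qed.

Lemma bin_polyE j m : (bin_poly j).[m%:R] = ('C(m, j))%:R.
Proof.
rewrite /bin_poly hornerZ ffact_poly -bin_ffact natrM mulrC mulfK//.
by rewrite Num.Theory.pnatr_eq0 -lt0n fact_gt0.
Qed.

Lemma size_bin_poly j : size (bin_poly j) = j.+1.
Proof.
rewrite /bin_poly size_scale ?size_prod_XsubC ?size_iota ?subn0//.
by rewrite invr_eq0 Num.Theory.pnatr_eq0 -lt0n fact_gt0.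
Qed.

(** By Pascal's rule, summation sends the binomial polynomial of degree N to the one of degree N +
    1; the induction removes the leading term of [Q] with a multiple of [bin_poly N]. *)
Lemma poly_antidifference (Q : {poly rat}) : exists P : {poly rat},
  forall m : nat, P.[m%:R] = \sum_(0 <= j < m) Q.[j%:R].
Proof.
have [N] := ubnP (size Q); elim: N Q => // N IH Q; rewrite ltnS => sQ.
case: N => [|N] in IH sQ *.
  exists 0 => m; rewrite big1 ?horner0// => j _.
  by move: sQ; rewrite leqn0 size_poly_eq0 => /eqP ->; rewrite horner0.
pose c := Q`_N / (bin_poly N)`_N.
have bN : (bin_poly N)`_N != 0.
  have -> : (bin_poly N)`_N = lead_coef (bin_poly N).
    by rewrite lead_coefE size_bin_poly.
  by rewrite lead_coef_eq0 -size_poly_eq0 size_bin_poly.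
have [|P PE] := IH (Q - c *: bin_poly N).
  rewrite ltnS; apply/leq_sizeP => j; rewrite leq_eqVlt => /predU1P[<-|Nj].
    by rewrite coefB coefZ divfK// subrr.
  rewrite coefB coefZ !nth_default ?mulr0 ?subr0//; first by rewrite size_bin_poly.
  exact: leq_trans sQ Nj.
exists (P + c *: bin_poly N.+1) => m.
rewrite hornerD PE hornerZ bin_polyE.
elim: m => [|m IHm]; first by rewrite !big_geq//= mulr0 addr0.
rewrite !big_nat_recr//= -IHm binS natrD hornerD hornerN hornerZ bin_polyE; ring.
Qed.

(** Labellings of m points: letter 0 is unrestricted and letter i, for i in 1..K, occurs r i times.
    Recursion on the first letter displays the difference equation for their number. *)
Fixpoint words (K m : nat) (r : nat -> nat) : seq (seq nat) :=
  if m is m'.+1 then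
    [seq 0%N :: s | s <- words K m' r] ++
    flatten [seq [seq i :: s | s <- words K m' (fun j => r j - (i == j))%N]
      | i <- [seq i <- iota 1 K | (0 < r i)%N] ]
  else if all (fun i => r i == 0%N) (iota 1 K) then [:: [::] ] else [::].

Lemma mem_words K m r s : (s \in words K m r) =
  [&& size s == m, all (fun i => i <= K)%N s &
      all (fun i => count_mem i s == r i) (iota 1 K)].
Proof.
elim: m r s => [|m IH] r s /=.
  case: s => [|i s] /=; last by case: ifP.
  rewrite (eq_all (a2 := fun i => r i == 0%N)) => [|i]; last by rewrite eq_sym.
  by case: ifP.
rewrite mem_cat; case: s => [|i s].
  rewrite andFb; apply/negbTE/negP => /orP[/mapP[]//|/flattenP[x /mapP[j _ ->] /mapP[]//]].
rewrite /= eqSS; have [->|i0] := posnP i.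
  rewrite mem_map => [|a b []//]; rewrite IH.
  have -> : (0%N :: s \in flatten [seq [seq i0 :: s0 | s0 <- words K m (fun j => (r j - (i0 == j))%N)]
      | i0 <- [seq i0 <- iota 1 K | (0 < r i0)%N] ]) = false.
    apply/negP => /flattenP[x /mapP[j + ->] /mapP[w _ [E _]]].
    by rewrite mem_filter mem_iota -E => /and3P[].
  rewrite orbF leq0n /=; congr [&& _, _ & _]; apply: eq_in_all => j.
  by rewrite mem_iota; case: j.
have -> : (i :: s \in [seq 0%N :: s0 | s0 <- words K m r]) = false.
  by apply/negP => /mapP[w _ [E _]]; rewrite E in i0.
rewrite orFb; apply/flattenP/idP => [[_ /mapP[j + ->] /mapP[w + [-> ->]]]|].
  rewrite mem_filter mem_iota IH => /andP[rj jK] /and3P[-> -> /allP H] /=.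
  rewrite (_ : j <= K)%N /=; last by lia.
  apply/allP => a aK; have /= /eqP -> := H a aK.
  by case: (eqVneq j a) => [<-|_]; lia.
case/and3P => sm /andP[iK sK] /allP H.
have iI : i \in iota 1 K by rewrite mem_iota; lia.
have ri : (0 < r i)%N by have /= := H i iI; rewrite eqxx => /eqP <-.
exists [seq i :: s0 | s0 <- words K m (fun j => (r j - (i == j))%N)].
  by apply/mapP; exists i => //; rewrite mem_filter ri.
apply/mapP; exists s => //; rewrite IH sm sK /=.
by apply/allP => a aK; have /= /eqP <- := H a aK; rewrite addKn.
Qed.

Lemma uniq_words K m r : uniq (words K m r).
Proof.
elim: m r => [|m IH] r /=; first by case: ifP.
rewrite cat_uniq map_inj_uniq ?IH => [|a b []//] /=; apply/andP; split.
  apply/hasPn => _ /flattenP[_ /mapP[j + ->] /mapP[w _ ->]].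
  rewrite mem_filter mem_iota => /and3P[_ j0 _]; apply/negP => /mapP[v _ [E _]].
  by rewrite E in j0.
have : uniq [seq i <- iota 1 K | (0 < r i)%N] by rewrite filter_uniq ?iota_uniq.
elim: [seq i <- iota 1 K | _] => //= i l IHl /andP[il /IHl ul].
rewrite cat_uniq map_inj_uniq ?IH => [|a b []//]; rewrite ul andbT /=.
apply/hasPn => _ /flattenP[_ /mapP[j jl ->] /mapP[w _ ->]].
by apply/negP => /mapP[v _ [E _]]; rewrite -E jl in il.
Qed.

(* [size (words K m r)], as a function of m, has a difference that is a sum of
   terms of the same kind with smaller r. *)
Lemma words_poly K r : exists P : {poly rat},
  forall m : nat, P.[m%:R] = (size (words K m r))%:R.
Proof.
have [N] := ubnP (\sum_(i <- iota 1 K) r i); elim: N r => // N IH r; rewrite ltnS => rN.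
have [Q QE] : exists Q : {poly rat}, forall m : nat,
    Q.[m%:R] = \sum_(i <- iota 1 K | (0 < r i)%N)
      (size (words K m (fun j => (r j - (i == j))%N)))%:R.
  have : all (mem (iota 1 K)) (iota 1 K) by apply/allP.
  elim: {2 3}(iota 1 K) => [_|i l IHl /= /andP[iK /IHl[Q QE]]].
    by exists 0 => m; rewrite big_nil horner0.
  have [ri|ri] := posnP (r i).
    by exists Q => m; rewrite QE big_cons ri ltnn.
  have [|P PE] := IH (fun j => (r j - (i == j))%N).
    apply: leq_trans rN; rewrite (bigD1_seq i)//= ?iota_uniq// eqxx.
    rewrite [ltnRHS](bigD1_seq i)//= ?iota_uniq//.
    rewrite (eq_bigr r) => [|j ji]; last by rewrite eq_sym (negPf ji) subn0.
    by lia.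
  by exists (P + Q) => m; rewrite hornerD big_cons ri QE PE.
have [P PE] := poly_antidifference Q.
exists (P + (size (words K 0 r))%:R%:P) => m; rewrite hornerD hornerC PE.
elim: m => [|m IHm]; first by rewrite big_geq// add0r.
rewrite big_nat_recr//= addrAC IHm QE size_cat size_map natrD; congr (_ + _).
rewrite size_flatten /shape sumnE !big_map big_filter natr_sum.
by apply: eq_bigr => i _; rewrite size_map.
Qed.

Definition choose_or T (x0 : T) (P : T -> Prop) : T :=
  if pselect (exists x, P x) is left ex then sval (cid ex) else x0.

Lemma choose_orP T (x0 : T) (P : T -> Prop) x : P x -> P (choose_or x0 P).
Proof.
move=> Px; rewrite /choose_or; case: pselect => [ex|[]]; last by exists x.
exact: svalP (cid ex).
Qed.

Lemma card_seq_set (T : eqType) (s : seq T) : uniq s -> [set` s] #= `I_(size s).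
Proof.
case: s => [|x0 s'] us.
  by rewrite (_ : [set` [::] ] = set0) ?II0//; apply/seteqP; split.
move: (x0 :: s') us => s us.
have -> : [set` s] = nth x0 s @` `I_(size s).
  apply/seteqP; split=> [x /= xs|_ [i /= si <-]]; last exact: mem_nth.
  by exists (index x s); rewrite /= ?index_mem// nth_index.
apply: inj_card_eq => i j; rewrite !inE /= => si sj /eqP.
by rewrite nth_uniq// => /eqP.
Qed.

(** * Rational polynomials over a field of characteristic zero *)

Section Char0.
Variables (k : fieldType) (char0 : [pchar k] =i pred0).

Lemma poly_nat_ext (P Q : {poly k}) N :
  (forall p : nat, (N <= p)%N -> P.[p%:R] = Q.[p%:R]) -> P = Q.
Proof.
move=> PQ; apply/eqP; rewrite -subr_eq0; apply/negPn/negP => PQ0.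
have := @max_poly_roots _ _ [seq i%:R | i <- iota N (size (P - Q))] PQ0.
rewrite size_map size_iota ltnn => H; apply: notF; apply: H.
  apply/allP => _ /mapP[i + ->]; rewrite mem_iota => /andP[Ni _].
  by rewrite rootE hornerD hornerN PQ// subrr.
by rewrite map_inj_uniq ?iota_uniq//; apply: natr_inj.
Qed.

Lemma intr_neq0 (z : int) : z != 0 -> z%:~R != 0 :> k.
Proof.
have H (m : nat) : m.+1%:R != 0 :> k by move/pcharf0P: char0 => ->.
by case: z => [[|m]|m] // _; rewrite ?NegzE ?mulrNz ?oppr_eq0; exact: H.
Qed.

Lemma ratr_frac (a b : int) : b != 0 -> ratr (a%:~R / b%:~R) = a%:~R / b%:~R :> k.
Proof.
move=> b0; set x := _ / _; rewrite /ratr.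
have bQ : b%:~R != 0 :> rat by rewrite intr_eq0.
have dk := intr_neq0 (denq_neq0 x); have bk := intr_neq0 b0.
apply/eqP; rewrite eqr_div// -!intrM; apply/eqP; congr (_%:~R).
apply: (@intr_inj rat); rewrite !intrM.
apply/eqP; rewrite -eqr_div ?intr_eq0 ?denq_eq0//.
by rewrite divq_num_den.
Qed.

(** [ratr] is defined by the reduced fraction; as nonzero integers are nonzero in [k], any fraction
    computes it ([ratr_frac]), and the morphism laws become arithmetic of fractions. *)
Lemma ratr_rmorphism : exists f : {rmorphism rat -> k}, f =1 ratr.
Proof.
have E (x : rat) : x = (numq x)%:~R / (denq x)%:~R by rewrite divq_num_den.
have dq (x : rat) : (denq x)%:~R != 0 :> rat by rewrite intr_eq0 denq_eq0.
have dk (x : rat) := intr_neq0 (denq_neq0 x).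
have ratrB : zmod_morphism (ratr : rat -> k).
  move=> x y; have -> : x - y = (numq x * denq y - numq y * denq x)%:~R /
      (denq x * denq y)%:~R.
    by rewrite {1}(E x) {1}(E y) -mulNr addf_div// intrB !intrM mulNr.
  rewrite ratr_frac ?mulf_neq0// /ratr -[in RHS]mulNr addf_div//.
  by rewrite intrB !intrM mulNr.
have ratrM : monoid_morphism (ratr : rat -> k).
  split=> [|x y]; first by have := @ratr_frac 1 1 isT; rewrite !divr1.
  have -> : x * y = (numq x * numq y)%:~R / (denq x * denq y)%:~R.
    by rewrite {1}(E x) {1}(E y) mulf_div !intrM.
  by rewrite ratr_frac ?mulf_neq0// /ratr mulf_div !intrM.
pose f : {rmorphism rat -> k} := HB.pack (ratr : rat -> k)
  (GRing.isZmodMorphism.Build _ _ _ ratrB) (GRing.isMonoidMorphism.Build _ _ _ ratrM).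
by exists f.
Qed.

Lemma ratr_poly_nat (P : {poly rat}) (m c : nat) :
  P.[m%:R] = c%:R -> (map_poly (ratr : rat -> k) P).[m%:R] = c%:R.
Proof.
have [f fE] := ratr_rmorphism => Pm.
by rewrite -(eq_map_poly fE) -(rmorph_nat f) horner_map Pm rmorph_nat.
Qed.

End Char0.

(** * Counting labellings with a given prefix *)

Section Integral.
Variables (k : fieldType) (char0 : [pchar k] =i pred0) (t : k) (n : option nat).
Variable b : weight n t.
Local Notation Y := (orbit_set b).

Lemma fixed_pointsE (A : set Y) p y :
  fixed_points A p y <-> A y /\ supp_le p (lab y).
Proof.
split=> -[Ay yp]; split=> //; last first; [move=> g gp|move=> u pu]; last first.
  (* Beyond [p] the point u may be exchanged, inside [Sfix p], with a point v known to have label 0;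
     invariance then gives u the same label. *)
  pose v := maxn p (bnd y).
  have v0 : lab y v = 0%N by apply: (@bndP _ _ _ _ y (bnd y)) => //; rewrite leq_maxr.
  have /yp : Sfix p (swap u v).
    move=> x /= xp; rewrite /swap_fun; case: eqP => [E|_]; first by lia.
    by case: eqP => // E; have := leq_maxl p (bnd y); lia.
  move=> /(congr1 (fun z => lab z v)); rewrite lab_act v0 /= /swap_fun.
  by case: eqP => [->//|_]; rewrite eqxx.
apply: lab_inj => u; rewrite lab_act; have [up|pu] := ltnP u p.
  congr lab; apply: (@sinf_inj g); rewrite [LHS](sinf_invK g).
  by rewrite gp.
rewrite [RHS]yp// yp// leqNgt; apply/negP => h.
by have := gp _ h; rewrite [g _](sinf_invK g) => E; rewrite -E in h; lia.
Qed.

(** Lists the fixed points of [Sfix p] as words of length p, with [yof] as inverse of reading the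
    labels. Labels are below [wK b], hence the largest letter. *)
Definition wseq p : seq (seq nat) := words (wK b).-1 p (tw b).

Definition yof (w : seq nat) : Y :=
  choose_or (coset_base (young b) : Y) (fun y : Y => lab y = nth 0%N w).

Lemma count_nth (s : seq nat) i p : size s = p ->
  (\sum_(0 <= u < p) (nth 0%N s u == i) = count_mem i s)%N.
Proof.
move=> sp; rewrite -count_mem_map_iota; congr count.
by rewrite -[RHS](mkseq_nth 0%N) /mkseq sp.
Qed.

Lemma lab_yof p w : w \in wseq p -> lab (yof w) = nth 0%N w.
Proof.
rewrite mem_words => /and3P[/eqP sw wK' /allP wc].
have [||y yE] := @lab_exists _ _ _ b (nth 0%N w) p.
- by move=> u pu; rewrite nth_default// sw.
- move=> i i0; rewrite count_nth//.
  have [iK|Ki] := leqP i (wK b).-1; first by apply/eqP/wc; rewrite mem_iota; lia.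
  rewrite tw_wK; last by move: Ki (wK_gt0 b); lia.
  by apply/count_memPn/negP => /(allP wK'); lia.
by apply: (@choose_orP _ _ (fun y : Y => lab y = nth 0%N w) y); apply/funext.
Qed.

Lemma wseq_lab p (y : Y) : supp_le p (lab y) -> map (lab y) (iota 0 p) \in wseq p.
Proof.
move=> py; rewrite mem_words size_map size_iota eqxx /=; apply/andP; split.
  by apply/allP => _ /mapP[u _ ->]; have := lab_lt_wK y u; lia.
apply/allP => i; rewrite mem_iota => /andP[i0 _].
by rewrite count_mem_map_iota lab_count.
Qed.

Lemma yof_lab p (y : Y) : supp_le p (lab y) -> yof (map (lab y) (iota 0 p)) = y.
Proof.
move=> py; apply: lab_inj => u; rewrite (lab_yof (wseq_lab py)).
have [up|pu] := ltnP u p; first by rewrite (nth_map 0%N) ?size_iota// nth_iota.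
by rewrite nth_default ?py// size_map size_iota.
Qed.

Lemma yof_inj p : {in wseq p &, injective yof}.
Proof.
move=> w w' wp w'p /(congr1 (@lab _ _ _ _)); rewrite (lab_yof wp) (lab_yof w'p) => E.
move: wp w'p; rewrite !mem_words => /and3P[/eqP sw _ _] /and3P[/eqP sw' _ _].
by apply: (@eq_from_nth _ 0%N) => [|i _]; rewrite ?sw ?E.
Qed.

Lemma supp_yof p w : w \in wseq p -> supp_le p (lab (yof w)).
Proof.
move=> wp u pu; rewrite (lab_yof wp) nth_default//.
by move: wp; rewrite mem_words => /and3P[/eqP ->].
Qed.

Lemma card_fixed_points (A : set Y) p :
  fixed_points A p #= `I_(count (fun w => `[< A (yof w) >]) (wseq p)).
Proof.
set s := [seq w <- wseq p | `[< A (yof w) >] ].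
have -> : count (fun w => `[< A (yof w) >]) (wseq p) = size s by rewrite size_filter.
have us : uniq s by rewrite filter_uniq// uniq_words.
apply: card_eq_trans (card_seq_set us).
have -> : fixed_points A p = yof @` [set` s].
  apply/seteqP; split=> [y /fixed_pointsE[Ay yp]|_ [w /= ws <-]].
    exists (map (lab y) (iota 0 p)); last exact: yof_lab.
    by rewrite /= mem_filter yof_lab// wseq_lab// andbT; apply/asboolP.
  move: ws; rewrite mem_filter => /andP[/asboolP Aw wp].
  by apply/fixed_pointsE; split=> //; apply: supp_yof.
apply: inj_card_eq => w w'; rewrite !inE /= !mem_filter => /andP[_ wp] /andP[_ w'p].
exact: yof_inj wp w'p.
Qed.

(** The counting polynomial is unique because two candidates agree at all large integers, so the
    choice made in [mu] must return [P]. *)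
Lemma muE (s : k) (A : set Y) (P : {poly rat}) N :
  (forall p, (N <= p)%N ->
     P.[p%:R] = (count (fun w => `[< A (yof w) >]) (wseq p))%:R) ->
  mu s A = (map_poly ratr P).[s].
Proof.
move=> PE; rewrite /mu; congr (map_poly _ _).[_]; apply: xget_unique.
  exists N => p /PE ->; eexists; last reflexivity.
  exact: card_fixed_points.
move=> Q [N' QE]; apply: (@poly_nat_ext _ (@Num.Theory.pchar_num _) _ _ (maxn N N')) => p.
rewrite geq_max => /andP[Np N'p]; have [m mE ->] := QE p N'p; rewrite PE//.
congr (_%:R); apply/card_eq_II.
by apply: card_eq_trans (card_fixed_points A p); rewrite card_eq_sym.
Qed.

Definition pre p0 (y : Y) : seq nat := map (lab y) (iota 0 p0).

Lemma pre_eq p0 (y y' : Y) : pre p0 y = pre p0 y' <->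
  forall u, (u < p0)%N -> lab y u = lab y' u.
Proof.
split=> [E u up|E]; last first.
  by apply/eq_in_map => u; rewrite mem_iota => /andP[_ /E].
have := congr1 (fun s => nth 0%N s u) E.
by rewrite /pre !(nth_map 0%N) ?size_iota// nth_iota.
Qed.

Lemma pre_yof p0 p w : (p0 <= p)%N -> w \in wseq p -> pre p0 (yof w) = take p0 w.
Proof.
move=> p0p wp; have sw : size w = p by move: wp; rewrite mem_words => /and3P[/eqP].
rewrite /pre (lab_yof wp); apply: (@eq_from_nth _ 0%N).
  by rewrite size_map size_iota size_take sw; case: ltngtP p0p => // ->.
move=> i; rewrite size_map size_iota => ip.
by rewrite (nth_map 0%N) ?size_iota// nth_iota// nth_take.
Qed.

(** Labellings with a given prefix form an orbit of [Sfix p0]. Completing the prefix amounts to a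
    word of length p - p0 with the remaining multiplicities, hence the shift by [p0]. *)
Lemma prefix_poly p0 (y : Y) : exists P : {poly rat}, forall p, (p0 <= p)%N ->
  P.[p%:R] = (count (fun w => pre p0 (yof w) == pre p0 y) (wseq p))%:R.
Proof.
set v := pre p0 y; pose r i := (tw b i - count_mem i v)%N.
have sv : size v = p0 by rewrite size_map size_iota.
(* Makes the truncated subtraction in [r] exact. *)
have vb i : (0 < i)%N -> (count_mem i v <= tw b i)%N.
  move=> i0; rewrite -(@lab_count _ _ _ _ y (maxn p0 (bnd y)))//; last first.
    by apply: bndP; rewrite leq_maxr.
  rewrite count_mem_map_iota [leqRHS](@big_cat_nat _ _ _ p0) ?leq_maxl//=.
  exact: leq_addr.
have [P PE] := words_poly (wK b).-1 r.
exists (P \Po ('X - (p0%:R)%:P)) => p p0p.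
rewrite horner_comp !hornerE -natrB// PE; congr (_%:R).
rewrite (eq_in_count (a2 := fun w => take p0 w == v)) => [|w wp]; last by rewrite (pre_yof p0p wp).
rewrite -size_filter -(size_map (cat v)); apply: perm_size.
apply: uniq_perm; rewrite ?filter_uniq ?uniq_words//.
  by rewrite map_inj_uniq ?uniq_words// => x x' /eqP; rewrite eqseq_cat// eqxx => /eqP.
move=> w; rewrite mem_filter; apply/mapP/andP => [[x + ->]|[/eqP wv]].
  rewrite !mem_words => /and3P[/eqP sx xK /allP xc].
  rewrite take_size_cat// eqxx; split=> //; rewrite size_cat sv sx subnKC// eqxx /=.
  rewrite all_cat xK andbT; apply/andP; split.
    by apply/allP => _ /mapP[u _ ->]; have := lab_lt_wK y u; lia.
  apply/allP => i iI; rewrite count_cat (eqP (xc i iI)) subnKC//; apply: vb.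
  by move: iI; rewrite mem_iota => /andP[].
move=> wp; exists (drop p0 w); last by rewrite -wv cat_take_drop.
move: wp; rewrite !mem_words => /and3P[/eqP sw wK' /allP wc].
rewrite size_drop sw eqxx /=; move: wK'; rewrite -{1}(cat_take_drop p0 w) all_cat.
move=> /andP[_ ->] /=; apply/allP => i iI.
rewrite /r -wv -(eqP (wc i iI)) -{2}(cat_take_drop p0 w) count_cat addKn.
exact: eqxx.
Qed.

Definition prefixes p0 : seq (seq nat) :=
  [seq v <- undup [seq map val (tval w) | w <- enum {: p0.-tuple 'I_(wK b)}]
     | `[< exists y, pre p0 y = v >] ].

Lemma mem_prefixes p0 y : pre p0 y \in prefixes p0.
Proof.
rewrite mem_filter; apply/andP; split; first by apply/asboolP; exists y.
rewrite mem_undup; apply/mapP.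
exists [tuple Ordinal (lab_lt_wK y i) | i < p0]; first by rewrite mem_enum.
rewrite /= -map_comp /pre -[in LHS]val_enum_ord -map_comp.
by apply: eq_map => i.
Qed.

Definition rep p0 v : Y := choose_or (coset_base (young b) : Y) (fun y => pre p0 y = v).

Lemma pre_rep p0 v : v \in prefixes p0 -> pre p0 (rep p0 v) = v.
Proof.
rewrite mem_filter => /andP[/asboolP[y yv] _].
exact: (@choose_orP _ _ (fun y => pre p0 y = v) y).
Qed.

Lemma sum_by_prefix (V : nmodType) p0 p (F : seq nat -> V) :
  \sum_(w <- wseq p) F w =
  \sum_(v <- prefixes p0) \sum_(w <- wseq p | pre p0 (yof w) == v) F w.
Proof.
rewrite (exchange_big_dep xpredT)//; apply: eq_bigr => w _; rewrite -big_filter.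
rewrite (eq_filter (a2 := pred1 (pre p0 (yof w)))) => [|v]; last exact: eq_sym.
rewrite filter_pred1_uniq ?big_seq1 ?mem_prefixes//.
by rewrite filter_uniq ?undup_uniq.
Qed.

Definition ysum p (H : Y -> k) : k := \sum_(w <- wseq p) H (yof w).

(** Invariance is asked only for permutations of [p0, p), because [H] may itself be a finite sum
    over labellings supported below [p], as in [double_integral]. *)
Lemma ysum_orbits p0 (H : Y -> k) p : (p0 <= p)%N ->
  (forall v, v \in prefixes p0 -> (bnd (rep p0 v) <= p)%N) ->
  (forall g y, Sfix p0 g -> (forall u, (p <= u)%N -> g u = u) -> supp_le p (lab y) ->
     H (fs_act g y) = H y) ->
  ysum p H = \sum_(v <- prefixes p0) H (rep p0 v) *
    (count (fun w => pre p0 (yof w) == v) (wseq p))%:R.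
Proof.
move=> p0p rp Hg.
have E v : v \in prefixes p0 -> H (rep p0 v) *
    (count (fun w => pre p0 (yof w) == v) (wseq p))%:R =
    \sum_(w <- wseq p | pre p0 (yof w) == v) H (yof w).
  move=> vp; rewrite -sum1_count natr_sum mulr_sumr [LHS]big_seq_cond [RHS]big_seq_cond.
  apply: eq_bigr => w /andP[wp /eqP pw]; rewrite mulr1.
  have [||//||g [g0 gp ->]] := @orbit_conj _ _ _ b (yof w) (rep p0 v) p0 p.
  - by [].
  - exact: supp_yof.
  - exact/bndP/rp.
  - by apply/pre_eq; rewrite pre_rep.
  by apply: Hg => //; apply: supp_yof.
by rewrite [RHS]big_seq (eq_bigr _ E) -big_seq /ysum -sum_by_prefix.
Qed.

Definition smooth (f : Y -> k) := exists p0, forall y y',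
  (forall u, (u < p0)%N -> lab y u = lab y' u) -> f y = f y'.

(** The integral and the finite sums are the same combination of orbit-counting polynomials,
    evaluated at s and at p. The polynomials are kept apart by orbit since [double_integral]
    multiplies each by an inner integral. *)
Lemma smooth_orbits p0 (f : Y -> k) :
  (forall y y', (forall u, (u < p0)%N -> lab y u = lab y' u) -> f y = f y') ->
  exists P : seq nat -> {poly k},
  [/\ forall s, integral s f = \sum_(v <- prefixes p0) f (rep p0 v) * (P v).[s],
    forall p, (p0 <= p)%N -> ysum p f = \sum_(v <- prefixes p0) f (rep p0 v) * (P v).[p%:R] &
    forall v p, v \in prefixes p0 -> (p0 <= p)%N ->
      (P v).[p%:R] = (count (fun w => pre p0 (yof w) == v) (wseq p))%:R].
Proof.
move=> fp; have /choice[Q QE] := prefix_poly p0.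
pose P v := map_poly (ratr : rat -> k) (Q (rep p0 v)).
have PE v p : v \in prefixes p0 -> (p0 <= p)%N ->
    (P v).[p%:R] = (count (fun w => pre p0 (yof w) == v) (wseq p))%:R.
  by move=> vp p0p; apply: ratr_poly_nat => //; rewrite QE// pre_rep.
have frep y : f y = f (rep p0 (pre p0 y)).
  by apply: fp; apply/pre_eq; rewrite pre_rep// mem_prefixes.
exists P; split=> // [s|p p0p]; last first.
  rewrite /ysum (sum_by_prefix p0) big_seq [RHS]big_seq.
  apply: eq_bigr => v vp; rewrite PE// -sum1_count natr_sum mulr_sumr.
  by apply: eq_bigr => w /eqP wv; rewrite mulr1 frep wv.
(* The integral runs over values of [f]; grouping the orbit representatives by value turns it into a
   sum over orbits. *)
pose C := undup [seq f (rep p0 v) | v <- prefixes p0].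
have rangeE : range f = [set` C].
  apply/seteqP; split=> [_ [y _ <-]|c /=]; rewrite /= mem_undup.
    by rewrite frep; apply/mapP; exists (pre p0 y) => //; apply: mem_prefixes.
  by move=> /mapP[v _ ->]; exists (rep p0 v).
rewrite /integral rangeE -fsbig_seq ?undup_uniq//=.
have muC c : mu s (f @^-1` [set c]) =
    \sum_(v <- prefixes p0 | f (rep p0 v) == c) (P v).[s].
  rewrite (@muE s _ (\sum_(v <- prefixes p0 | f (rep p0 v) == c) Q (rep p0 v)) p0).
    have [g gE] := ratr_rmorphism char0.
    rewrite -(eq_map_poly gE) rmorph_sum horner_sum; apply: eq_bigr => v _.
    by rewrite /= (eq_map_poly gE).
  move=> p p0p; rewrite horner_sum -sum1_count natr_sum big_mkcond [RHS]big_mkcond /=.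
  rewrite [RHS](sum_by_prefix p0) big_seq [RHS]big_seq.
  apply: eq_bigr => v vp; rewrite QE// pre_rep// -sum1_count natr_sum.
  case: eqP => [fc|fc]; last first.
    rewrite big1// => w /eqP wv; case: asboolP => // /= fw; exfalso; apply: fc.
    by rewrite -fw [RHS]frep wv.
  by apply: eq_bigr => w /eqP wv; case: asboolP => // fw; case: fw; rewrite /= frep wv.
transitivity (\sum_(c <- C) \sum_(v <- prefixes p0 | f (rep p0 v) == c)
  f (rep p0 v) * (P v).[s]).
  apply: eq_bigr => c _; rewrite muC mulr_sumr.
  by apply: eq_bigr => v /eqP ->.
rewrite (exchange_big_dep xpredT)// big_seq [RHS]big_seq; apply: eq_bigr => v vp.
rewrite -big_filter (eq_filter (a2 := pred1 (f (rep p0 v)))) => [|c]; last exact: eq_sym.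
rewrite filter_pred1_uniq ?big_seq1 ?undup_uniq// mem_undup.
by apply/mapP; exists v.
Qed.

End Integral.

(** * Integrals as polynomial values, and the category laws *)

Section IntegralTheory.
Variables (k : fieldType) (char0 : [pchar k] =i pred0) (t : k).

Section OneOrbit.
Variables (n : option nat) (b : weight n t).
Local Notation Y := (orbit_set b).
Implicit Types (f : Y -> k) (y : Y) (s : k).

Lemma integral_poly f : smooth f -> exists P : {poly k},
  (forall s, integral s f = P.[s]) /\
  exists N, forall p, (N <= p)%N -> ysum p f = P.[p%:R].
Proof.
move=> [p0 /(smooth_orbits char0)[P [P1 P2 _]]].
exists (\sum_(v <- prefixes b p0) (f (rep b p0 v)) *: P v); split=> [s|].
  by rewrite P1 horner_sum; apply: eq_bigr => v _; rewrite hornerZ.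
exists p0 => p /P2 ->.
by rewrite horner_sum; apply: eq_bigr => v _; rewrite hornerZ.
Qed.

(** The transfer principle: an identity between finite sums for all large [p] becomes an identity
    between integrals at every parameter. *)
Lemma integralE f (Q : {poly k}) N s : smooth f ->
  (forall p, (N <= p)%N -> ysum p f = Q.[p%:R]) -> integral s f = Q.[s].
Proof.
move=> /integral_poly[P [-> [N' PN]]] QN.
congr (_.[s]); apply: (@poly_nat_ext _ char0 _ _ (maxn N N')) => p.
by rewrite geq_max => /andP[Np N'p]; rewrite -PN// QN.
Qed.

Lemma eq_integral f g s : f =1 g -> integral s f = integral s g.
Proof. by move=> /funext ->. Qed.

Lemma smooth_lin (a : k) f g : smooth f -> smooth g ->
  smooth (fun y => a * f y + g y).
Proof.
move=> [p fp] [q gq]; exists (maxn p q) => y y' E.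
by rewrite (fp y y') ?(gq y y')// => u up; apply: E; rewrite leq_max up ?orbT.
Qed.

Lemma smoothM f g : smooth f -> smooth g -> smooth (fun y => f y * g y).
Proof.
move=> [p fp] [q gq]; exists (maxn p q) => y y' E.
by rewrite (fp y y') ?(gq y y')// => u up; apply: E; rewrite leq_max up ?orbT.
Qed.

Lemma integral_lin s (a : k) f g : smooth f -> smooth g ->
  integral s (fun y => a * f y + g y) = a * integral s f + integral s g.
Proof.
move=> sf sg; have [P [-> [N PN]]] := integral_poly sf.
have [Q [-> [N' QN]]] := integral_poly sg.
rewrite (@integralE _ (a *: P + Q) (maxn N N')) ?hornerD ?hornerZ//.
  exact: smooth_lin.
move=> p; rewrite geq_max hornerD hornerZ => /andP[/PN <- /QN <-].
by rewrite /ysum mulr_sumr -big_split.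
Qed.

Lemma integral0 s : integral s (fun _ : Y => 0) = 0.
Proof.
have s0 : smooth (fun _ : Y => 0 : k) by exists 0%N.
by rewrite (@integralE _ 0 0) ?horner0// => p _; rewrite /ysum big1 ?horner0.
Qed.

Lemma smooth_sum (I : Type) (r : seq I) (c : I -> k) (F : I -> Y -> k) :
  (forall i, smooth (F i)) -> smooth (fun y => \sum_(i <- r) c i * F i y).
Proof.
move=> sF; elim: r => [|i r IH]; first by exists 0%N => y y' _; rewrite !big_nil.
have := smooth_lin (c i) (sF i) IH; congr smooth.
by apply/funext => y; rewrite big_cons.
Qed.

Lemma integral_sum s (I : Type) (r : seq I) (c : I -> k) (F : I -> Y -> k) :
  (forall i, smooth (F i)) ->
  integral s (fun y => \sum_(i <- r) c i * F i y) =
  \sum_(i <- r) c i * integral s (F i).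
Proof.
move=> sF; elim: r => [|i r IH].
  by rewrite big_nil -[RHS](integral0 s); apply: eq_integral => y; rewrite big_nil.
rewrite big_cons -IH -integral_lin//; last exact: smooth_sum.
by apply: eq_integral => y; rewrite big_cons.
Qed.

Lemma Sfix_stab y p g : supp_le p (lab y) -> Sfix p g -> fs_act g y = y.
Proof.
move=> yp gp; have [_ H] : fixed_points [set: Y] p y by apply/fixed_pointsE.
exact: H.
Qed.

Lemma smooth_invariant f p0 :
  (forall g y, Sfix p0 g -> f (fs_act g y) = f y) -> smooth f.
Proof.
move=> fp; exists p0 => y y' E.
have [||//||g [gp _ ->]] := @orbit_conj _ _ _ _ y y' p0 (maxn p0 (maxn (bnd y) (bnd y'))).
- exact: leq_maxl.
- by apply: bndP; rewrite !leq_max leqnn ?orbT.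
- by apply: bndP; rewrite !leq_max leqnn ?orbT.
- exact: E.
by rewrite fp.
Qed.

Lemma lab_agree_full y y' p : supp_le p (lab y) ->
  (forall u, (u < p)%N -> lab y u = lab y' u) -> y' = y.
Proof.
move=> yp E.
have [||//||g [gp _ ->]] := @orbit_conj _ _ _ _ y y' p (maxn p (bnd y')).
- exact: leq_maxl.
- exact: supp_leW (leq_maxl _ _) yp.
- by apply: bndP; rewrite leq_maxr.
- exact: E.
exact: Sfix_stab gp.
Qed.

(** For a finitely supported function the finite sums stabilize once [p] exceeds the supports, so
    the polynomial is constant and the parameter disappears. *)
Lemma integral_supp (I : eqType) (r : seq I) (pt : I -> Y) f s :
  uniq r -> {in r &, injective pt} ->
  (forall y, f y != 0 -> exists2 i, i \in r & y = pt i) ->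
  integral s f = \sum_(i <- r) f (pt i).
Proof.
(* Below this bound the labels already determine each point of the support. *)
move=> ur pinj supp; pose p0 := \max_(i <- r) bnd (pt i).
have bp i : i \in r -> (bnd (pt i) <= p0)%N.
  by move=> ir; apply: (@leq_bigmax_seq _ _ predT (fun i => bnd (pt i))).
have agree y y' : (forall u, (u < p0)%N -> lab y u = lab y' u) -> f y != 0 -> y' = y.
  move=> E /supp[i ir yE]; apply: lab_agree_full E.
  by rewrite yE; apply/bndP/bp.
have sf : smooth f.
  exists p0 => y y' E; have [fy|/(agree _ _ E)->//] := eqVneq (f y) 0.
  have [->//|/(agree y' y)->//] := eqVneq (f y') 0.
  by move=> u /E.
rewrite (@integralE _ (\sum_(i <- r) f (pt i))%:P p0)// ?hornerC// => p p0p; rewrite hornerC.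
pose W i := map (lab (pt i)) (iota 0 p).
have Wp i : i \in r -> supp_le p (lab (pt i)).
  by move=> /bp h; apply: bndP; apply: leq_trans p0p.
rewrite /ysum (bigID (mem (map W r))) /= [X in _ + X]big_seq_cond.
rewrite [X in _ + X]big1 ?addr0 => [|w /andP[wp wr]]; last first.
  apply/eqP/negPn/negP => /supp[i ir E]; move/negP: wr; apply; apply/mapP; exists i => //.
  rewrite /W -E (lab_yof wp); apply: (@eq_from_nth _ 0%N).
    by rewrite size_map size_iota; move: wp; rewrite mem_words => /and3P[/eqP].
  move=> j jw; move: wp jw; rewrite mem_words => /and3P[/eqP sw _ _]; rewrite sw => jp.
  by rewrite (nth_map 0%N) ?size_iota// nth_iota.
have Wi : {in r &, injective W}.
  move=> i j ir jr E; apply: pinj => //.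
  by rewrite -(yof_lab (Wp i ir)) -(yof_lab (Wp j jr)); congr yof.
rewrite -big_filter (perm_big (map W r)) /=; last first.
  apply: uniq_perm; rewrite ?filter_uniq ?uniq_words ?map_inj_in_uniq//.
  move=> w; rewrite mem_filter andb_idr// => /mapP[i ir ->].
  by apply/wseq_lab/Wp.
rewrite big_map big_seq [RHS]big_seq; apply: eq_bigr => i ir.
by rewrite yof_lab//; apply: Wp.
Qed.

Lemma ysum_act p (g : Sinf) f : (forall u, (p <= u)%N -> g u = u) ->
  ysum p (fun y => f (fs_act g y)) = ysum p f.
Proof.
move=> gp; rewrite /ysum.
pose T w := map (lab (fs_act g (yof b w))) (iota 0 p).
have sp w : w \in wseq b p -> supp_le p (lab (fs_act g (yof b w))).
  move=> wp u pu; rewrite lab_act; apply: (supp_yof wp).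
  rewrite leqNgt; apply/negP => h; have := gp u pu.
  move=> E; move: h; rewrite -{1}E [_ (g u)](sinf_funK g); lia.
have yT w : w \in wseq b p -> yof b (T w) = fs_act g (yof b w).
  by move=> wp; apply/yof_lab/sp.
have P : perm_eq (map T (wseq b p)) (wseq b p).
  have ui : {in wseq b p &, injective T}.
    move=> w w' wp w'p /(congr1 (yof b)); rewrite !yT//.
    by move=> /(can_inj (fs_actK g))/(yof_inj wp w'p).
  have uT : uniq (map T (wseq b p)) by rewrite map_inj_in_uniq ?uniq_words.
  have sub : {subset map T (wseq b p) <= wseq b p}.
    by move=> _ /mapP[w wp ->]; apply/wseq_lab/sp.
  apply: uniq_perm => //; first exact: uniq_words.
  by apply: (uniq_min_size uT sub _).2; rewrite size_map.
rewrite -[RHS](perm_big _ P) big_map big_seq [RHS]big_seq; apply: eq_bigr => w wp.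
by rewrite yT.
Qed.

End OneOrbit.

Section DoubleIntegral.
Variables (n1 n2 : option nat) (c : weight n1 t) (b : weight n2 t).
Local Notation Z := (orbit_set c).
Local Notation Y := (orbit_set b).
Variables (A : Z -> k) (G : Z -> Y -> k) (B : Y -> k) (p0 : nat).
Hypothesis Ainv : forall g z, Sfix p0 g -> A (fs_act g z) = A z.
Hypothesis Binv : forall g y, Sfix p0 g -> B (fs_act g y) = B y.
Hypothesis Ginv : forall g z y, Sfix p0 g -> G (fs_act g z) (fs_act g y) = G z y.

(* The counting polynomials of the orbits of [Sfix p0] on [Z], multiplied by
   those of the inner integrals, count the pairs. *)
Lemma double_integral : exists (P : {poly k}) (N : nat),
  integral t (fun z => A z * integral t (fun y => G z y * B y)) = P.[t] /\
  forall p, (N <= p)%N ->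
    P.[p%:R] = \sum_(w <- wseq c p) \sum_(x <- wseq b p)
      A (yof c w) * G (yof c w) (yof b x) * B (yof b x).
Proof.
pose f0 z := A z * integral t (fun y => G z y * B y).
have GBs z : smooth (fun y => G z y * B y).
  apply: (@smooth_invariant _ _ _ (maxn p0 (bnd z))) => g y gp.
  have g0 : Sfix p0 g by move=> u up; apply: gp; rewrite /= leq_max up.
  rewrite Binv// -[in LHS](@Sfix_stab _ _ z (maxn p0 (bnd z)) g) ?Ginv//.
  by apply: bndP; rewrite leq_maxr.
have f0inv g z : Sfix p0 g -> f0 (fs_act g z) = f0 z.
  move=> gp; rewrite /f0 Ainv//; congr (_ * _).
  transitivity (integral t (fun y => G z (fs_act g^-1%g y) * B (fs_act g^-1%g y))).
    apply: eq_integral => y; rewrite -(Ginv z (fs_act g^-1%g y) gp) fs_actKV.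
    by congr (_ * _); rewrite -[in LHS](fs_actKV g y) Binv.
  apply: (@integral_act _ t Y (fun y => G z y * B y)).
  exists (bnd z + p0)%N => h y hp.
  have h0 : Sfix p0 h by move=> u /= up; apply: hp; rewrite /= ltn_addl.
  have hz : fs_act h z = z.
    apply: (@Sfix_stab _ _ z (bnd z)); first exact: bndP.
    by move=> u /= ub; apply: hp; rewrite /= ltn_addr.
  by rewrite Binv// -[in LHS]hz Ginv.
have f0p z z' : (forall u, (u < p0)%N -> lab z u = lab z' u) -> f0 z = f0 z'.
  move=> E.
  have [||//||g [gp _ ->]] := @orbit_conj _ _ _ _ z z' p0 (maxn p0 (maxn (bnd z) (bnd z'))).
  - exact: leq_maxl.
  - by apply: bndP; rewrite !leq_max leqnn ?orbT.
  - by apply: bndP; rewrite !leq_max leqnn ?orbT.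
  - exact: E.
  by rewrite f0inv.
have [P [P1 _ P3]] := smooth_orbits char0 f0p.
have /choice[Q QE] v := integral_poly (GBs (rep c p0 v)).
have /choice[N NE] v := (QE v).2.
exists (\sum_(v <- prefixes c p0) A (rep c p0 v) *: (Q v * P v)).
(* Beyond this threshold the inner polynomials at all representatives give the finite sums, and the
   representatives occur among the labellings summed over. *)
exists (maxn p0 (\max_(v <- prefixes c p0) maxn (N v) (bnd (rep c p0 v)))); split.
  rewrite P1 horner_sum; apply: eq_bigr => v _.
  by rewrite hornerZ hornerM /f0 (QE v).1 mulrA.
move=> p; rewrite geq_max => /andP[p0p Mp].
have Np v : v \in prefixes c p0 -> (maxn (N v) (bnd (rep c p0 v)) <= p)%N.
  by move=> vp; apply: leq_trans Mp;
    apply: (@leq_bigmax_seq _ _ predT (fun v => maxn (N v) (bnd (rep c p0 v)))).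
pose H z := A z * ysum p (fun y => G z y * B y).
transitivity (ysum p H); last first.
  by apply: eq_bigr => w _; rewrite /H /ysum mulr_sumr; apply: eq_bigr => x _; rewrite mulrA.
rewrite (@ysum_orbits _ _ _ _ p0 H)//.
- rewrite horner_sum big_seq [RHS]big_seq; apply: eq_bigr => v vp.
  rewrite hornerZ hornerM P3// -NE ?mulrA//.
  by have := Np v vp; rewrite geq_max => /andP[].
- by move=> v vp; have := Np v vp; rewrite geq_max => /andP[].
move=> g z g0 gp zp; rewrite /H Ainv//; congr (_ * _).
rewrite -(@ysum_act _ _ p g (fun y => G (fs_act g z) y * B y))//.
by apply: eq_bigr => w _; rewrite Ginv// Binv.
Qed.

End DoubleIntegral.

Section Composition.
Implicit Types n : option nat.

Lemma hom_stab n1 n2 (d : weight n1 t) (b : weight n2 t)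
  (g : perm_hom k (orbit_set b) (orbit_set d)) z h y p :
  supp_le p (lab z) -> Sfix p h -> g (z, fs_act h y) = g (z, y).
Proof. by move=> zp hp; rewrite -(Sfix_stab zp hp) hom_act (Sfix_stab zp hp). Qed.

Lemma hom_stabr n1 n2 (d : weight n1 t) (b : weight n2 t)
  (g : perm_hom k (orbit_set b) (orbit_set d)) z h y p :
  supp_le p (lab y) -> Sfix p h -> g (fs_act h z, y) = g (z, y).
Proof. by move=> zp hp; rewrite -(Sfix_stab zp hp) hom_act (Sfix_stab zp hp). Qed.

Lemma hom_smoothl n1 n2 (d : weight n1 t) (b : weight n2 t)
  (g : perm_hom k (orbit_set b) (orbit_set d)) z : smooth (fun y => g (z, y)).
Proof.
apply: (@smooth_invariant _ _ _ (bnd z)) => h y hp; apply: hom_stab hp.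
exact: bndP.
Qed.

Lemma hom_smoothr n1 n2 (d : weight n1 t) (b : weight n2 t)
  (g : perm_hom k (orbit_set b) (orbit_set d)) x : smooth (fun y => g (y, x)).
Proof.
apply: (@smooth_invariant _ _ _ (bnd x)) => h y hp; apply: hom_stabr hp.
exact: bndP.
Qed.

Lemma hom_compA n1 n2 n3 n4 (d : weight n1 t) (c : weight n2 t)
  (b : weight n3 t) (a : weight n4 t)
  (h : perm_hom k (orbit_set c) (orbit_set d)) (g : perm_hom k (orbit_set b) (orbit_set c))
  (f : perm_hom k (orbit_set a) (orbit_set b)) :
  hom_comp t h (hom_comp t g f) = hom_comp t (hom_comp t h g) f.
Proof.
apply/val_inj/funext => -[w x] /=.
(* [Sfix p0] fixes both outer points, so each kernel with an outer argument held constant is still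
   invariant under it. *)
pose p0 := maxn (bnd w) (bnd x).
have wp : supp_le p0 (lab w) by apply: bndP; rewrite leq_maxl.
have xp : supp_le p0 (lab x) by apply: bndP; rewrite leq_maxr.
have [||//|P [N [-> PN]]] := @double_integral _ _ c b (fun z => h (w, z))
  (fun z y => g (z, y)) (fun y => f (y, x)) p0.
- by move=> u z; apply: hom_stab.
- by move=> u y; apply: hom_stabr.
- by move=> u z y _; rewrite hom_act.
have [||//|Q [N' [QE QN]]] := @double_integral _ _ b c (fun y => f (y, x))
  (fun y z => g (z, y)) (fun z => h (w, z)) p0.
- by move=> u y; apply: hom_stabr.
- by move=> u z; apply: hom_stab.
- by move=> u z y _; rewrite hom_act.
transitivity (Q.[t]).
  congr (_.[t]); apply: (@poly_nat_ext _ char0 _ _ (maxn N N')) => p.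
  rewrite geq_max => /andP[Np N'p]; rewrite PN// QN// exchange_big /=.
  by apply: eq_bigr => y _; apply: eq_bigr => z _; ring.
rewrite -QE; apply: eq_integral => y; rewrite mulrC; congr (_ * _).
by apply: eq_integral => z; rewrite mulrC.
Qed.

Lemma hom_comp_idl n1 n2 (d : weight n1 t) (b : weight n2 t)
  (f : perm_hom k (orbit_set b) (orbit_set d)) :
  hom_comp t (hom_id k (orbit_set d)) f = f.
Proof.
apply/val_inj/funext => -[z x] /=.
rewrite (@integral_supp _ _ _ [:: tt] (fun=> z))//=.
- by rewrite big_seq1 asboolT// mul1r.
- by move=> [] [].
move=> y; case: asboolP => [->|]; last by rewrite mul0r eqxx.
by exists tt.
Qed.

Lemma hom_comp_idr n1 n2 (d : weight n1 t) (b : weight n2 t)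
  (f : perm_hom k (orbit_set b) (orbit_set d)) :
  hom_comp t f (hom_id k (orbit_set b)) = f.
Proof.
apply/val_inj/funext => -[z x] /=.
rewrite (@integral_supp _ _ _ [:: tt] (fun=> x))//=.
- by rewrite big_seq1 asboolT// mulr1.
- by move=> [] [].
move=> y; case: asboolP => [->|]; last by rewrite mulr0 eqxx.
by exists tt.
Qed.

Lemma hom_comp_linl n1 n2 n3 (d : weight n1 t) (c : weight n2 t) (b : weight n3 t)
  (f : perm_hom k (orbit_set b) (orbit_set c)) :
  linear (fun g : perm_hom k (orbit_set c) (orbit_set d) => hom_comp t g f).
Proof.
move=> a g g'; apply/val_inj/funext => -[z x] /=.
rewrite -[RHS]/(a * integral t (fun y => g (z, y) * f (y, x)) +
  integral t (fun y => g' (z, y) * f (y, x))).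
rewrite -integral_lin; [|by apply: smoothM; [apply: hom_smoothl|apply: hom_smoothr]..].
apply: eq_integral => y; rewrite -[LHS]/((a * g (z, y) + g' (z, y)) * f (y, x)); ring.
Qed.

Lemma hom_comp_linr n1 n2 n3 (d : weight n1 t) (c : weight n2 t) (b : weight n3 t)
  (g : perm_hom k (orbit_set c) (orbit_set d)) :
  linear (fun f : perm_hom k (orbit_set b) (orbit_set c) => hom_comp t g f).
Proof.
move=> a f f'; apply/val_inj/funext => -[z x] /=.
rewrite -[RHS]/(a * integral t (fun y => g (z, y) * f (y, x)) +
  integral t (fun y => g (z, y) * f' (y, x))).
rewrite -integral_lin; [|by apply: smoothM; [apply: hom_smoothl|apply: hom_smoothr]..].
apply: eq_integral => y; rewrite -[LHS]/(g (z, y) * (a * f (y, x) + f' (y, x))); ring.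
Qed.

End Composition.
End IntegralTheory.

(** An equivariant bijection matches the fixed points of every [Sfix p], so both sides have the same
    counting polynomials. *)
Lemma integral_bij (k : fieldType) (s : k) (Y Y' : finitary_set) (phi : Y' -> Y)
    (f : Y -> k) : bijective phi ->
  (forall g y, phi (fs_act g y) = fs_act g (phi y)) ->
  integral s f = integral s (fun y => f (phi y)).
Proof.
move=> [psi phiK psiK] phiA.
have muE (A : set Y) : mu s A = mu s (phi @^-1` A).
  rewrite /mu; congr (map_poly _ (xget _ _)).[_].
  have fpE p : fixed_points A p = phi @` fixed_points (phi @^-1` A) p.
    apply/seteqP; split=> [y [Ay yp]|_ [y [Ay yp] <-]].
      exists (psi y) => //; split=> [|g gp] /=; first by rewrite psiK.
      by apply: (can_inj phiK); rewrite phiA psiK yp.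
    by split=> // g gp; rewrite -phiA yp.
  have E p : fixed_points A p #= fixed_points (phi @^-1` A) p.
    by rewrite fpE; apply: inj_card_eq => y y' _ _; apply: can_inj phiK _ _.
  apply/funext => P; apply/propext; split=> -[N PN]; exists N => p Np;
    have [m mE Pm] := PN _ Np; exists m => //; apply: card_eq_trans mE.
    by rewrite card_eq_sym.
  exact: E.
rewrite /integral; congr (\big[_/_]_(_ <- _) _).
  congr finite_support.
    apply/seteqP; split=> [_ [y _ <-]|_ [y _ <-]]; last by exists (phi y).
    by exists (psi y) => //; rewrite psiK.
  by apply/funext => c; rewrite muE.
by apply/funext => c; rewrite muE.
Qed.

(** * Orbit kernels *)

Notation nmat := (nat -> nat -> nat).
Definition trm (m : nmat) : nmat := fun i j => m j i.

Section Kernels.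
Variables (k : fieldType) (char0 : [pchar k] =i pred0) (t : k).

Section Transpose.
Variables X Y : finitary_set.

Fact htr_subproof (f : perm_hom k X Y) :
  (fun xy : X * Y => f (xy.2, xy.1)) \in @hom_pred k Y X.
Proof. by rewrite unfold_in; apply/asboolP => g x y /=; rewrite hom_act. Qed.
Definition htr (f : perm_hom k X Y) : perm_hom k Y X := PermHom (htr_subproof f).

Lemma htr_linear : linear htr.
Proof. by move=> a f g; apply/val_inj/funext. Qed.

End Transpose.

Lemma htrK X Y : cancel (@htr X Y) (@htr Y X).
Proof. by move=> f; apply/val_inj/funext => -[y x]. Qed.

Lemma htr_comp X Y Z (g : perm_hom k Y Z) (f : perm_hom k X Y) :
  htr (hom_comp t g f) = hom_comp t (htr f) (htr g).
Proof.
apply/val_inj/funext => -[x z] /=; congr integral.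
by apply/funext => y; rewrite mulrC.
Qed.

Section Ker.
Variables (n1 n2 : option nat) (d : weight n1 t) (b : weight n2 t).
Local Notation Hom := (perm_hom k (orbit_set b) (orbit_set d)).

Fact ker_subproof (m : nmat) :
  (fun yx : orbit_set d * orbit_set b => (`[< cmat yx.1 yx.2 = m >])%:R : k)
  \in @hom_pred k (orbit_set b) (orbit_set d).
Proof. by rewrite unfold_in; apply/asboolP => g y x /=; rewrite cmat_act. Qed.
Definition ker (m : nmat) : Hom := PermHom (ker_subproof m).

Lemma hom_cmat (f : Hom) y x y' x' : cmat y x = cmat y' x' -> f (y, x) = f (y', x').
Proof. by move=> /cmat_conj[g [-> ->]]; rewrite hom_act. Qed.

(** There are finitely many orbits on pairs: transitivity brings [x] to the base point [x0], and the
    stabilizer of [x0] contains [Sfix (wM b)], under which [y] is determined by its prefix of length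
    [wM b]. *)
Lemma hom_decomp (f : Hom) : exists (ms : seq nmat) (c : nmat -> k),
  (forall m, m \in ms -> exists y x, cmat y x = m /\ c m = f (y, x)) /\
  f = \sum_(m <- ms) c m *: ker m.
Proof.
pose x0 : orbit_set b := coset_base (young b); pose p0 := wM b.
have x0p : supp_le p0 (lab x0) by move=> u /lab0_supp; rewrite lab_coset_base.
pose ms := undup [seq cmat (rep d p0 v) x0 | v <- prefixes d p0].
pose c (m : nmat) : k := f (choose_or (coset_base (young d) : orbit_set d, x0)
  (fun z : orbit_set d * orbit_set b => cmat z.1 z.2 = m)).
have cE y x : c (cmat y x) = f (y, x).
  rewrite /c; set z := choose_or _ _.
  have : cmat z.1 z.2 = cmat y x.
    exact: (@choose_orP _ _ (fun z : orbit_set d * orbit_set b => cmat z.1 z.2 = _) (y, x)).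
  by case: z => y' x' /hom_cmat.
have mem_ms (y : orbit_set d) (x : orbit_set b) : (cmat y x : nmat) \in ms.
  have [g xE] := orbit_transitive x0 x.
  rewrite xE -(fs_actKV g y) cmat_act mem_undup; set y' := fs_act _ y.
  apply/mapP; exists (pre p0 y'); first exact: mem_prefixes.
  have [||//||h [hp _ ->]] := @orbit_conj _ _ _ _ y' (rep d p0 (pre p0 y')) p0
      (maxn p0 (maxn (bnd y') (bnd (rep d p0 (pre p0 y'))))).
  - exact: leq_maxl.
  - by apply: bndP; rewrite !leq_max leqnn ?orbT.
  - by apply: bndP; rewrite !leq_max leqnn ?orbT.
  - by apply/pre_eq; rewrite pre_rep// mem_prefixes.
  by rewrite -{2}(Sfix_stab x0p hp) cmat_act.
exists ms, c; split=> [m|].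
  rewrite mem_undup => /mapP[v _ ->].
  by exists (rep d p0 v), x0; split=> //; rewrite cE.
apply/val_inj/funext => -[y x].
have E (r : seq nmat) : val (\sum_(m <- r) c m *: ker m) (y, x) =
    \sum_(m <- r) c m * (`[< cmat y x = m >])%:R.
  elim: r => [|m r IH]; first by rewrite !big_nil.
  by rewrite !big_cons -IH.
rewrite [RHS]E (bigD1_seq (cmat y x)) ?undup_uniq//=.
rewrite asboolT// mulr1 cE big1 ?addr0// => m ym.
case: asboolP => [E'|_]; last by rewrite mulr0.
by rewrite E' eqxx in ym.
Qed.

Lemma cmat_cardE (y : orbit_set d) (x : orbit_set b) i j : (i, j) != (0, 0)%N ->
  [set u | lab y u = i /\ lab x u = j] #= `I_(cmat y x i j).
Proof.
move=> ij; pose p := maxn (bnd y) (bnd x).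
have [py px] : supp_le p (lab y) /\ supp_le p (lab x).
  by split; apply: bndP; rewrite ?leq_maxl ?leq_maxr.
rewrite (cmatE py px ij).
pose s := [seq u <- iota 0 p | (lab y u == i) && (lab x u == j)].
have -> : (\sum_(0 <= u < p) ((lab y u == i) && (lab x u == j)))%N = size s.
  rewrite size_filter -sum1_count [RHS]big_mkcond /index_iota subn0 /=.
  by apply: eq_bigr => u _; case: (_ && _).
have us : uniq s by rewrite filter_uniq ?iota_uniq.
apply: card_eq_trans (card_seq_set us).
rewrite (_ : [set u | _] = [set` s])//; apply/seteqP; split=> u /=.
  move=> [ui uj]; rewrite mem_filter ui uj !eqxx mem_iota /= add0n ltnNge.
  by apply/negP => pu; have := supp_pair py px ij pu; rewrite ui uj !eqxx.
by rewrite mem_filter => /andP[/andP[/eqP-> /eqP->]].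
Qed.

Lemma realize_mat (m : nmat) K : m 0%N 0%N = 0%N ->
  (forall i j, (K <= i)%N || (K <= j)%N -> m i j = 0%N) ->
  (forall i, (0 < i)%N -> \sum_(0 <= j < K) m i j = tw d i)%N ->
  (forall j, (0 < j)%N -> \sum_(0 <= i < K) m i j = tw b j)%N ->
  exists (y : orbit_set d) (x : orbit_set b), cmat y x = m.
Proof.
move=> m0 mK mrow mcol.
(* The list repeats each pair (i, j) m i j times; its components label the points for [d] and for
   [b] simultaneously. *)
pose s := flatten [seq flatten [seq nseq (m i j) (i, j) | j <- iota 0 K] | i <- iota 0 K].
pose L u := nth (0, 0)%N s u.
have cs (P : pred (nat * nat)) : count P s =
    (\sum_(0 <= i < K) \sum_(0 <= j < K) m i j * P (i, j))%N.
  rewrite /s count_flatten sumnE !big_map /index_iota subn0; apply: eq_bigr => i _.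
  rewrite count_flatten sumnE !big_map; apply: eq_bigr => j _.
  by rewrite count_nseq mulnC.
have Ls (P : pred (nat * nat)) : (\sum_(0 <= u < size s) P (L u) = count P s)%N.
  rewrite -sum1_count (big_nth (0, 0)%N) [RHS]big_mkcond /=.
  by apply: eq_bigr => u _; case: (P _).
have [||y yE] := @lab_exists _ _ _ d (fun u => (L u).1) (size s).
- by move=> u us; rewrite /L nth_default.
- move=> i i0; rewrite (Ls (fun c => c.1 == i)) cs -(mrow i i0).
  have [iK|Ki] := ltnP i K; last first.
    rewrite [RHS]big1 => [|j _]; last by rewrite mK ?Ki.
    rewrite big1_seq// => i'; rewrite mem_index_iota => /andP[_ /andP[_ i'K]].
    rewrite big1// => j _ /=; case: eqP => [E|]; last by rewrite muln0.
    by move: i'K; rewrite E ltnNge Ki.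
  rewrite (bigD1_seq i) ?mem_index_iota ?iota_uniq//= eqxx.
  rewrite [X in (_ + X)%N]big1 ?addn0 => [|i' /negPf i'i]; last first.
    by rewrite big1// => j _; rewrite i'i muln0.
  by apply: eq_bigr => j _; rewrite muln1.
have [||x xE] := @lab_exists _ _ _ b (fun u => (L u).2) (size s).
- by move=> u us; rewrite /L nth_default.
- move=> j j0; rewrite (Ls (fun c => c.2 == j)) cs exchange_big -(mcol j j0).
  have [jK|Kj] := ltnP j K; last first.
    rewrite [RHS]big1 => [|i _]; last by rewrite mK ?Kj ?orbT.
    rewrite big1_seq// => i'; rewrite mem_index_iota => /andP[_ /andP[_ i'K]].
    rewrite big1// => i _ /=; case: eqP => [E|]; last by rewrite muln0.
    by move: i'K; rewrite E ltnNge Kj.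
  rewrite (bigD1_seq j) ?mem_index_iota ?iota_uniq//= eqxx.
  rewrite [X in (_ + X)%N]big1 ?addn0 => [|i' /negPf i'i]; last first.
    by rewrite big1// => i _; rewrite i'i muln0.
  by apply: eq_bigr => i _; rewrite muln1.
exists y, x; apply/funext => i; apply/funext => j.
have [/eqP[-> ->]|ij] := boolP ((i, j) == (0, 0)%N); first by rewrite cmat00 m0.
rewrite (@cmatE _ _ _ _ _ _ _ _ (size s))//.
- rewrite (eq_bigr (fun u => nat_of_bool (L u == (i, j)))) => [|u _]; last first.
    by rewrite yE xE -xpair_eqE -surjective_pairing.
  rewrite (Ls (pred1 (i, j))) cs.
  have [/andP[iK jK]|] := boolP ((i < K) && (j < K))%N.
    rewrite (bigD1_seq i) ?mem_index_iota ?iota_uniq//=.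
    rewrite (bigD1_seq j) ?mem_index_iota ?iota_uniq//= eqxx muln1.
    rewrite !big1 ?addn0// => [i' i'i|j' j'j].
      by rewrite big1// => j' _; rewrite xpair_eqE (negPf i'i) muln0.
    by rewrite xpair_eqE (negPf j'j) andbF muln0.
  rewrite negb_and -!leqNgt => ijK; rewrite mK//.
  rewrite big1_seq// => i'; rewrite mem_index_iota => /andP[_ /andP[_ i'K]].
  rewrite big1_seq// => j'; rewrite mem_index_iota => /andP[_ /andP[_ j'K]] /=.
  by case: eqP => [[E1 E2]|]; rewrite ?muln0//; move: ijK; rewrite -E1 -E2; lia.
- by move=> u us; rewrite yE /L nth_default.
by move=> u us; rewrite xE /L nth_default.
Qed.

End Ker.

Lemma htr_ker n1 n2 (d : weight n1 t) (b : weight n2 t) m :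
  htr (ker d b m) = ker b d (trm m).
Proof.
apply/val_inj/funext => -[x y] /=; congr (_%:R); congr (nat_of_bool _).
apply: asbool_equiv_eq; split=> E; apply/funext => i; apply/funext => j.
  by rewrite -cmat_tr E.
by have := congr1 (fun m => m j i) E; rewrite -cmat_tr.
Qed.

End Kernels.

(** * Matrices over the field and counting matrices *)

Section NatMatrices.
Variables (k : fieldType) (char0 : [pchar k] =i pred0) (t : k) (n : option nat).
Hypothesis n_gt0 : n != Some 0%N.
Implicit Types (d b : weight n t) (q : nat -> nat -> k).

Definition nq q : nmat := fun i j => if (i, j) == (0, 0)%N then 0%N else natval (q i j).

Lemma nq_transpose q : nq (transpose q) = trm (nq q).
Proof.
by apply/funext => i; apply/funext => j; rewrite /nq /trm !xpair_eqE andbC.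
Qed.

Lemma nqE d b q i j : is_mat d b q -> (i, j) != (0, 0)%N -> q i j = (nq q i j)%:R.
Proof.
by move=> qm ij; rewrite /nq (negPf ij); have [m ->] := mat_nat qm ij; rewrite natvalE.
Qed.

Lemma fsbig_nat (F : nat -> k) K : (forall i, (K <= i)%N -> F i = 0) ->
  \sum_(i \in [set: nat]) F i = \sum_(0 <= i < K) F i.
Proof.
move=> FK; rewrite [RHS]fsbig_seq ?iota_uniq//; symmetry; apply: fsbig_widen => // i [_ /= iK].
by apply: FK; rewrite leqNgt; apply: contra_notN iK => iK; rewrite mem_index_iota.
Qed.

Lemma fsbig_nat2 (F : nat -> nat -> k) K :
  (forall i j, (K <= i)%N || (K <= j)%N -> F i j = 0) ->
  \sum_(p \in [set: nat * nat]) F p.1 p.2 = \sum_(0 <= i < K) \sum_(0 <= j < K) F i j.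
Proof.
move=> FK; pose r := [seq (i, j) | i <- index_iota 0 K, j <- index_iota 0 K].
have ur : uniq r by apply: allpairs_uniq; rewrite ?iota_uniq// => -[? ?] [? ?].
transitivity (\sum_(p <- r) F p.1 p.2); last by rewrite big_allpairs_dep.
rewrite [RHS]fsbig_seq//; symmetry; apply: fsbig_widen => // -[i j] [_ /= ij].
apply: FK; rewrite (leqNgt K i) (leqNgt K j) -negb_and; apply: contra_notN ij => /andP[iK jK].
by apply/allpairsP; exists (i, j); rewrite !mem_index_iota.
Qed.

Lemma mat_bound d b q : is_mat d b q -> exists K,
  forall i j, (K <= i)%N || (K <= j)%N -> q i j = 0.
Proof.
move=> /mat_fin/finite_seqP[s sE].
exists (\max_(p <- s) maxn p.1 p.2).+1 => i j ij; apply/eqP/negPn/negP => qij.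
have : [set` s] (i, j) by rewrite -sE.
move=> /= si; have := @leq_bigmax_seq _ s predT (fun p => maxn p.1 p.2) _ si isT.
rewrite /= geq_max => /andP[h1 h2]; case/orP: ij => h.
  by have := leq_trans h h1; rewrite ltnn.
by have := leq_trans h h2; rewrite ltnn.
Qed.

Lemma mat_realize d b q : is_mat d b q ->
  exists (y : orbit_set d) (x : orbit_set b), cmat y x = nq q.
Proof.
move=> qm; have [K qK] := mat_bound qm.
apply: (@realize_mat _ _ _ _ _ _ _ K) => //.
- move=> i j ij; rewrite /nq; case: ifP => // _.
  by rewrite qK// natval0.
- move=> i i0; apply: (natr_inj char0); rewrite -twE// -(mat_row qm i) natr_sum.
  rewrite (@fsbig_nat _ K) => [|j Kj]; last by rewrite qK ?Kj ?orbT.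
  by apply: eq_bigr => j _; rewrite (nqE qm)//; case: (i) i0.
move=> j j0; apply: (natr_inj char0); rewrite -twE// -(mat_col qm j) natr_sum.
rewrite (@fsbig_nat _ K) => [|i Ki]; last by rewrite qK ?Ki.
by apply: eq_bigr => i _; rewrite (nqE qm)//; case: (i) j0 => [|?]; case: (j).
Qed.

Lemma weight_sumE b K : (wK b <= K)%N -> \sum_(0 <= i < K) b i = t.
Proof.
move=> bK; rewrite -[RHS](weight_sum b) (@fsbig_nat _ K)// => i Ki.
by apply: wKP; apply: leq_trans Ki.
Qed.

Lemma weight_out b i : ~~ in_range n i -> (0 < i)%N /\ tw b i = 0%N.
Proof.
move=> ni; split; last by rewrite /tw (weight_range b ni) natval0.
by case: i ni => //; move: n_gt0; rewrite /in_range; case: n => // -[|].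
Qed.

Lemma realize_is_mat d b (y : orbit_set d) (x : orbit_set b) :
  exists2 q, is_mat d b q & nq q = cmat y x.
Proof.
pose K := maxn (wK d) (wK b).
have [dK bK] : (wK d <= K)%N /\ (wK b <= K)%N by rewrite leq_maxl leq_maxr.
have K0 : (0 < K)%N := leq_trans (wK_gt0 d) dK.
(* The only value compatible with the sum of column 0. *)
pose c00 := b 0%N - \sum_(1 <= i < K) (cmat y x i 0)%:R.
pose q i j : k := if (i, j) == (0, 0)%N then c00 else (cmat y x i j)%:R.
have cK i j : (K <= i)%N || (K <= j)%N -> cmat y x i j = 0%N.
  move=> ij; have ij0 : (i, j) != (0, 0)%N.
    by rewrite xpair_eqE; move: ij K0; lia.
  apply/cmat_eq0 => // u [ui uj]; have := lab_lt_wK y u; have := lab_lt_wK x u.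
  by move: ij; lia.
have qK i j : (K <= i)%N || (K <= j)%N -> q i j = 0.
  move=> ij; rewrite /q cK//; case: eqP => // -[i0 j0].
  by move: ij K0; lia.
have col j : \sum_(0 <= i < K) q i j = b j.
  have [->|j0] := posnP j.
    rewrite (@big_cat_nat _ _ _ 1)//= big_nat1 {1}/q eqxx /c00.
    rewrite [X in _ + X](eq_big_nat _ _ (F2 := fun i => (cmat y x i 0)%:R)) ?subrK//.
    by move=> i /andP[i0 _]; rewrite /q xpair_eqE; case: (i) i0.
  rewrite twE// -(cmat_col y x j0 dK) natr_sum; apply: eq_bigr => i _.
  by rewrite /q xpair_eqE andbC; case: (j) j0.
have rowS i : (0 < i)%N -> \sum_(0 <= j < K) q i j = d i.
  move=> i0; rewrite twE// -(cmat_row y x i0 bK) natr_sum; apply: eq_bigr => j _.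
  by rewrite /q xpair_eqE; case: (i) i0.
have total : \sum_(0 <= i < K) \sum_(0 <= j < K) q i j = t.
  by rewrite exchange_big /= (eq_bigr b) ?weight_sumE.
(* Row 0 is obtained from the total [t] by subtracting the other rows. *)
have row i : \sum_(0 <= j < K) q i j = d i.
  have [->|] := posnP i; last exact: rowS.
  apply: (@addIr _ (\sum_(1 <= i < K) d i)).
  transitivity (\sum_(0 <= i < K) \sum_(0 <= j < K) q i j).
    rewrite [RHS](@big_cat_nat _ _ _ 1)//= big_nat1; congr (_ + _).
    by apply/esym/eq_big_nat => j /andP[j0 _]; apply: rowS.
  apply: (etrans total); apply: (etrans (esym (weight_sumE dK))).
  by rewrite (@big_cat_nat _ _ _ 1 0)//= big_nat1.
exists q; last first.
  apply/funext => i; apply/funext => j; rewrite /nq /q.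
  by case: eqP => [[-> ->]|_]; rewrite ?cmat00// natvalE.
split.
- move=> i j; rewrite negb_and => ij.
  have ij0 : (i, j) != (0, 0)%N.
    by rewrite xpair_eqE; case/orP: ij => /weight_out H; [have := H d|have := H b]; lia.
  rewrite /q (negPf ij0); case/orP: ij => /weight_out H.
    have [i0 di] := H d; have := cmat_row y x i0 bK; rewrite di => /eqP.
    rewrite sum_nat_seq_eq0 => /allP c0; have [jK|Kj] := ltnP j K.
      by have := c0 j; rewrite mem_index_iota jK => /(_ isT)/eqP ->.
    by rewrite cK ?Kj ?orbT.
  have [j0 bj] := H b; have := cmat_col y x j0 dK; rewrite bj => /eqP.
  rewrite sum_nat_seq_eq0 => /allP c0; have [iK|Ki] := ltnP i K.
    by have := c0 i; rewrite mem_index_iota iK => /(_ isT)/eqP ->.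
  by rewrite cK ?Ki.
- have [z zE] := weight_head b; exists (z + (\sum_(1 <= i < K) cmat y x i 0)%N%:Z).
  by rewrite /q eqxx /c00 zE intrD opprD addrA -pmulrn natr_sum.
- by move=> i j ij; rewrite /q (negPf ij); eexists.
- have F : finite_set (`I_K `*` `I_K : set (nat * nat)).
    by apply: finite_setX; apply: finite_II.
  apply: (sub_finite_set _ F) => -[i j] /= qij; split=> /=; rewrite ltnNge;
    by apply: contra_neqN qij => h; rewrite qK ?h ?orbT.
- by rewrite (@fsbig_nat2 _ K).
- by move=> j; rewrite (@fsbig_nat _ K)// => i Ki; rewrite qK ?Ki.
by move=> i; rewrite (@fsbig_nat _ K)// => j Kj; rewrite qK ?Kj ?orbT.
Qed.

(** The intersections of blocks that define the orbit of q are the level sets of the pair of labels,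
    so a representative sigma is the same as a pair of points with counting matrix [nq q]. *)
Lemma xi_ker d b q : is_mat d b q -> xi d b q = dsum_in (j := (d, b)) (ker d b (nq q)).
Proof.
move=> qm; rewrite /xi; congr (dsum_in (j := (d, b)) _).
apply/val_inj/funext => -[y x] /=; rewrite /xi_fun /=; congr (_%:R).
congr (nat_of_bool _); apply: asbool_equiv_eq.
have blk (s : Sinf) i j : block d i `&` (s @` block b j) =
    [set u | lab (young_coset d 1%g) u = i /\ lab (young_coset b s) u = j].
  apply/seteqP; split=> u /=; rewrite !lab_young_coset invg1.
    by move=> [/blockE -> [v /blockE <- <-]]; rewrite [_ (s v)](sinf_funK s).
  move=> [ui uj]; split; first exact/blockE.
  by exists (s^-1%g u); [exact/blockE|exact: (sinf_invK s)].
split=> [[s sq [g [-> ->]]]|E].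
  rewrite cmat_act; apply/funext => i; apply/funext => j; rewrite /nq.
  have [/eqP[-> ->]|ij] := boolP ((i, j) == (0, 0)%N); first by rewrite cmat00.
  have [m] := sq i j ij; rewrite blk => mE ->; rewrite natvalE//.
  apply/card_eq_II/(card_eq_trans _ mE); rewrite card_eq_sym.
  exact: cmat_cardE.
have [g yE] := orbit_transitive (young_coset d 1%g) y.
have [h xE] := orbit_transitive (coset_base (young b) : orbit_set b) (fs_act g^-1%g x).
have xE' : x = fs_act g (young_coset b h) by rewrite /young_coset -xE fs_actKV.
exists h; last by exists g.
move=> i j ij; exists (nq q i j); last exact: nqE qm ij.
by rewrite blk -E yE xE' cmat_act; apply: cmat_cardE.
Qed.

End NatMatrices.

(** * Spanning *)

Section Spanned.
Variables (k : fieldType) (V : lmodType k).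
Implicit Types (S : V -> Prop) (u v w : V).

Inductive spanned S : V -> Prop :=
| spanned0 : spanned S 0
| spanned_cons a v w : S v -> spanned S w -> spanned S (a *: v + w).

Lemma spannedD S u v : spanned S u -> spanned S v -> spanned S (u + v).
Proof.
elim=> [|a x w Sx _ IH] sv; first by rewrite add0r.
by rewrite -addrA; apply: spanned_cons => //; apply: IH.
Qed.

Lemma spannedZ S a u : spanned S u -> spanned S (a *: u).
Proof.
elim=> [|c x w Sx _ IH]; first by rewrite scaler0; apply: spanned0.
by rewrite scalerDr scalerA; apply: spanned_cons.
Qed.

Lemma spannedB S u v : spanned S u -> spanned S v -> spanned S (u - v).
Proof. by move=> su sv; rewrite -scaleN1r; apply: spannedD => //; apply: spannedZ. Qed.

Lemma spanned_mem S u : S u -> spanned S u.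
Proof.
by move=> Su; rewrite -[u]scale1r -[_ *: _]addr0; apply: spanned_cons => //; apply: spanned0.
Qed.

Lemma spanned_sum S (I : Type) (r : seq I) (F : I -> V) :
  (forall i, spanned S (F i)) -> spanned S (\sum_(i <- r) F i).
Proof.
move=> SF; elim: r => [|i r IH]; first by rewrite big_nil; apply: spanned0.
by rewrite big_cons; apply: spannedD.
Qed.

End Spanned.

Lemma spanned_linear (k : fieldType) (U V : lmodType k) (phi : U -> V)
    (S : U -> Prop) (S' : V -> Prop) u : linear phi ->
  (forall v, S v -> S' (phi v)) -> spanned S u -> spanned S' (phi u).
Proof.
move=> lphi SS'; elim=> [|a v w Sv _ IH].
  have := lphi (-1) 0 0; rewrite scaleN1r oppr0 addr0 => ->.
  by rewrite scaleN1r addNr; apply: spanned0.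
by rewrite lphi; apply: spanned_cons => //; apply: SS'.
Qed.

(** * Changing weights, and statistics of weights *)

Section Weights.
Variables (k : fieldType) (char0 : [pchar k] =i pred0) (t : k).

(** The conjugating permutation fixes every point from [p] on, hence permutes [0, p). As F 0 may be
    nonzero, both sums must stop at the same [p]. *)
Lemma lab_sum n (b : weight n t) (y y' : orbit_set b) p (F : nat -> nat) :
  supp_le p (lab y) -> supp_le p (lab y') ->
  (\sum_(0 <= u < p) F (lab y u) = \sum_(0 <= u < p) F (lab y' u))%N.
Proof.
move=> yp y'p.
have [||//||g [_ gp y'E]] := @orbit_conj _ _ _ _ y y' 0 p => //.
pose F1 u := if (u < p)%N then F (lab y u) else 0%N.
pose F2 u := if (u < p)%N then F (lab y' u) else 0%N.
transitivity (\sum_(0 <= u < p) F1 u)%N.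
  by apply: eq_big_nat => u /andP[_ up]; rewrite /F1 up.
transitivity (\sum_(0 <= u < p) F2 u)%N; last first.
  by apply: eq_big_nat => u /andP[_ up]; rewrite /F2 up.
apply: (@sum_nat_transport _ _ _ _ g) => u.
- by rewrite /F1 ltnNge => ->.
- by rewrite /F2 ltnNge => ->.
have gp' : (g u < p)%N = (u < p)%N.
  have [up|pu] := ltnP u p; last by rewrite gp// ltnNge pu.
  rewrite ltnNge; apply/negP => h; have := gp _ h => /(@sinf_inj g) E.
  by move: up; rewrite -E ltnNge h.
by rewrite /F1 /F2 gp'; case: ifP => // _; rewrite y'E lab_act [_ (g u)](sinf_funK g).
Qed.

(** The level sets of label i are finite and equinumerous, so an inclusion between them is an
    equality. *)
Lemma lab_sub n (b : weight n t) (y y' : orbit_set b) i : (0 < i)%N ->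
  (forall u, lab y u = i -> lab y' u = i) -> forall u, lab y' u = i -> lab y u = i.
Proof.
move=> i0 yy' u ui; pose p := maxn (maxn (bnd y) (bnd y')) u.+1.
have [yp y'p] : supp_le p (lab y) /\ supp_le p (lab y').
  by split; apply: bndP; rewrite !leq_max leqnn ?orbT.
have up : (u < p)%N by rewrite leq_max leqnn orbT.
have E := @lab_sum _ _ _ _ _ (fun l => nat_of_bool (l == i)) yp y'p.
apply/eqP; apply: contra_eqT E => yu; rewrite neq_ltn; apply/orP; left.
rewrite (bigD1_seq u) ?mem_index_iota ?iota_uniq//= (negPf yu).
rewrite [ltnRHS](bigD1_seq u) ?mem_index_iota ?iota_uniq//= ui eqxx ltnS.
by apply: leq_sum => v _; case: eqP => // /yy' ->; rewrite eqxx.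
Qed.

Section MkWeight.
Variables (n : option nat) (w : nat -> nat) (K : nat).
Hypothesis n_gt0 : n != Some 0%N.
Hypothesis wK0 : forall i, (K <= i)%N -> w i = 0%N.
Hypothesis wn : forall i, ~~ in_range n i -> w i = 0%N.

(** The entry at 0 is dictated by the total [t]. Stopping at K.+1 allows index 0 to be split off
    even when K is 0. *)
Let val i : k := if i == 0%N then t - \sum_(1 <= j < K.+1) (w j)%:R else (w i)%:R.

Let val0 i : (K < i)%N -> val i = 0.
Proof. by rewrite /val => Ki; rewrite wK0 ?(ltnW Ki)//; case: i Ki. Qed.

Fact mkw_range i : ~~ in_range n i -> val i = 0.
Proof.
move=> ni; rewrite /val wn//; case: eqP => // i0; rewrite i0 in ni.
by move: n_gt0 ni; rewrite /in_range; case: n => // -[|].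
Qed.
Fact mkw_head : exists z : int, val 0%N = t - z%:~R.
Proof.
exists (\sum_(1 <= j < K.+1) w j)%N%:Z; rewrite /val eqxx -pmulrn.
by rewrite natr_sum.
Qed.
Fact mkw_nat i : (0 < i)%N -> exists m : nat, val i = m%:R.
Proof. by rewrite /val; case: i => // i _; eexists. Qed.
Fact mkw_fin : finite_set [set i | val i != 0].
Proof.
apply: (sub_finite_set _ (finite_II K.+1)) => i /= vi; rewrite ltnNge.
by apply: contra_neqN vi => Ki; rewrite val0.
Qed.
Fact mkw_sum : \sum_(i \in [set: nat]) val i = t.
Proof.
rewrite (@fsbig_nat _ _ K.+1) => [|i Ki]; last exact: val0.
rewrite (@big_cat_nat _ _ _ 1)//= big_nat1 {1}/val eqxx.
rewrite [X in _ + X](eq_big_nat _ _ (F2 := fun i => (w i)%:R)) ?subrK//.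
by move=> i /andP[i0 _]; rewrite /val; case: (i) i0.
Qed.
Definition mkw : weight n t :=
  Weight mkw_range mkw_head mkw_nat mkw_fin mkw_sum.

Lemma tw_mkw i : (0 < i)%N -> tw mkw i = w i.
Proof. by rewrite /tw /= /val; case: i => // i _; apply: natvalE. Qed.

End MkWeight.

Section Relabel.
Variables (n1 n2 : option nat) (c : weight n1 t) (c' : weight n2 t).
Variables (pi pi' : nat -> nat).
Hypotheses (piK : cancel pi pi') (piK' : cancel pi' pi) (pi0 : pi 0%N = 0%N).
Hypothesis piE : forall i, (0 < i)%N -> tw c' (pi i) = tw c i.

Lemma relabel_bij : exists2 phi : orbit_set c' -> orbit_set c,
  bijective phi & (forall g z, phi (fs_act g z) = fs_act g (phi z)) /\
  (forall z u, lab (phi z) u = pi' (lab z u)).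
Proof.
have pi'0 : pi' 0%N = 0%N by rewrite -pi0 piK.
have /choice[phi phiE] (z : orbit_set c') : exists y : orbit_set c, lab y =1 pi' \o lab z.
  apply: (@lab_exists _ _ _ _ _ (bnd z)) => [u pu|i i0 /=].
    by rewrite /= (bndP (leqnn _) pu) pi'0.
  have pii0 : (0 < pi i)%N.
    by rewrite lt0n; apply/eqP => E; move: i0; rewrite -(piK i) E pi'0.
  rewrite -piE// -(@lab_count _ _ _ _ z (bnd z))//; last exact: bndP.
  by apply: eq_bigr => u _; rewrite (can2_eq piK' piK).
have /choice[psi psiE] (y : orbit_set c) : exists z : orbit_set c', lab z =1 pi \o lab y.
  apply: (@lab_exists _ _ _ _ _ (bnd y)) => [u pu|i i0 /=].
    by rewrite /= (bndP (leqnn _) pu) pi0.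
  have pii0 : (0 < pi' i)%N.
    by rewrite lt0n; apply/eqP => E; move: i0; rewrite -(piK' i) E pi0.
  rewrite -{2}(piK' i) piE// -(@lab_count _ _ _ _ y (bnd y))//; last exact: bndP.
  by apply: eq_bigr => u _; rewrite (can2_eq piK piK').
exists phi.
  exists psi => [z|y]; apply: lab_inj => u.
    by rewrite psiE /= phiE /= piK'.
  by rewrite phiE /= psiE /= piK.
split=> [g z|z u]; last by rewrite phiE.
by apply: lab_inj => u; rewrite lab_act !phiE /= lab_act.
Qed.

Lemma relabel n3 n4 (d : weight n3 t) (b : weight n4 t)
  (g : perm_hom k (orbit_set c) (orbit_set d)) (f : perm_hom k (orbit_set b) (orbit_set c)) :
  exists (g' : perm_hom k (orbit_set c') (orbit_set d))
         (f' : perm_hom k (orbit_set b) (orbit_set c')),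
    hom_comp t g' f' = hom_comp t g f.
Proof.
have [phi phib [phiA _]] := relabel_bij.
have g'P : (fun zy : orbit_set d * orbit_set c' => g (zy.1, phi zy.2)) \in
    @hom_pred k (orbit_set c') (orbit_set d).
  by rewrite unfold_in; apply/asboolP => h z y /=; rewrite phiA hom_act.
have f'P : (fun yx : orbit_set c' * orbit_set b => f (phi yx.1, yx.2)) \in
    @hom_pred k (orbit_set b) (orbit_set c').
  by rewrite unfold_in; apply/asboolP => h z y /=; rewrite phiA hom_act.
exists (PermHom g'P), (PermHom f'P); apply/val_inj/funext => -[z x] /=.
exact/esym/(integral_bij _ _ phib phiA).
Qed.

End Relabel.

Lemma ker_comp_eq n1 n2 n3 n4 (c : weight n1 t) (c' : weight n2 t)
  (d : weight n3 t) (b : weight n4 t) m1 m2 :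
  (forall i, (0 < i)%N -> tw c' i = tw c i) ->
  hom_comp t (ker d c' m1) (ker c' b m2) = hom_comp t (ker d c m1) (ker c b m2).
Proof.
move=> cc'; have [phi phib [phiA phiL]] := @relabel_bij _ _ c c' id id
  (fun=> erefl) (fun=> erefl) erefl cc'.
apply/val_inj/funext => -[z x] /=; rewrite [RHS](integral_bij _ _ phib phiA).
have E1 (y : orbit_set c') : cmat z (phi y) = cmat z y by apply: eq_cmat.
have E2 (y : orbit_set c') : cmat (phi y) x = cmat y x by apply: eq_cmat.
congr (integral t _); apply/funext => y.
rewrite /= E1.
by rewrite E2.
Qed.

Section Measures.
Implicit Types n : option nat.

Definition wsum n (b : weight n t) (F : nat -> nat -> nat) : nat :=
  (\sum_(1 <= i < wK b) F i (tw b i))%N.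

(** Empty rows must contribute nothing, which explains the subtraction of 1 in [wpow]. *)
Lemma wsum_widen n (b : weight n t) F K : (forall i, F i 0%N = 0%N) ->
  (wK b <= K)%N -> wsum b F = (\sum_(1 <= i < K) F i (tw b i))%N.
Proof.
move=> F0 bK; rewrite /wsum (@big_cat_nat _ _ _ (wK b) 1 K) ?wK_gt0//=.
rewrite [X in (_ + X)%N]big1_seq ?addn0// => i.
by rewrite mem_index_iota => /andP[_ /andP[/tw_wK ->]].
Qed.

Lemma wsum_lab n (b : weight n t) (y : orbit_set b) (c : nat -> nat) p :
  c 0%N = 0%N -> supp_le p (lab y) ->
  wsum b (fun i a => c i * a)%N = (\sum_(0 <= u < p) c (lab y u))%N.
Proof.
move=> c0 yp; rewrite /wsum.
under eq_big_nat => i /andP[i0 _] do rewrite -(lab_count yp i0) big_distrr /=.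
rewrite exchange_big /=; apply: eq_bigr => u _.
have [->|l0] := posnP (lab y u).
  rewrite c0 big1_seq// => i; rewrite mem_index_iota => /andP[_ /andP[i0 _]].
  by rewrite eq_sym eqn0Ngt i0 muln0.
rewrite (bigD1_seq (lab y u)) ?mem_index_iota ?iota_uniq ?l0 ?lab_lt_wK//=.
rewrite eqxx muln1 big1 ?addn0// => i; rewrite eq_sym => /negPf ->.
by rewrite muln0.
Qed.

Definition wsize n (b : weight n t) := wsum b (fun _ a => 1 * a)%N.
Definition wdepth n (b : weight n t) := wsum b (fun i a => i * a)%N.
(* [wpow] grows when a row is replaced by a longer one, whatever the other new
   rows are, since [2 ^ x + 2 ^ y <= 2 ^ (x + 1)] for [y <= x]. *)
Definition wpow n (b : weight n t) := wsum b (fun _ a => 2 ^ a - 1)%N.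

(** Bounds [wpow] at fixed size, so that an induction along increasing [wpow] terminates. *)
Lemma wpow_le n (b : weight n t) : (wpow b <= 2 ^ wsize b - 1)%N.
Proof.
rewrite /wpow /wsize /wsum; elim: {1 2}(index_iota 1 (wK b)) => [|i r IH].
  by rewrite !big_nil.
rewrite !big_cons mul1n expnD.
have := expn_gt0 2 (tw b i); have := expn_gt0 2 (\sum_(j <- r) 1 * tw b j).
move: IH; set A := (2 ^ _)%N; set B := (2 ^ _)%N; set S := (\sum_(_ <- _) _)%N.
move=> /= IH B0 A0; nia.
Qed.

End Measures.
End Weights.

(* Semistandardness of a matrix whose (0, 0) entry is infinite: box c of row
   a.+1 has an entry <= r only if box c of row a has an entry < r. *)
Definition SSm (m : nmat) : Prop := m 1%N 0%N = 0%N /\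
  forall a r, (0 < a)%N ->
    (\sum_(0 <= j < r.+1) m a.+1 j <= \sum_(0 <= j < r) m a j)%N.

(** Each step down a column raises the entry, so row i contains only entries at least i. In the
    induction the right side of the semistandard inequality vanishes. *)
Lemma SSm_triangular m i j : SSm m -> (j < i)%N -> m i j = 0%N.
Proof.
move=> [m10 mS]; elim: i j => // i IH j; rewrite ltnS => ji.
case: i IH ji => [|i] IH ji; first by move: ji; rewrite leqn0 => /eqP ->.
have := mS i.+1 j isT; rewrite [X in (_ <= X)%N]big1_seq ?leqn0.
  by rewrite sum_nat_seq_eq0 => /allP/(_ j); rewrite mem_index_iota ltnSn => /(_ isT)/eqP.
move=> l; rewrite mem_index_iota => /andP[_ /andP[_ lj]]; apply: IH.
exact: leq_trans lj ji.
Qed.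

Lemma sum_natD1 (P : pred nat) (F : nat -> nat) K j : (1 <= j < K)%N -> P j ->
  (\sum_(1 <= i < K | P i) F i = F j + \sum_(1 <= i < K | P i && (i != j)) F i)%N.
Proof.
move=> jK Pj; rewrite -big_filter (bigD1_seq j) ?filter_uniq ?iota_uniq//=.
  by rewrite big_filter_cond.
by rewrite mem_filter Pj mem_index_iota.
Qed.

(** * Straightening a violation of semistandardness *)

Section Straightening.
Variables (k : fieldType) (char0 : [pchar k] =i pred0) (t : k).

(** The sum of i * j * T i j for the counting matrix T, computed point by point; the infinite entry
    (0, 0) would have coefficient 0. *)
Definition wt n1 n2 (d : weight n1 t) (b : weight n2 t) (y : orbit_set d)
    (x : orbit_set b) : nat :=
  (\sum_(0 <= u < maxn (bnd y) (bnd x)) lab y u * lab x u)%N.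

Section Wt.
Variables (n1 n2 : option nat) (d : weight n1 t) (b : weight n2 t).
Implicit Types (y : orbit_set d) (x : orbit_set b).

Lemma wtE y x p : supp_le p (lab y) ->
  wt y x = (\sum_(0 <= u < p) lab y u * lab x u)%N.
Proof.
move=> yp; rewrite /wt; set q := maxn _ _.
have yq : supp_le q (lab y) by apply: bndP; rewrite leq_maxl.
case: (leqP p q) => [pq|/ltnW qp]; [|apply: esym]; apply: sum_nat_widen => // u h.
  by rewrite yp.
by rewrite yq.
Qed.

Lemma wt_cmat y x y' x' : cmat y x = cmat y' x' -> wt y x = wt y' x'.
Proof.
move=> /cmat_conj[g [-> ->]].
rewrite (@wtE y x (bnd y)) ?(@wtE (fs_act g y) _ (bnd (fs_act g y))); try exact: bndP.
apply: (@sum_nat_transport _ _ _ _ g) => u.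
- by move=> uy; rewrite (bndP (leqnn _) uy).
- by move=> uy; rewrite (bndP (leqnn _) uy).
by rewrite !lab_act [_ (g u)](sinf_funK g).
Qed.

Lemma wt_bound y x : (wt y x <= wK b * wdepth d)%N.
Proof.
rewrite (@wtE y x (bnd y)); last exact: bndP.
rewrite /wdepth (@wsum_lab _ _ _ d y id (bnd y))//; last exact: bndP.
rewrite big_distrr /=; apply: leq_sum => u _; rewrite mulnC leq_mul2r.
by rewrite ltnW ?orbT// lab_lt_wK.
Qed.

Lemma cmat_rowlt y x p a r : (0 < a)%N -> supp_le p (lab y) -> supp_le p (lab x) ->
  (\sum_(0 <= j < r) cmat y x a j =
   \sum_(0 <= u < p) ((lab y u == a) && (lab x u < r)))%N.
Proof.
move=> a0 yp xp; under eq_bigr => j _.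
  rewrite (cmatE yp xp); last by case: (a) a0.
  over.
rewrite exchange_big /=; apply: eq_bigr => u _; case: eqP => _ /=; last by rewrite big1.
have [ur|ru] := ltnP (lab x u) r; first exact: sum_delta.
rewrite big1_seq// => j; rewrite mem_index_iota => /andP[_ /andP[_ jr]].
by case: eqP => // E; move: jr; rewrite -E ltnNge ru.
Qed.

End Wt.

Section Straighten.
Variables (n : option nat) (l : weight None t) (b : weight n t).
Variables (y0 : orbit_set l) (x0 : orbit_set b) (a r : nat).
Hypothesis l_dom : forall i, (0 < i)%N -> (tw l i.+1 <= tw l i)%N.
Hypothesis viol : (a = 0%N /\ r = 0%N /\ (0 < cmat y0 x0 1 0)%N) \/
  ((0 < a)%N /\ (\sum_(0 <= j < r) cmat y0 x0 a j <
                 \sum_(0 <= j < r.+1) cmat y0 x0 a.+1 j)%N).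

(** [wK l] is a row that is empty in [l]. When a = 0 the receiving row is row 0 itself, and with r =
    0 no entry leaves it. *)
Let z := if a == 0%N then 0%N else wK l.
Let p := maxn (bnd y0) (bnd x0).
Let y0p : supp_le p (lab y0). Proof. by apply: bndP; rewrite leq_maxl. Qed.
Let x0p : supp_le p (lab x0). Proof. by apply: bndP; rewrite leq_maxr. Qed.

Let L u :=
  if lab y0 u == a then (if (lab x0 u < r)%N then a else z)
  else if lab y0 u == a.+1 then (if (lab x0 u <= r)%N then z else a.+1)
  else lab y0 u.

Let Lp : supp_le p L.
Proof.
move=> u pu; rewrite /L y0p// x0p// /z.
case: viol => [[-> [-> _]]//|[a0 _]].
by rewrite eq_sym eqn0Ngt a0.
Qed.

Let a1K : (a.+1 < wK l)%N.
Proof.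
have H j : (0 < cmat y0 x0 a.+1 j)%N -> (a.+1 < wK l)%N.
  move=> cj; have [u [<- _]] : exists u, lab y0 u = a.+1 /\ lab x0 u = j.
    apply: contrapT => /forallNP H; have [_ /(_ H) E] := @cmat_eq0 _ _ _ _ _ _ y0 x0 a.+1 j isT.
    by rewrite E in cj.
  exact: lab_lt_wK.
case: viol => [[a0 [_ c]]|[_ lt]]; first by apply: (H 0%N); rewrite a0.
apply: contrapT => aK; move: lt; rewrite [ltnRHS]big1 ?ltn0// => j _.
by apply/eqP; rewrite -leqn0 leqNgt; apply/negP => /H.
Qed.

Let LK u : (L u < (wK l).+1)%N.
Proof.
rewrite /L /z; have := lab_lt_wK y0 u; have := a1K.
by case: (a == 0%N); do ?case: ifP; lia.
Qed.

Let w i := (\sum_(0 <= u < p) (L u == i))%N.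
Let w0 i : ((wK l).+1 <= i)%N -> w i = 0%N.
Proof. by move=> iK; rewrite /w big1// => u _; case: eqP => // E; have := LK u; lia. Qed.

Let nu : weight None t := @mkw _ t None w _ isT w0 (fun i => fun h => False_ind _ (notF h)).

Let tw_nu i : (0 < i)%N -> tw nu i = w i.
Proof. exact: tw_mkw. Qed.

Lemma straighten_middle : exists v0 : orbit_set nu, lab v0 =1 L.
Proof. by apply: (lab_exists Lp) => i i0; rewrite tw_nu. Qed.

Let za : (0 < a)%N -> z = wK l. Proof. by rewrite /z; case: (a). Qed.
Let zN1 : z != a.+1.
Proof. by rewrite /z; have := a1K; case: (a) => // a' h; apply/eqP => /=; lia. Qed.

Section Middle.
Variable v0 : orbit_set nu.
Hypothesis v0E : lab v0 =1 L.

Let P (i j : nat) := (j <> z -> i = j) /\ (j = z -> i = a \/ i = a.+1) /\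
  (i <> a -> i <> a.+1 -> j = i) /\ (i = a -> j = a \/ j = z) /\
  (i = a.+1 -> j = a.+1 \/ j = z).

Let P0 u : P (lab y0 u) (lab v0 u).
Proof.
rewrite v0E /L /P; have := lab_lt_wK y0 u; have := a1K.
have : a = 0%N /\ z = 0%N \/ (0 < a)%N /\ z = wK l.
  by rewrite /z; case: (a); [left|right].
have [->|ya] := eqVneq (lab y0 u) a.
  by case: ifP => _; repeat split; try lia; auto.
have [->|yb] := eqVneq (lab y0 u) a.+1.
  by case: ifP => _; repeat split; try lia; auto.
by move=> h1 h2 h3; repeat split; move: ya yb; try (move=> /eqP ? /eqP ?); try lia.
Qed.

(** The middle labelling is determined by the outer two. A point that v labels a+1 has label a+1 in
    [y0] and more than r in [x0], so [v0] labels it a+1 too; equal cardinalities give equality. The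
    same works for a > 0, and the other points have no choice left. Hence the coefficient is 1 for
    every [t]. *)
Lemma straighten_value :
  hom_comp t (ker l nu (cmat y0 v0)) (ker nu b (cmat v0 x0)) (y0, x0) = 1.
Proof.
rewrite /= (@integral_supp _ _ _ _ _ _ [:: tt] (fun=> v0))//=.
- by rewrite big_seq1 !asboolT// mulr1.
- by move=> [] [].
move=> v; case: asboolP => [E1|]; last by rewrite mul0r eqxx.
case: asboolP => [E2 _|]; last by rewrite mulr0 eqxx.
exists tt => //; apply: lab_inj => u.
have Pv u' : P (lab y0 u') (lab v u').
  have [g [-> ->]] := cmat_conj (esym E1).
  by rewrite !lab_act; apply: P0.
have Q0 u' : (lab v0 u' = a -> (0 < a)%N -> (lab x0 u' < r)%N) /\
    (lab v0 u' = a.+1 -> (r < lab x0 u')%N).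
  rewrite v0E /L; split.
    move=> + a0; have := a1K; rewrite za//.
    have [_|ya] := eqVneq (lab y0 u') a; first by case: ifP => //; lia.
    have [_|yb] := eqVneq (lab y0 u') a.+1; first by case: ifP; lia.
    by move/eqP: ya.
  move/eqP: (zN1) => zN; have [_|ya] := eqVneq (lab y0 u') a; first by case: ifP; lia.
  have [_|yb] := eqVneq (lab y0 u') a.+1; first by case: leqP => // _ /zN.
  by move/eqP: yb.
have Qv u' : (lab v u' = a -> (0 < a)%N -> (lab x0 u' < r)%N) /\
    (lab v u' = a.+1 -> (r < lab x0 u')%N).
  have [g [-> ->]] := cmat_conj (esym E2).
  by rewrite !lab_act; apply: Q0.
have sub1 u' : lab v u' = a.+1 -> lab v0 u' = a.+1.
  move=> vu; have [H _] := Pv u'; move/eqP: (zN1) => zN.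
  rewrite v0E /L H ?vu; last by move=> E; apply: zN.
  rewrite gtn_eqF// eqxx leqNgt (Qv u').2//.
have suba u' : (0 < a)%N -> lab v u' = a -> lab v0 u' = a.
  move=> a0 vu; have [H _] := Pv u'.
  by rewrite v0E /L H ?vu ?eqxx ?(Qv u').1// za//; have := a1K; lia.
have [_ [_ [R1 [R2 R3]]]] := Pv u; have [_ [_ [S1 [S2 S3]]]] := P0 u.
have bwd1 : lab v0 u = a.+1 -> lab v u = a.+1 by apply: lab_sub.
have bwda : (0 < a)%N -> lab v0 u = a -> lab v u = a.
  by move=> a0; apply: lab_sub => // u'; apply: suba.
have fwd1 := sub1 u; have fwda := suba u.
have [ya|ya] := eqVneq (lab y0 u) a.
  have [a0|a0] := posnP a.
    have zE : z = a by rewrite /z a0.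
    by move: (R2 ya) (S2 ya); rewrite zE => -[->|->] [->|->].
  case: (R2 ya) (S2 ya) => [va|vz] [va'|vz'].
  - by rewrite va.
  - by rewrite fwda.
  - by rewrite bwda.
  - by rewrite vz.
have [yb|yb] := eqVneq (lab y0 u) a.+1.
  case: (R3 yb) (S3 yb) => [va|vz] [va'|vz'].
  - by rewrite va.
  - by rewrite fwd1.
  - by rewrite bwd1.
  - by rewrite vz.
by move/eqP: ya => ya; move/eqP: yb => yb; rewrite R1 ?S1.
Qed.

Lemma straighten_support y x :
  hom_comp t (ker l nu (cmat y0 v0)) (ker nu b (cmat v0 x0)) (y, x) != 0 ->
  cmat y x = cmat y0 x0 \/ (wt y0 x0 < wt y x)%N.
Proof.
move=> h0.
have [v [E1 E2]] : exists v : orbit_set nu, cmat y v = cmat y0 v0 /\ cmat v x = cmat v0 x0.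
  apply: contrapT => /forallNP H; case/eqP: h0; rewrite /= -[RHS](@integral0 k char0 t _ nu t).
  congr (integral t _); apply/funext => v /=; case: asboolP => E1; last by rewrite mul0r.
  by case: asboolP => E2; rewrite ?mulr0//; case: (H v).
have [g [vE xE]] := cmat_conj (esym E2).
(* After conjugating (v, x) to (v0, x0), only the first labelling varies. *)
pose y1 := fs_act g^-1%g y.
have yE : y = fs_act g y1 by rewrite fs_actKV.
have c1 : cmat y x = cmat y1 x0 by rewrite yE xE cmat_act.
have E1' : cmat y0 v0 = cmat y1 v0 by rewrite -E1 yE vE cmat_act.
rewrite (wt_cmat c1) c1.
have P1 u : P (lab y1 u) (lab v0 u).
  have [h [-> vh]] := cmat_conj E1'; rewrite {1}vh.
  by rewrite !lab_act; apply: P0.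
pose q := maxn p (bnd y1).
have y0q : supp_le q (lab y0) by apply: supp_leW y0p; rewrite leq_maxl.
have x0q : supp_le q (lab x0) by apply: supp_leW x0p; rewrite leq_maxl.
have y1q : supp_le q (lab y1) by apply: bndP; rewrite leq_maxr.
have sumy : (\sum_(0 <= u < q) lab y0 u = \sum_(0 <= u < q) lab y1 u)%N.
  exact: (@lab_sum _ _ _ _ _ _ _ id).
(* This is (lab y1 u - lab y0 u) * (lab x0 u - r) >= 0 without subtraction: on points labelled z by
   [v0], [y0] puts the entries above r in row a and those below r in row a+1. The r terms cancel
   after summation by [sumy]. *)
have local u : (lab y0 u * lab x0 u + r * lab y1 u <= lab y1 u * lab x0 u + r * lab y0 u)%N /\
    (lab y0 u * lab x0 u + r * lab y1 u = lab y1 u * lab x0 u + r * lab y0 u -> 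
     lab x0 u != r -> lab y1 u = lab y0 u)%N.
  have [A0 [A1 _]] := P0 u; have [B0 [B1 _]] := P1 u.
  have [vz|/eqP vz] := eqVneq (lab v0 u) z; last by rewrite (A0 vz) (B0 vz).
  have C0 : (lab y0 u = a -> r <= lab x0 u)%N.
    move=> ya; move: vz; rewrite v0E /L ya eqxx; case: ltnP => // xr E.
    move: xr E; case: viol => [[_ [-> _]]//|[a0 _]] _; rewrite za//.
    by have := a1K; lia.
  have C1 : (lab y0 u = a.+1 -> lab x0 u <= r)%N.
    move=> ya; move: vz; rewrite v0E /L ya eqxx gtn_eqF//; case: leqP => // _ /eqP.
    by rewrite eq_sym (negPf zN1).
  split; first by case: (A1 vz) => e; case: (B1 vz) => e'; rewrite e e';
    [|have := C0 e|have := C1 e|]; nia.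
  move=> E /eqP xr; move: E; case: (A1 vz) => e; case: (B1 vz) => e'; rewrite e e' //;
    [have := C0 e|have := C1 e]; nia.
have le : (wt y0 x0 <= wt y1 x0)%N.
  rewrite (wtE _ y0q) (wtE _ y1q).
  rewrite -(leq_add2r (r * \sum_(0 <= u < q) lab y1 u)) -{2}sumy !big_distrr -!big_split /=.
  by apply: leq_sum => u _; apply: (local u).1.
case: ltngtP le => // [|eqw] _; [by right|left].
have same u : (u < q)%N -> lab x0 u != r -> lab y1 u = lab y0 u.
  move=> uq; apply: (local u).2; apply/eqP; rewrite eqn_leq (local u).1 /=.
  rewrite leqNgt; apply/negP => lt.
  have : (\sum_(0 <= u < q) (lab y0 u * lab x0 u + r * lab y1 u) <
          \sum_(0 <= u < q) (lab y1 u * lab x0 u + r * lab y0 u))%N.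
    rewrite (bigD1_seq u) ?mem_index_iota ?iota_uniq//=.
    rewrite [ltnRHS](bigD1_seq u) ?mem_index_iota ?iota_uniq//=.
    by rewrite -addSn leq_add//; apply: leq_sum => u' _; apply: (local u').1.
  rewrite !big_split -!big_distrr /= sumy -(wtE _ y0q) -(wtE _ y1q) eqw.
  by rewrite ltnn.
apply/funext => i; apply/funext => j.
have [/eqP[-> ->]|ij] := boolP ((i, j) == (0, 0)%N); first by rewrite !cmat00.
rewrite (cmatE y1q x0q ij) (cmatE y0q x0q ij).
have [jr|jr] := eqVneq j r; last first.
  apply: eq_big_nat => u /andP[_ uq]; case: (eqVneq (lab x0 u) j) => [xj|]; last by rewrite !andbF.
  by rewrite same// xj.
(* The matrices agree outside column r, and the equal row counts settle column r. *)
have E := @lab_sum _ _ _ _ _ _ _ (fun c => nat_of_bool (c == i)) y1q y0q.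
have split y' : (\sum_(0 <= u < q) (lab y' u == i) =
    \sum_(0 <= u < q) ((lab y' u == i) && (lab x0 u == j)) +
    \sum_(0 <= u < q) ((lab y' u == i) && (lab x0 u != j)))%N.
  by rewrite -big_split; apply: eq_bigr => u _; case: (lab y' u == i); case: (lab x0 u == j).
move: E; rewrite !split.
rewrite [X in (_ + X = _)%N -> _](eq_big_nat _ _
  (F2 := fun u => nat_of_bool ((lab y0 u == i) && (lab x0 u != j)))); first by move=> /addIn.
move=> u /andP[_ uq]; case: (eqVneq (lab x0 u) j) => [|xj]; first by rewrite !andbF.
by rewrite same// -jr.
Qed.

(** A violation in rows 0 and 1 moves a point into row 0 and lowers the size. Otherwise the new row
    is longer than row a, hence by dominance of [l] than row a+1, and its term in [wpow] outweighs
    both. *)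
Lemma straighten_size : (wsize nu <= wsize l)%N /\
  ((wsize nu < wsize l)%N \/ (wpow l < wpow nu)%N).
Proof.
have v0p : supp_le p (lab v0) by move=> u /Lp; rewrite v0E.
have c1 : (1 != 0)%N by [].
have S n' (d : weight n' t) (y : orbit_set d) : supp_le p (lab y) ->
    wsize d = (\sum_(0 <= u < p) (lab y u != 0%N))%N.
  move=> yp; rewrite -(@wsum_lab _ _ _ d y (fun l => nat_of_bool (l != 0)) p)//.
  rewrite /wsize /wsum; apply: eq_big_nat => i /andP[i0 _].
  by rewrite -lt0n i0.
have le u : ((lab v0 u != 0) <= (lab y0 u != 0))%N.
  rewrite v0E /L /z; case: (eqVneq (lab y0 u) a) => [->|ya].
    by case: (posnP a) => [->|a0]; [case: ifP|exact: leq_b1].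
  case: (eqVneq (lab y0 u) a.+1) => [->|yb]; first exact: leq_b1.
  by [].
split; first by rewrite (S _ _ _ v0p) (S _ _ _ y0p); apply: leq_sum => u _; apply: le.
case: viol => [[a0 [r0 c10]]|[a0 lt]].
  left; rewrite (S _ _ _ v0p) (S _ _ _ y0p).
  have [u [yu xu]] : exists u, lab y0 u = 1%N /\ lab x0 u = 0%N.
    apply: contrapT => /forallNP H; have [_ /(_ H) E] := @cmat_eq0 _ _ _ _ _ _ y0 x0 1 0 isT.
    by rewrite E in c10.
  have up : (u < p)%N by rewrite ltnNge; apply/negP => /y0p; rewrite yu.
  rewrite (bigD1_seq u) ?mem_index_iota ?iota_uniq//=.
  rewrite [ltnRHS](bigD1_seq u) ?mem_index_iota ?iota_uniq//=.
  rewrite v0E /L /z a0 r0 yu xu /= add0n add1n ltnS.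
  by apply: leq_sum => u' _; apply: le.
right.
have aK := a1K; have zK := za a0.
have wE i : i != a -> i != a.+1 -> i != z -> w i = (\sum_(0 <= u < p) (lab y0 u == i))%N.
  move=> ia ib iz; apply: eq_bigr => u _; congr (nat_of_bool _); rewrite /L.
  case: (eqVneq (lab y0 u) a) => [->|_].
    by case: ifP => _; rewrite [in RHS]eq_sym (negPf ia) eq_sym ?(negPf ia) ?(negPf iz).
  case: (eqVneq (lab y0 u) a.+1) => [->|_]; last by [].
  by case: ifP => _; rewrite [in RHS]eq_sym (negPf ib) eq_sym ?(negPf ib) ?(negPf iz).
(* Row z loses the A entries of row a below r and gains the B entries of row a+1 up to r; the
   violation says A < B. *)
have wz : (tw l a < w z)%N.
  rewrite -(lab_count y0p a0).
  have := lt; rewrite (cmat_rowlt _ _ y0p x0p)// (cmat_rowlt _ _ y0p x0p)//.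
  set A := (\sum_(0 <= u < p) _)%N; set B := (\sum_(0 <= u < p) _)%N => AB.
  have E : (\sum_(0 <= u < p) (lab y0 u == a) + B <= w z + A)%N.
    rewrite /w /A /B -!big_split /=; apply: leq_sum => u _; rewrite /L ltnS.
    have [->|ya] := eqVneq (lab y0 u) a.
      by rewrite ltn_eqF// andFb addn0; case: ifP => _; rewrite ?eqxx /= ?add1n ?addn1; lia.
    by case: (eqVneq (lab y0 u) a.+1) => //= _; case: ifP => _; rewrite ?eqxx; lia.
  by lia.
pose K := maxn (maxn (wK l) (wK nu)) z.+1.
have lK : (wK l <= K)%N by rewrite /K; lia.
have nuK : (wK nu <= K)%N by rewrite /K; lia.
have zltK : (z < K)%N by rewrite /K; lia.
rewrite /wpow (wsum_widen _ lK)// (wsum_widen _ nuK)//.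
have aK1 : (1 <= a < K)%N by lia.
have bK1 : (1 <= a.+1 < K)%N by lia.
have zK1 : (1 <= z < K)%N by lia.
have ba : a.+1 != a by rewrite gtn_eqF.
have zNa : (z != a) && (z != a.+1) by rewrite !gtn_eqF//; lia.
have twz : tw l z = 0%N by rewrite tw_wK// zK.
rewrite (sum_natD1 _ aK1)//= (sum_natD1 _ bK1)//= (sum_natD1 _ zK1)//= twz subnn add0n.
rewrite [in ltnRHS](sum_natD1 _ aK1)//= [in ltnRHS](sum_natD1 _ bK1)//=.
rewrite [in ltnRHS](sum_natD1 _ zK1)//=.
rewrite [X in (_ < _ + (_ + (_ + X)))%N]
  (_ : _ = \sum_(1 <= i < K | (i != a) && (i != a.+1) && (i != z)) (2 ^ tw l i - 1))%N; last first.
  rewrite big_nat_cond [RHS]big_nat_cond; apply: eq_bigr => i.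
  case/andP => /andP[i0 _] /andP[/andP[ia ib] iz].
  by rewrite tw_nu// wE// (lab_count y0p).
rewrite (tw_nu (i := z)); last lia.
set R := (\sum_(_ <= _ < _ | _) _)%N.
have h1 := leq_pexp2l (isT : 0 < 2)%N wz; rewrite expnS in h1.
have h2 := leq_pexp2l (isT : 0 < 2)%N (l_dom a0).
have h3 := expn_gt0 2 (tw l a); have h4 := expn_gt0 2 (tw l a.+1).
move: h1 h2 h3 h4; set A := (2 ^ tw l a)%N; set B := (2 ^ tw l a.+1)%N.
set C := (2 ^ w z)%N; set A' := (2 ^ tw nu a)%N; set B' := (2 ^ tw nu a.+1)%N.
move=> /= h1 h2 h3 h4; lia.
Qed.

End Middle.

Lemma straighten : exists (nu : weight None t)
    (g : perm_hom k (orbit_set nu) (orbit_set l))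
    (f : perm_hom k (orbit_set b) (orbit_set nu)),
  [/\ (wsize nu <= wsize l)%N, (wsize nu < wsize l)%N \/ (wpow l < wpow nu)%N,
    hom_comp t g f (y0, x0) = 1 &
    forall y x, hom_comp t g f (y, x) != 0 ->
      cmat y x = cmat y0 x0 \/ (wt y0 x0 < wt y x)%N].
Proof.
have [v0 v0E] := straighten_middle; have [s1 s2] := straighten_size v0E.
exists nu, (ker l nu (cmat y0 v0)), (ker nu b (cmat v0 x0)); split=> //.
  exact: straighten_value.
exact: straighten_support.
Qed.
End Straighten.
End Straightening.

(** * Codeterminants span *)

Section SpanningTheorem.
Variables (k : fieldType) (char0 : [pchar k] =i pred0) (t : k) (n : option nat).
Hypothesis n_gt0 : n != Some 0%N.
Implicit Types d b l : weight n t.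

Definition ss_pair d b l (m : nmat * nmat) : Prop :=
  [/\ dominant l, (exists (z : orbit_set d) (y : orbit_set l), cmat z y = m.1),
   (exists (y : orbit_set l) (x : orbit_set b), cmat y x = m.2),
   SSm (trm m.1) & SSm m.2].

(** The analogue of the standard codeterminants of classical Schur algebras. *)
Definition codet d b (f : perm_hom k (orbit_set b) (orbit_set d)) : Prop :=
  exists l m, ss_pair d b l m /\ f = hom_comp t (ker d l m.1) (ker l b m.2).

Lemma codet_htr d b f : @codet d b f -> codet (htr f).
Proof.
move=> [l [[m1 m2] [[ldom [z [y zy]] [y' [x yx]] s1 s2] ->]]].
exists l, (trm m2, trm m1); split; last by rewrite htr_comp !htr_ker.
split=> //=.
- exists x, y'; apply/funext => i; apply/funext => j.
  by rewrite -cmat_tr yx.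
exists y, z; apply/funext => i; apply/funext => j.
by rewrite -cmat_tr zy.
Qed.

Lemma codet_span_htr d b f : spanned (@codet d b) f -> spanned (@codet b d) (htr f).
Proof. by move=> sf; apply: spanned_linear (@htr_linear _ _ _) _ sf => g /codet_htr. Qed.

(** Returns from unlimited range to range [n]: by triangularity a row i outside the range has
    entries only in columns at least i, which are outside the range too, where [b] vanishes. *)
Lemma dominant_through (c : weight None t) b (y : orbit_set c) (x : orbit_set b) :
  (forall i, (0 < i)%N -> (tw c i.+1 <= tw c i)%N) -> SSm (cmat y x) ->
  exists2 l : weight n t, dominant l & forall i, (0 < i)%N -> tw l i = tw c i.
Proof.
move=> cdom ss; pose K := maxn (wK c) (wK b).
pose w i := if i == 0%N then 0%N else tw c i.
have w0 i : (wK c <= i)%N -> w i = 0%N.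
  by move=> Ki; rewrite /w tw_wK//; case: eqP.
have wn i : ~~ in_range n i -> w i = 0%N.
  rewrite /w => ni; case: (posnP i) => // i0.
  rewrite -(cmat_row y x i0 (leqnn _)) big1_seq// => j _.
  have [ji|ij] := ltnP j i; first exact: SSm_triangular.
  have nj : ~~ in_range n j.
    by move: ni; rewrite /in_range; case: n => // N; rewrite -!leqNgt => /leq_trans; apply.
  have [j0 bj] := weight_out n_gt0 b nj.
  have := cmat_col y x j0 (leq_maxl (wK c) i.+1); rewrite bj => /eqP.
  rewrite sum_nat_seq_eq0 => /allP/(_ i).
  by rewrite mem_index_iota leq_max ltnSn orbT => /(_ isT)/eqP.
exists (mkw t n_gt0 w0 wn) => [i i0|i i0]; last by rewrite tw_mkw// /w (gtn_eqF i0).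
rewrite -!/(tw _ _) !tw_mkw// /w gtn_eqF// gtn_eqF//.
exact: cdom.
Qed.

Lemma ss_comp_span (c : weight None t) d b (z : orbit_set d) (y : orbit_set c)
    (y' : orbit_set c) (x : orbit_set b) :
  (forall i, (0 < i)%N -> (tw c i.+1 <= tw c i)%N) ->
  SSm (trm (cmat z y)) -> SSm (cmat y' x) ->
  spanned (@codet d b) (hom_comp t (ker d c (cmat z y)) (ker c b (cmat y' x))).
Proof.
move=> cdom s1 s2; have [l ldom lE] := dominant_through cdom s2.
have [phi [psi phiK psiK] [phiA phiL]] := @relabel_bij _ _ _ _ l c id id
  (fun=> erefl) (fun=> erefl) erefl (fun i i0 => esym (lE i i0)).
have E1 : cmat z (phi y) = cmat z y by apply: eq_cmat.
have E2 : cmat (phi y') x = cmat y' x by apply: eq_cmat.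
apply: spanned_mem; exists l, (cmat z y, cmat y' x); split.
  split=> //=; first by exists z, (phi y).
  by exists (phi y'), x.
exact/esym/ker_comp_eq.
Qed.

Definition through (c : weight None t) : Prop := forall d b
  (g : perm_hom k (orbit_set c) (orbit_set d)) (f : perm_hom k (orbit_set b) (orbit_set c)),
  spanned (@codet d b) (hom_comp t g f).

Lemma comp_span_ker n' (c : weight n' t) d b (g : perm_hom k (orbit_set c) (orbit_set d))
    (f : perm_hom k (orbit_set b) (orbit_set c)) :
  (forall y x, f (y, x) != 0 -> spanned (@codet d b) (hom_comp t g (ker c b (cmat y x)))) ->
  spanned (@codet d b) (hom_comp t g f).
Proof.
move=> H; have [ms [a [aE ->]]] := hom_decomp f.
pose phi (f0 : perm_hom k (orbit_set b) (orbit_set c)) := hom_comp t g f0.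
have lphi : linear phi := hom_comp_linr char0 g.
have : {subset ms <= ms} by [].
elim: {1 3}ms => [_|m r IH sub].
  rewrite big_nil -/(phi 0); have := lphi (-1) 0 0; rewrite scaleN1r oppr0 addr0 => ->.
  by rewrite scaleN1r addNr; apply: spanned0.
rewrite big_cons -/(phi _) lphi; apply: spannedD; last first.
  by apply: IH => m' m'r; apply: sub; rewrite inE m'r orbT.
have [|y [x [<- ->]]] := aE m; first by apply: sub; rewrite inE eqxx.
have [->|fyx] := eqVneq (f (y, x)) 0; first by rewrite scale0r; apply: spanned0.
exact/spannedZ/H.
Qed.

Lemma not_SSm (m : nmat) : ~ SSm m -> exists a r,
  (a = 0%N /\ r = 0%N /\ (0 < m 1 0)%N) \/
  ((0 < a)%N /\ (\sum_(0 <= j < r) m a j < \sum_(0 <= j < r.+1) m a.+1 j)%N).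
Proof.
move=> nss; have [m10|m10] := posnP (m 1%N 0%N); last by exists 0%N, 0%N; left.
apply: contrapT => /forallNP H; apply: nss; split=> // a r a0.
by rewrite leqNgt; apply/negP => h; apply: (H a); exists r; right.
Qed.

(** [g] stays arbitrary, so the lemma can be applied to one factor, and after transposition to the
    other. The inner induction is on increasing [wt], which [wt_bound] keeps bounded. *)
Lemma straighten_span (c : weight None t) d b
    (g : perm_hom k (orbit_set c) (orbit_set d)) (f : perm_hom k (orbit_set b) (orbit_set c)) :
  (forall i, (0 < i)%N -> (tw c i.+1 <= tw c i)%N) ->
  (forall c' : weight None t, (wsize c' <= wsize c)%N ->
     (wsize c' < wsize c)%N \/ (wpow c < wpow c')%N -> through c') ->
  (forall (y : orbit_set c) (x : orbit_set b), SSm (cmat y x) -> spanned (@codet d b) (hom_comp t g (ker c b (cmat y x)))) ->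
  spanned (@codet d b) (hom_comp t g f).
Proof.
move=> cdom IHc Hss; apply: comp_span_ker => y x _.
have [N] := ubnP (wK b * wdepth c - wt y x)%N.
elim: N y x => // N IH y x; rewrite ltnS => Nwt.
have [ss|/not_SSm[a [r viol]]] := pselect (SSm (cmat y x)); first exact: Hss.
have [c' [f2 [f1 [s1 s2 v1 supp]]]] := straighten char0 cdom viol.
pose h := hom_comp t f2 f1.
(* The first term factors through a better weight; the second is supported on matrices of larger
   [wt]. *)
have -> : ker c b (cmat y x) = h - (h - ker c b (cmat y x)) by rewrite opprB addrC subrK.
have -> : hom_comp t g (h - (h - ker c b (cmat y x))) =
    hom_comp t g h - hom_comp t g (h - ker c b (cmat y x)).
  have E := hom_comp_linr char0 g (-1) (h - ker c b (cmat y x)) h.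
  by move: E; rewrite /= !scaleN1r => E; rewrite [LHS](congr1 _ (addrC _ _)) E addrC.
apply: spannedB; first by rewrite (hom_compA char0); apply: IHc.
apply: comp_span_ker => y' x'.
have -> : (h - ker c b (cmat y x)) (y', x') =
  h (y', x') - (`[< cmat y' x' = cmat y x >])%:R by [].
case: asboolP => [E|E]; first by rewrite (hom_cmat _ E) v1 subrr eqxx.
rewrite subr0 => /supp[//|lt]; apply: IH.
apply: leq_trans Nwt; have := wt_bound y x; have := wt_bound y' x'; lia.
Qed.

(** Lexicographic induction: on decreasing [wsize], then on increasing [wpow], then on decreasing
    [wdepth]. The first two serve straightening, the third serves sorting. *)
Lemma through_all (c : weight None t) : through c.
Proof.
have [N1] := ubnP (wsize c); elim: N1 c => // N1 IH1 c; rewrite ltnS => cN1.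
have [N2] := ubnP (2 ^ wsize c - wpow c)%N.
elim: N2 c cN1 => // N2 IH2 c cN1; rewrite ltnS => cN2.
have [N3] := ubnP (wdepth c).
elim: N3 c cN1 cN2 => // N3 IH3 c cN1 cN2; rewrite ltnS => cN3.
have small (c' : weight None t) : (wsize c' <= wsize c)%N ->
     (wsize c' < wsize c)%N \/ (wpow c < wpow c')%N -> through c'.
  move=> le H; have [lt|ge] := ltnP (wsize c') (wsize c).
    by apply: IH1; apply: leq_trans cN1.
  have eqs : wsize c' = wsize c by apply/eqP; rewrite eqn_leq le.
  apply: IH2; first by rewrite eqs.
  have := wpow_le c'; have := expn_gt0 2 (wsize c'); rewrite eqs.
  by move: H cN2; rewrite eqs ltnn => -[//|] /=; lia.
move=> d b g f.
have [cdom|] := pselect (forall i, (0 < i)%N -> (tw c i.+1 <= tw c i)%N).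
  apply: straighten_span => // y x ss.
  (* The right factor is now a semistandard kernel; transposing exposes the left factor. *)
  rewrite -[hom_comp _ _ _]htrK; apply: codet_span_htr.
  rewrite htr_comp; apply: straighten_span => // y' z' ss'.
  rewrite -[hom_comp _ _ _]htrK; apply: codet_span_htr; rewrite htr_comp htrK htr_ker.
  have -> : trm (cmat y' z') = cmat z' y'.
    by apply/funext => i; apply/funext => j; rewrite -cmat_tr.
  apply: ss_comp_span => //.
  move: ss'; congr SSm; by apply/funext => i; apply/funext => j; rewrite -cmat_tr.
(* Rows a and a+1 are in the wrong order. Swapping them keeps [wsize] and [wpow] and lowers
   [wdepth]. *)
move=> /existsNP[a /not_implyP[a0 /negP]]; rewrite -ltnNge => lt.
pose w i := if i == 0%N then 0%N else tw c (swap_fun a a.+1 i).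
have aK : (a.+1 < wK c)%N.
  by rewrite ltnNge; apply/negP => /tw_wK E; rewrite E in lt.
have w0 i : (wK c <= i)%N -> w i = 0%N.
  move=> Ki; rewrite /w /swap_fun; case: eqP => // _.
  by rewrite !gtn_eqF ?tw_wK//; lia.
pose c' := @mkw _ t None w _ isT w0 (fun i => fun h => False_ind _ (notF h)).
have sw0 : swap_fun a a.+1 0 = 0%N by rewrite /swap_fun ltn_eqF.
have swK := @swap_funK a a.+1.
have c'E i : (0 < i)%N -> tw c' i = tw c (swap_fun a a.+1 i).
  by move=> i0; rewrite tw_mkw// /w gtn_eqF.
have c'E2 i : (0 < i)%N -> tw c' (swap_fun a a.+1 i) = tw c i.
  move=> i0; rewrite c'E ?swK// lt0n; apply/eqP => E.
  by move: i0; rewrite -(swK i) E sw0.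
have [g' [f' <-]] := @relabel _ _ _ _ c c' _ _ swK swK sw0 c'E2 _ _ d b g f.
pose K := maxn (wK c) (wK c').
have cK : (wK c <= K)%N by rewrite leq_maxl.
have c'K : (wK c' <= K)%N by rewrite leq_maxr.
have split2 (F : nat -> nat) : (\sum_(1 <= i < K) F i = F a + (F a.+1 +
    \sum_(1 <= i < K | (i != a) && (i != a.+1)) F i))%N.
  rewrite (@sum_natD1 _ _ _ a)//=; last lia.
  by rewrite (@sum_natD1 _ _ _ a.+1)//=; [lia|rewrite gtn_eqF].
have ta : tw c' a = tw c a.+1 by rewrite c'E// /swap_fun eqxx.
have tb : tw c' a.+1 = tw c a by rewrite c'E// /swap_fun eqxx gtn_eqF.
have rest (F : nat -> nat -> nat) : (\sum_(1 <= i < K | (i != a) && (i != a.+1)) F i (tw c' i) =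
    \sum_(1 <= i < K | (i != a) && (i != a.+1)) F i (tw c i))%N.
  rewrite big_nat_cond [RHS]big_nat_cond; apply: eq_bigr => i.
  move=> /andP[/andP[i0 _] /andP[ia ib]].
  by rewrite c'E// /swap_fun (negPf ia) (negPf ib).
have sz : wsize c' = wsize c.
  rewrite /wsize (wsum_widen _ cK)// (wsum_widen _ c'K)// !split2.
  by rewrite (rest (fun _ x => 1 * x)%N) ta tb; lia.
have pw : wpow c' = wpow c.
  rewrite /wpow (wsum_widen _ cK)// (wsum_widen _ c'K)// !split2.
  by rewrite (rest (fun _ x => 2 ^ x - 1)%N) ta tb; lia.
have dp : (wdepth c' < wdepth c)%N.
  rewrite /wdepth (wsum_widen _ cK) ?(wsum_widen _ c'K)//; try by move=> ?; rewrite muln0.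
  by rewrite !split2 (rest muln) ta tb; nia.
by apply: IH3; rewrite ?sz ?pw//; apply: leq_trans dp cN3.
Qed.

Theorem codet_spans d b (f : perm_hom k (orbit_set b) (orbit_set d)) :
  spanned (@codet d b) f.
Proof.
pose w i := if i == 0%N then 0%N else tw b i.
have w0 i : (wK b <= i)%N -> w i = 0%N.
  by move=> Ki; rewrite /w tw_wK//; case: eqP.
pose c := @mkw _ t None w _ isT w0 (fun i => fun h => False_ind _ (notF h)).
rewrite -(hom_comp_idr char0 f).
have cE i : (0 < i)%N -> tw c i = tw b i.
  by move=> i0; rewrite tw_mkw// /w gtn_eqF.
have [g' [f' <-]] := @relabel _ _ _ _ b c id id (fun=> erefl) (fun=> erefl) erefl cE _ _ d b f (hom_id k _).
exact: through_all.
Qed.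

End SpanningTheorem.

(** * Linear independence *)

Definition runs (F : nat -> nat) K : seq nat := flatten [seq nseq (F j) j | j <- iota 0 K].

Lemma size_runs F K : size (runs F K) = (\sum_(0 <= j < K) F j)%N.
Proof.
rewrite /runs size_flatten /shape sumnE !big_map /index_iota subn0.
by apply: eq_bigr => j _; rewrite size_nseq.
Qed.

Lemma runsS F K : runs F K.+1 = runs F K ++ nseq (F K) K.
Proof. by rewrite /runs -addn1 iotaD map_cat flatten_cat /= cats0. Qed.

Lemma count_runs F K j : count_mem j (runs F K) = if (j < K)%N then F j else 0%N.
Proof.
elim: K => [|K IH] //; rewrite runsS count_cat IH count_nseq /= ltnS [(j <= K)%N]leq_eqVlt.
by case: (ltngtP j K) => [jK|Kj|->]; rewrite ?mul0n ?mul1n ?addn0 ?eqxx ?gtn_eqF// eq_sym.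
Qed.

(** In a weakly increasing row the entries below r form an initial segment; this turns entries of
    boxes into partial row sums, the language of [SSm]. *)
Lemma nth_runs F K c r : (forall j, (K <= j)%N -> F j = 0%N) -> (c < size (runs F K))%N ->
  (nth 0%N (runs F K) c < r)%N = (c < \sum_(0 <= j < r) F j)%N.
Proof.
move=> FK; have H J : (J <= K)%N -> (c < size (runs F J))%N ->
    (nth 0%N (runs F J) c < r)%N = (c < \sum_(0 <= j < r) F j)%N.
  elim: J => [//|J IH] JK; rewrite runsS size_cat size_nseq nth_cat => cJ.
  case: (ltnP c (size (runs F J))) => [lt|ge]; first by rewrite IH// ltnW.
  rewrite nth_nseq; have -> : (c - size (runs F J) < F J)%N by lia.
  rewrite size_runs in ge cJ.
  case: (ltnP J r) => Jr.
    apply/esym; apply: (leq_trans cJ).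
    by rewrite [leqRHS](@big_cat_nat _ _ _ J.+1)//= big_nat_recr//= leq_addr.
  apply/esym/negbTE; rewrite -leqNgt; apply: leq_trans ge.
  by rewrite [leqRHS](@big_cat_nat _ _ _ r)//= leq_addr.
exact: H.
Qed.

Section RunsSemistandard.
Variables (T : nmat) (K : nat) (w : nat -> nat).
Hypothesis TK : forall i j, (K <= j)%N -> T i j = 0%N.
Hypothesis Tw : forall i, (0 < i)%N -> (\sum_(0 <= j < K) T i j = w i)%N.
Hypothesis wdom : forall i, (0 < i)%N -> (w i.+1 <= w i)%N.
Hypothesis ss : SSm T.

Lemma dom_le i j : (0 < i)%N -> (i <= j)%N -> (w j <= w i)%N.
Proof.
move=> i0; elim: j => [|j IH]; first by case: i i0.
rewrite leq_eqVlt ltnS => /predU1P[->//|ij].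
by apply: leq_trans (IH ij); apply: wdom; apply: leq_trans ij.
Qed.

Lemma runs_lt i c r : (0 < i)%N -> (c < w i)%N ->
  (nth 0%N (runs (T i) K) c < r)%N = (c < \sum_(0 <= j < r) T i j)%N.
Proof. by move=> i0 ci; apply: nth_runs; [apply: TK|rewrite size_runs Tw]. Qed.

Lemma runs_mono i i' c : (0 < i)%N -> (i < i')%N -> (c < w i')%N ->
  (nth 0%N (runs (T i) K) c < nth 0%N (runs (T i') K) c)%N.
Proof.
move=> i0; elim: i' => // i' IH; rewrite ltnS leq_eqVlt => /predU1P[<-|ii'] ci.
  rewrite runs_lt//; last by apply: leq_trans ci _; apply: wdom.
  by apply: leq_trans (ss.2 i _ i0); rewrite -runs_lt.
have i'0 : (0 < i')%N by apply: leq_trans ii'.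
have ci' : (c < w i')%N by apply: leq_trans ci _; apply: wdom.
apply: leq_trans (IH ii' ci') _; apply: ltnW.
by rewrite runs_lt//; apply: leq_trans (ss.2 i' _ i'0); rewrite -runs_lt.
Qed.

(** Strictness against the zeros of the infinite row 0: the condition on the entry (1, 0) gives it
    for row 1, and columns increase from there. *)
Lemma runs_pos i c : (0 < i)%N -> (c < w i)%N -> (0 < nth 0%N (runs (T i) K) c)%N.
Proof.
move=> i0 ci; have e1 : (0 < nth 0%N (runs (T 1) K) c)%N.
  rewrite lt0n -leqn0 -ltnS runs_lt//; last by apply: leq_trans ci _; apply: dom_le.
  by rewrite big_nat1 ss.1.
case: i i0 ci => [//|[//|i]] _ ci.
by apply: leq_trans e1 _; apply: ltnW; apply: runs_mono.
Qed.

End RunsSemistandard.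

(** * Rearrangements within columns *)

Lemma seq_argmin (T : eqType) (s : seq T) (P : pred T) (f : T -> nat) i :
  i \in s -> P i -> exists j, [/\ j \in s, P j & forall i', i' \in s -> P i' -> (f j <= f i')%N].
Proof.
have [N] := ubnP (f i); elim: N i => // N IH i; rewrite ltnS => fN is_ Pi.
have [[j [js Pj lt]]|H] := pselect (exists j, [/\ j \in s, P j & (f j < f i)%N]).
  by apply: (IH j) => //; apply: leq_trans fN.
exists i; split=> // j js Pj; rewrite leqNgt; apply/negP => lt.
by apply: H; exists j.
Qed.

(** Induction on the number of moved points: with u lowest among them and s v = u, exchanging the
    images of u and v raises the sum by (f v - f u) * (g (s u) - g u) > 0. *)
Lemma rearrangement N (f g col : 'I_N -> nat) (s : 'S_N) :
  (forall u v, col u = col v -> f u = f v -> u = v) ->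
  (forall u v, col u = col v -> (f u < f v)%N -> (g u < g v)%N) ->
  (forall u, col (s u) = col u) -> s <> 1%g ->
  (\sum_u f u * g (s u) < \sum_u f u * g u)%N.
Proof.
move=> inj mono; have [M] := ubnP #|[pred u | s u != u]|.
elim: M s => // M IH s; rewrite ltnS => sM scol s1.
have [u0 u0P] : exists u, s u != u.
  apply: contrapT => /forallNP H; apply: s1; apply/permP => u; rewrite perm1.
  by apply/eqP/negPn/negP/H.
have u0E : u0 \in enum 'I_N by rewrite mem_enum.
have [u [_ su umin]] := @seq_argmin _ _ (fun w => s w != w) f _ u0E u0P.
pose v := (s^-1)%g u; have sv : s v = u by rewrite permKV.
have vu : v != u by apply: contra_neq su => E; rewrite -{1}E sv.
have lt w : col w = col u -> s w != w -> w != u -> (f u < f w)%N.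
  move=> cw sw wu; rewrite ltn_neqAle umin ?mem_enum// andbT.
  by apply: contra_neq wu => E; apply: inj.
have fuv : (f u < f v)%N by apply: lt => //; rewrite ?sv 1?eq_sym// -scol sv.
have guw : (g u < g (s u))%N.
  apply: mono; first by rewrite scol.
  by apply: lt => //; rewrite ?scol// (inj_eq perm_inj).
(* Composing with a transposition fixes the lowest moved point [u]. *)
pose s' := (tperm u v * s)%g.
have s'u : s' u = u by rewrite permM tpermL sv.
have s'v : s' v = s u by rewrite permM tpermR.
have s'w w : w != u -> w != v -> s' w = s w.
  by move=> wu wv; rewrite permM tpermD// eq_sym.
have step : (\sum_u f u * g (s u) < \sum_u f u * g (s' u))%N.
  rewrite (bigD1 u)//= (bigD1 v)//= [ltnRHS](bigD1 u)//= [X in (_ < _ + X)%N](bigD1 v)//=.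
  rewrite s'u s'v sv [X in (_ < _ + (_ + X))%N](eq_bigr (fun w => f w * g (s w))%N).
    by set R := (\sum_(_ | _) _)%N; nia.
  by move=> w /andP[wu wv]; rewrite s'w.
apply: (leq_trans step).
have [->|/eqP s'1] := eqVneq s' 1%g.
  by apply: leq_sum => w _; rewrite perm1.
apply: ltnW; apply: IH => //.
  apply: leq_trans sM; apply: proper_card; apply/properP; split; last first.
    by exists u; rewrite !inE ?su// s'u eqxx.
  apply/fintype.subsetP => w; rewrite !inE; have [->|wu] := eqVneq w u; first by rewrite su.
  have [->|wv] := eqVneq w v; first by rewrite sv [u == v]eq_sym vu.
  by rewrite s'w.
move=> w; rewrite permM scol; case: tpermP => [->|->|//].
  by rewrite -scol sv.
by rewrite -[RHS]scol sv.
Qed.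

Section PermSinf.
Variable N : nat.

Definition perm_fun (s : 'S_N) (u : nat) : nat :=
  if insub u is Some i then val (s i) else u.

Lemma perm_funK s : cancel (perm_fun s) (perm_fun s^-1%g).
Proof.
move=> u; rewrite {2}/perm_fun; case: insubP => [i _ <-|/negPf uN].
  by rewrite /perm_fun valK permK.
by rewrite /perm_fun insubF.
Qed.

Lemma perm_funKV s : cancel (perm_fun s^-1%g) (perm_fun s).
Proof. by move=> u; rewrite -{1}[s]invgK perm_funK. Qed.

Definition perm_sinf s : Sinf := MkSinf (perm_funK s) (perm_funKV s).

Lemma perm_sinf_ord s (i : 'I_N) : perm_sinf s i = s i.
Proof. by rewrite /= /perm_fun valK. Qed.

Lemma perm_sinf_out s u : (N <= u)%N -> perm_sinf s u = u.
Proof. by move=> Nu; rewrite /= /perm_fun insubF// ltnNge Nu. Qed.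

(** The order is reversed because products in 'S_N compose from left to right and those in [Sinf]
    from right to left. *)
Lemma perm_sinfM s s' : perm_sinf (s * s')%g = (perm_sinf s' * perm_sinf s)%g.
Proof.
apply: sinf_eq => u; rewrite -[RHS]/(perm_sinf s' (perm_sinf s u)).
have [uN|Nu] := ltnP u N; last by rewrite !perm_sinf_out.
by rewrite -[u]/(val (Ordinal uN)) !perm_sinf_ord permM.
Qed.

Lemma perm_sinfV s : perm_sinf s^-1%g = (perm_sinf s)^-1%g.
Proof. exact: sinf_eq. Qed.

Lemma perm_sinf1 : perm_sinf 1%g = 1%g.
Proof.
apply: sinf_eq => u; have [uN|Nu] := ltnP u N; last by rewrite perm_sinf_out.
by rewrite -[u]/(val (Ordinal uN)) perm_sinf_ord perm1.
Qed.

End PermSinf.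

Lemma weight_eq (k : fieldType) (char0 : [pchar k] =i pred0) n (t : k) (b c : weight n t) :
  (forall i, (0 < i)%N -> tw b i = tw c i) -> b = c.
Proof.
move=> bc; have E : weight_val b = weight_val c.
  pose K := (maxn (wK b) (wK c)).
  have bE : \sum_(0 <= i < K) b i = t by apply: weight_sumE; rewrite leq_maxl.
  have cE : \sum_(0 <= i < K) c i = t by apply: weight_sumE; rewrite leq_maxr.
  have K0 : (0 < K)%N by rewrite leq_max wK_gt0.
  have bc' i : (0 < i)%N -> b i = c i by move=> i0; rewrite !twE// bc.
  apply/funext => i; have [->|] := posnP i; last exact: bc'.
  have := etrans bE (esym cE).
  rewrite (@big_cat_nat _ _ _ 1)//= big_nat1 [RHS](@big_cat_nat _ _ _ 1)//= big_nat1.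
  rewrite [X in _ + X = _ -> _](eq_big_nat _ _ (F2 := c)) => [|j /andP[j0 _]]; last exact: bc'.
  by move=> /addIr.
case: b c E {bc} => [v1 a1 a2 a3 a4 a5] [v2 b1 b2 b3 b4 b5] /= E.
by case: v2 / E b1 b2 b3 b4 b5 => *; congr Weight; apply: Prop_irrelevance.
Qed.

(** * Antisymmetrization over the columns of a diagram *)

Section Antisymmetrizer.
Variables (k : fieldType) (char0 : [pchar k] =i pred0) (t : k) (n : option nat).
Variable l : weight n t.
Hypothesis ldom : forall i, (0 < i)%N -> (tw l i.+1 <= tw l i)%N.

Let M := wM l.
(** Points below M are the boxes of the rows i > 0, read row by row. The next [tw l 1] points
    represent a piece of the infinite row 0, just long enough to top every column. Column
    permutations move no point from N on. *)
Let N := (M + tw l 1)%N.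
Let row u := lab0 l u.
Let col u := if (u < M)%N then (u - off l (row u))%N else (u - M)%N.
Let yl : orbit_set l := coset_base (young l).

Let ylE u : lab yl u = row u. Proof. exact: lab_coset_base. Qed.

Lemma tw_le i j : (0 < i)%N -> (i <= j)%N -> (tw l j <= tw l i)%N.
Proof. exact: dom_le. Qed.

Lemma col_lt u : (u < N)%N -> (0 < row u)%N -> (col u < tw l (row u))%N.
Proof.
move=> uN r0; rewrite /col; case: (ltnP u M) => [uM|Mu].
  by have := lab0_mem r0; rewrite offS// -/(row u); lia.
by rewrite /row (lab0_supp Mu) in r0.
Qed.

Lemma row0 u : (row u == 0%N) = (M <= u)%N.
Proof.
apply/eqP/idP => [|/lab0_supp//]; rewrite leqNgt => r0; apply/negP => /lab0_lt.
by rewrite -/(row u) r0.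
Qed.

Lemma col_lt1 u : (u < N)%N -> (col u < tw l 1)%N.
Proof.
move=> uN; have [r0|r0] := posnP (row u).
  by move/eqP: r0; rewrite row0 => Mu; rewrite /col (ltnNge u) Mu /=; move: uN; rewrite /N; lia.
by apply: leq_trans (tw_le _ r0); rewrite ?col_lt.
Qed.

Lemma row_col_inj u v : row u = row v -> col u = col v -> u = v.
Proof.
move=> ruv; have E : (M <= u)%N = (M <= v)%N by rewrite -!row0 ruv.
rewrite /col ruv; have [Mv|vM] := leqP M v.
  by rewrite (ltnNge u) E Mv /=; lia.
have uM : (u < M)%N by rewrite ltnNge E -ltnNge.
have rv : (0 < row v)%N by rewrite lt0n row0 -ltnNge.
have h1 : (off l (row v) <= v < off l (row v).+1)%N := lab0_mem rv.
have h2 : (off l (row v) <= u < off l (row v).+1)%N.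
  by rewrite -ruv; apply: lab0_mem; rewrite -/(row u) ruv.
rewrite uM; move: h1 h2; set o := off l (row v); set o' := off l _; lia.
Qed.

Definition box r c : nat := if r == 0%N then (M + c)%N else (off l r + c)%N.

Lemma row_box r c : (r = 0%N \/ (c < tw l r)%N) -> row (box r c) = r.
Proof.
rewrite /box; case: eqVneq => [->|r0] rc.
  by apply/eqP; rewrite row0 leq_addr.
case: rc => [E|rc]; first by rewrite E in r0.
by apply: lab0_off; rewrite ?lt0n// offS ?lt0n//; lia.
Qed.

Lemma col_box r c : (r = 0%N \/ (c < tw l r)%N) -> col (box r c) = c.
Proof.
move=> rc; rewrite /col row_box// (ltnNge (box r c)) -row0 row_box//.
by rewrite /box; case: eqVneq => _ /=; rewrite addKn.
Qed.

Lemma box_lt r c : (c < tw l 1)%N -> (r = 0%N \/ (c < tw l r)%N) -> (box r c < N)%N.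
Proof.
move=> c1 rc; have := row_box rc; rewrite /box; case: eqVneq => [_ _|r0 E].
  by rewrite /N ltn_add2l.
have : (off l r + c < M)%N by rewrite ltnNge -row0 E.
by rewrite /N; lia.
Qed.

Let colstab := [pred s : 'S_N | [forall u, col (s u) == col u]].

Let colstabP (s : 'S_N) : reflect (forall u : 'I_N, col (s u) = col u) (colstab s).
Proof. exact: 'forall_eqP. Qed.

Section Alternating.
Variables (b : weight n t).

Definition alt (c : weight n t) (m : nmat) (y : orbit_set c) (x : orbit_set b) : k :=
  \sum_(s | colstab s) (-1) ^+ s * ker (k := k) c b m (y, fs_act (perm_sinf s) x).

Lemma alt_act (c : weight n t) m (y : orbit_set c) x (s : 'S_N) : colstab s ->
  alt m (fs_act (perm_sinf s) y) x = (-1) ^+ s * alt m y x.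
Proof.
move=> /colstabP sc; rewrite /alt (reindex_inj (mulIg s)) mulr_sumr.
apply: eq_big => [s'|s' _].
  apply/forallP/forallP => H u; apply/eqP; have /eqP := H u; rewrite permM sc //.
rewrite odd_permM signr_addb mulrA [_ * (-1) ^+ s]mulrC perm_sinfM fs_actM.
by rewrite hom_act.
Qed.

(** The transposition of u and v fixes [y] and changes the sign of [alt], and 2 is invertible in
    characteristic 0. *)
Lemma alt_sym0 (c : weight n t) m (y : orbit_set c) x (u v : 'I_N) :
  u != v -> col u = col v -> lab y u = lab y v -> alt m y x = 0.
Proof.
move=> uv cuv luv; pose s := tperm u v.
have sc : colstab s by apply/colstabP => w; rewrite /s; case: tpermP => [->|->|].
have sy : fs_act (perm_sinf s) y = y.
  apply: lab_inj => w; rewrite lab_act -perm_sinfV tpermV.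
  have [wN|Nw] := ltnP w N; last by rewrite perm_sinf_out.
  by rewrite -[w]/(val (Ordinal wN)) perm_sinf_ord; case: tpermP => [->|->|].
have := alt_act m y x sc; rewrite sy odd_tperm uv expr1 mulN1r => /eqP.
rewrite -subr_eq0 opprK -mulr2n -mulr_natl mulf_eq0 => /orP[|/eqP//].
by move/pcharf0P: char0 => ->.
Qed.

Lemma wdepthE : wdepth l = (\sum_(u < N) row u)%N.
Proof.
rewrite /wdepth (@wsum_lab _ _ _ l yl id N)//.
  by rewrite big_mkord; apply: eq_bigr => u _; rewrite ylE.
by move=> u Nu; rewrite ylE; apply/eqP; rewrite row0; move: Nu; rewrite /N; lia.
Qed.

(** Distinct labels in a column are at least their ranks, and the ranks add up to the depth of [l].
    The bound on the depth of [c] forces labels to equal ranks, with none left beyond N; sending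
    each point to the box of its rank is the permutation sought. *)
Lemma column_distinct (c : weight n t) (y : orbit_set c) : (wdepth c <= wdepth l)%N ->
  (forall u v : 'I_N, u != v -> col u = col v -> lab y u <> lab y v) ->
  exists2 s : 'S_N, colstab s & forall u, lab y u = row (perm_sinf s u).
Proof.
move=> dcl dist.
pose A (u : 'I_N) := [pred v : 'I_N | (col v == col u) && (lab y v < lab y u)%N].
(* The rank of the label of u within its column, counted from 0. *)
pose rho u := #|A u|.
have rho_le u : (rho u <= lab y u)%N.
  rewrite -[leqRHS](size_iota 0) /rho -(size_image (fun v : 'I_N => lab y v)).
  apply: uniq_leq_size => [|_ /mapP[v + ->]]; last first.
    by rewrite mem_enum mem_iota => /andP[].
  rewrite map_inj_in_uniq ?enum_uniq// => v w; rewrite !mem_enum !inE.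
  move=> /andP[/eqP cv _] /andP[/eqP cw _] E; apply/eqP/negPn/negP => vw.
  by apply: (dist v w vw) => //; rewrite cv cw.
(* The column has more than [rho u] boxes, so it reaches row [rho u] and the target box exists. *)
have rho_box u : rho u = 0%N \/ (col u < tw l (rho u))%N.
  have [->|r0] := posnP (rho u); [by left|right].
  rewrite ltnNge; apply/negP => ge.
  pose B := [pred v : 'I_N | col v == col u].
  have AB : (rho u < #|B|)%N.
    apply: proper_card; apply/properP; split.
      by apply/fintype.subsetP => v; rewrite !inE => /andP[].
    by exists u; rewrite !inE ?eqxx// ltnn andbF.
  move: AB; apply/negP; rewrite -leqNgt -[leqRHS](size_iota 0).
  rewrite -(size_image (fun v : 'I_N => row v)).
  apply: uniq_leq_size => [|_ /mapP[v + ->]].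
    rewrite map_inj_in_uniq ?enum_uniq// => v w; rewrite !mem_enum !inE.
    by move=> /eqP cv /eqP cw E; apply/val_inj/row_col_inj => //; rewrite cv cw.
  rewrite mem_enum inE => /eqP cv; rewrite mem_iota add0n /= ltnNge; apply/negP => rv.
  have rv0 : (0 < row v)%N by apply: leq_trans rv.
  have := col_lt (ltn_ord v) rv0; rewrite cv ltnNge => /negP; apply.
  by apply: leq_trans ge; apply: tw_le.
have boxN u : (box (rho u) (col u) < N)%N by apply: box_lt; rewrite ?col_lt1.
pose f u : 'I_N := Ordinal (boxN u).
have fcol u : col (f u) = col u by apply: col_box.
have frow u : row (f u) = rho u by apply: row_box.
have rho_mono (u v : 'I_N) : col u = col v -> (lab y u < lab y v)%N -> (rho u < rho v)%N.
  move=> cuv luv; apply: proper_card; apply/properP; split.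
    apply/fintype.subsetP => w; rewrite !inE cuv => /andP[-> h] /=.
    exact: ltn_trans luv.
  by exists u; rewrite !inE ?ltnn ?andbF// cuv eqxx.
have finj : injective f.
  move=> u v E; apply/eqP/negPn/negP => uv.
  have cuv : col u = col v by rewrite -fcol E fcol.
  have ruv : rho u = rho v by rewrite -frow E frow.
  have := dist u v uv cuv; case: (ltngtP (lab y u) (lab y v)) => // h _.
    by have := rho_mono u v cuv h; rewrite ruv ltnn.
  by have := rho_mono v u (esym cuv) h; rewrite ruv ltnn.
pose s := perm finj.
pose q := maxn N (bnd y).
have yq : supp_le q (lab y) by apply: bndP; rewrite leq_maxr.
have sumq : wdepth c = (\sum_(u < N) lab y u + \sum_(N <= u < q) lab y u)%N.
  rewrite /wdepth (@wsum_lab _ _ _ c y id q)// (@big_cat_nat _ _ _ N) ?leq_maxl//=.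
  by rewrite big_mkord.
have sumrho : wdepth l = (\sum_(u < N) rho u)%N.
  rewrite wdepthE (reindex_inj (@perm_inj _ s)); apply: eq_bigr => u _.
  by rewrite permE frow.
have lerho : (\sum_(u < N) rho u <= \sum_(u < N) lab y u)%N by apply: leq_sum.
exists s; first by apply/colstabP => u; rewrite permE fcol.
move=> u; have [uN|Nu] := ltnP u N; last first.
  rewrite perm_sinf_out//.
  have -> : row u = 0%N by apply/eqP; rewrite row0; move: Nu; rewrite /N; lia.
  have [uq|/yq//] := ltnP u q.
  have : (\sum_(N <= u < q) lab y u == 0)%N by lia.
  rewrite sum_nat_seq_eq0 => /allP/(_ u); rewrite mem_index_iota Nu uq => /(_ isT).
  by move/eqP.
rewrite -[u]/(val (Ordinal uN)) perm_sinf_ord permE frow.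
apply/eqP; rewrite eqn_leq rho_le andbT leqNgt; apply/negP => lt.
have : (\sum_(u < N) rho u < \sum_(u < N) lab y u)%N.
  rewrite (bigD1 (Ordinal uN))//= [ltnRHS](bigD1 (Ordinal uN))//= -addSn.
  by apply: leq_add => //; apply: leq_sum.
by lia.
Qed.

Lemma alt_supp (c : weight n t) m (y : orbit_set c) x : (wdepth c <= wdepth l)%N -> alt m y x != 0 ->
  exists2 s : 'S_N, colstab s & forall u, lab y u = row (perm_sinf s u).
Proof.
move=> dcl alt0; apply: column_distinct => // u v uv cuv luv.
by move: alt0; rewrite (alt_sym0 m x uv cuv luv) eqxx.
Qed.

Lemma same_weight (c : weight n t) (y : orbit_set c) (s : 'S_N) :
  (forall u, lab y u = row (perm_sinf s u)) -> c = l.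
Proof.
move=> ys; apply: weight_eq => // i i0; pose p := maxn N (bnd y).
have yp : supp_le p (lab y) by apply: bndP; rewrite leq_maxr.
rewrite -(lab_count yp i0) -(@lab0_count _ _ _ l i p)//; last first.
  by rewrite /p /N leq_max leq_addr.
apply: (@sum_nat_transport _ _ _ _ (perm_sinf s)) => u.
- by move=> /yp ->; rewrite eq_sym eqn0Ngt i0.
- move=> pu; rewrite lab0_supp; first by rewrite eq_sym eqn0Ngt i0.
  by apply: leq_trans pu; rewrite /p /N leq_max leq_addr.
by rewrite ys.
Qed.

(** Against the base labelling, a column-strict [x] is sorted in every column, so by [rearrangement]
    each nontrivial column permutation strictly lowers [wt]; only the identity reaches the matrix of
    [x] itself. *)
Lemma alt_strict (x : orbit_set b) :
  (forall u v : 'I_N, col u = col v -> (row u < row v)%N -> (lab x u < lab x v)%N) ->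
  (forall (y' : orbit_set l) (x' : orbit_set b), alt (cmat y' x') yl x != 0 ->
     cmat y' x' = cmat yl x \/ (wt y' x' < wt yl x)%N) /\
  alt (cmat yl x) yl x = 1.
Proof.
move=> strict.
have ylN : supp_le N (lab yl).
  by move=> u Nu; rewrite ylE; apply/eqP; rewrite row0; move: Nu; rewrite /N; lia.
have wlt (s : 'S_N) : colstab s -> s <> 1%g -> (wt yl (fs_act (perm_sinf s) x) < wt yl x)%N.
  move=> /colstabP sc s1; rewrite !(wtE _ ylN) !big_mkord.
  rewrite [ltnLHS](eq_bigr (fun u : 'I_N => (row u * lab x (s^-1%g u))%N)); last first.
    by move=> u _; rewrite ylE lab_act -perm_sinfV perm_sinf_ord.
  rewrite [ltnRHS](eq_bigr (fun u : 'I_N => (row u * lab x u)%N)); last first.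
    by move=> u _; rewrite ylE.
  apply: (@rearrangement N (fun u => row u) (fun u => lab x u) (fun u => col u)) => //.
  - by move=> u v cuv ruv; apply/val_inj/row_col_inj.
  - by move=> u; rewrite -sc permKV.
  - by move=> /(congr1 invg); rewrite invgK invg1.
split=> [y' x' alt0|].
  have [s [sc E]] : exists s, colstab s /\ cmat yl (fs_act (perm_sinf s) x) = cmat y' x'.
    apply: contrapT => /forallNP H; case/eqP: alt0; rewrite /alt big1// => s sc /=.
    by case: asboolP => E; rewrite ?mulr0//; case: (H s).
  have [s1|/eqP s1] := eqVneq s 1%g.
    by left; rewrite -E s1 perm_sinf1 fs_act1.
  by right; rewrite -(wt_cmat E); apply: wlt.
have kE (x' : orbit_set b) : ker l b (cmat yl x) (yl, x') =
  (`[< cmat yl x' = cmat yl x >])%:R :> k by [].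
rewrite /alt (bigD1 1%g); last by apply/colstabP => u; rewrite perm1.
rewrite odd_perm1 expr0 mul1r perm_sinf1 fs_act1 kE asboolT// big1; first exact: addr0.
move=> s /andP[sc /eqP s1]; rewrite kE; case: asboolP => E; rewrite ?mulr0//.
by have := wlt s sc s1; rewrite (wt_cmat E) ltnn.
Qed.

End Alternating.

Section Pairing.
Variables (d b : weight n t).

Definition altf (f : perm_hom k (orbit_set b) (orbit_set d)) z x : k :=
  \sum_(s | colstab s) (-1) ^+ s * f (z, fs_act (perm_sinf s) x).

Lemma altf_sum (I : Type) (r : seq I) (a : I -> k)
    (F : I -> perm_hom k (orbit_set b) (orbit_set d)) z x :
  altf (\sum_(i <- r) a i *: F i) z x = \sum_(i <- r) a i * altf (F i) z x.
Proof.
have E yx : (\sum_(i <- r) a i *: F i : perm_hom k (orbit_set b) (orbit_set d)) yx =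
    \sum_(i <- r) a i * F i yx.
  elim: r => [|i r IH]; first by rewrite !big_nil.
  by rewrite !big_cons -IH.
rewrite /altf (eq_bigr (fun s : 'S_N => \sum_(i <- r)
  (-1) ^+ s * (a i * F i (z, fs_act (perm_sinf s) x)))); last first.
  by move=> s _; rewrite E mulr_sumr.
rewrite exchange_big /=; apply: eq_bigr => i _; rewrite mulr_sumr.
by apply: eq_bigr => s _; rewrite mulrCA.
Qed.

Lemma altf_comp (c : weight n t) m1 m2 z x :
  altf (hom_comp t (ker d c m1) (ker c b m2)) z x =
  integral t (fun y : orbit_set c => ker (k := k) d c m1 (z, y) * alt m2 y x).
Proof.
rewrite /altf -big_filter.
rewrite -(@integral_sum _ char0 _ _ c t _ _ (fun s : 'S_N => (-1) ^+ s)
  (fun s (y : orbit_set c) => ker (k := k) d c m1 (z, y) *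
     ker (k := k) c b m2 (y, fs_act (perm_sinf s) x))); last first.
  by move=> s; apply: smoothM; [apply: hom_smoothl|apply: hom_smoothr].
congr (integral t _); apply/funext => y; rewrite /alt big_filter mulr_sumr.
by apply: eq_bigr => s _; rewrite mulrCA.
Qed.

Lemma altf_other (c : weight n t) m1 m2 z x : (wdepth c <= wdepth l)%N ->
  altf (hom_comp t (ker d c m1) (ker c b m2)) z x != 0 -> c = l.
Proof.
move=> dcl; rewrite altf_comp => H.
have [y alt0] : exists y : orbit_set c, alt m2 y x != 0.
  apply: contrapT => /forallNP E; case/eqP: H; rewrite -[RHS](@integral0 k char0 t _ c t).
  congr (integral t _); apply/funext => y.
  by have /negP/negPn/eqP -> := E y; rewrite mulr0.
by have [s _ ys] := alt_supp dcl alt0; apply: same_weight ys.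
Qed.

(** The second factor restricts the middle point to column translates of [yl], so the integral is a
    finite sum. There its value is a sign times [alt m2 yl x], and those signs antisymmetrize the
    first factor. *)
Lemma altf_diag m1 m2 z x :
  altf (hom_comp t (ker d l m1) (ker l b m2)) z x = alt (trm m1) yl z * alt m2 yl x.
Proof.
have colV (s : 'S_N) : colstab s -> colstab s^-1%g.
  by move=> /colstabP sc; apply/colstabP => u; rewrite -sc permKV.
rewrite altf_comp (@integral_supp _ char0 _ _ l _ [seq s <- enum 'S_N | colstab s]
  (fun s => fs_act (perm_sinf s) yl)).
- rewrite big_filter big_enum_cond /=.
  rewrite (eq_bigr (fun s : 'S_N => (-1) ^+ s * ker (k := k) d l m1 (z, fs_act (perm_sinf s) yl)
      * alt m2 yl x)); last first.
    by move=> s sc; rewrite alt_act// mulrA [_ * (-1) ^+ _]mulrC.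
  rewrite -mulr_suml; congr (_ * _).
  rewrite /alt [RHS](reindex_inj invg_inj).
  apply: eq_big => [s|s _]; first by apply/idP/idP => /colV; rewrite ?invgK.
  rewrite odd_permV; congr (_ * _).
  rewrite -(htr_ker d l m1) perm_sinfV.
  have -> : htr (ker d l m1) (yl, fs_act (perm_sinf s)^-1%g z) =
    ker (k := k) d l m1 (fs_act (perm_sinf s)^-1%g z, yl) by [].
  by rewrite -[in LHS](fs_actKV (perm_sinf s) z) hom_act.
- by rewrite filter_uniq ?enum_uniq.
(* The translates are distinct: a point is determined by its row and its column. *)
- move=> s s'; rewrite !mem_filter => /andP[sc _] /andP[s'c _] E.
  apply: (@invg_inj 'S_N); apply/permP => u; apply/val_inj/row_col_inj.
    have := congr1 (fun y => lab y u) E; rewrite !lab_act !ylE -!perm_sinfV.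
    by rewrite !perm_sinf_ord.
  by move/colstabP: (colV _ sc) => ->; move/colstabP: (colV _ s'c) => ->.
move=> y; have [->|alt0 _] := eqVneq (alt m2 y x) 0; first by rewrite mulr0 eqxx.
have [s sc ys] := alt_supp (leqnn _) alt0.
exists s^-1%g; first by rewrite mem_filter colV// mem_enum.
by apply: lab_inj => u; rewrite ys lab_act ylE -perm_sinfV invgK.
Qed.

End Pairing.

Section Filling.
Variables (b : weight n t) (y0 : orbit_set l) (x0 : orbit_set b).
Hypothesis ss : SSm (cmat y0 x0).
Let T := cmat y0 x0.
Let K := wK b.

Let TK i j : (K <= j)%N -> T i j = 0%N.
Proof.
move=> Kj; have ij : (i, j) != (0, 0)%N.
  by rewrite xpair_eqE negb_and; have := wK_gt0 b; move: Kj; rewrite /K; lia.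
by apply/cmat_eq0 => // u [_ xj]; have := lab_lt_wK x0 u; rewrite xj ltnNge Kj.
Qed.

Let e i c := nth 0%N (runs (T i) K) c.

Let size_e i : (0 < i)%N -> size (runs (T i) K) = tw l i.
Proof. by move=> i0; rewrite size_runs; apply: cmat_row. Qed.

Let Tw i : (0 < i)%N -> (\sum_(0 <= j < K) T i j = tw l i)%N.
Proof. by move=> i0; apply: cmat_row. Qed.

(** The part of row 0 lying over the columns gets label 0; the finitely many nonzero entries of row
    0 are placed from N on, outside the reach of column permutations. *)
Let L u := if (u < M)%N then e (row u) (col u) else if (u < N)%N then 0%N else e 0 (u - N).
Let p := (N + size (runs (T 0) K))%N.

Let MN : (M <= N)%N. Proof. exact: leq_addr. Qed.
Let Np : (N <= p)%N. Proof. exact: leq_addr. Qed.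

Let Lp : supp_le p L.
Proof.
move=> u pu; rewrite /L !ltnNge (leq_trans _ pu) ?(leq_trans MN Np)//= (leq_trans Np pu) /=.
by rewrite /e nth_default// leq_subRL ?(leq_trans Np pu).
Qed.

Let count_e i j : (\sum_(0 <= c < size (runs (T i) K)) (e i c == j) = T i j)%N.
Proof. by rewrite count_nth// count_runs; case: ltnP => // /TK ->. Qed.

Let L_mat i j : (i, j) != (0, 0)%N ->
  (\sum_(0 <= u < p) ((row u == i) && (L u == j)) = T i j)%N.
Proof.
move=> ij; have [i0|i0] := posnP i; last first.
  have o1 : (off l i <= off l i.+1)%N by apply: off_mono.
  have o2 : (off l i.+1 <= p)%N.
    by apply: leq_trans (off_le_wM l _) _; apply: leq_trans Np.
  rewrite (@big_cat_nat _ _ _ (off l i)) ?(leq_trans o1 o2)//=.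
  rewrite (@big_cat_nat _ _ _ (off l i.+1) _ p)//=.
  rewrite big1_seq ?add0n => [|u]; last first.
    rewrite mem_index_iota /row lab0P// => /andP[_ h].
    by case: andP => // -[h1 _]; move: h h1; lia.
  rewrite [X in (_ + X)%N]big1_seq ?addn0 => [|u]; last first.
    rewrite mem_index_iota /row lab0P// => /andP[_ h].
    by case: andP => // -[h1 _]; move: h h1; lia.
  rewrite -{1}[off l i]add0n big_addn offS// addKn -(size_e i0) -count_e.
  apply: eq_big_nat => c /andP[_ ci]; rewrite size_e// in ci.
  have rc : row (c + off l i)%N = i.
    by apply: lab0_off => //; rewrite offS//; lia.
  have cM : (c + off l i < M)%N by rewrite ltnNge -row0 rc -lt0n.
  by rewrite rc eqxx /L cM rc /col cM rc addnK.
move: ij; rewrite i0 => j0.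
rewrite (@big_cat_nat _ _ _ M) ?(leq_trans MN Np)//= (@big_cat_nat _ _ _ N _ p)//=.
rewrite big1_seq ?add0n => [|u]; last first.
  by rewrite mem_index_iota => /andP[_ /andP[_ uM]]; rewrite row0 leqNgt uM.
rewrite big1_seq ?add0n => [|u]; last first.
  rewrite mem_index_iota => /andP[_ /andP[Mu uN]]; rewrite /L (ltnNge u M) Mu uN /=.
  by case: (j) j0 => // j'; rewrite andbF.
rewrite -{1}[N]add0n big_addn /p addKn -count_e; apply: eq_big_nat => c _.
rewrite row0 (leq_trans MN (leq_addl _ _)) /L !ltnNge leq_addl.
by rewrite (leq_trans MN (leq_addl _ _)) /= addnK.
Qed.

Lemma filling : exists2 x : orbit_set b, cmat yl x = T &
  forall u v : 'I_N, col u = col v -> (row u < row v)%N -> (lab x u < lab x v)%N.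
Proof.
have ylp : supp_le p (lab yl).
  move=> u pu; rewrite ylE; apply/eqP; rewrite row0.
  exact: leq_trans (leq_trans MN Np) pu.
have [|x xE] := @lab_exists _ _ _ b L p Lp.
  move=> j j0; rewrite -(cmat_col y0 x0 j0 (leqnn _)).
  have E : (\sum_(0 <= i < wK l) cmat y0 x0 i j =
      \sum_(0 <= i < wK l) \sum_(0 <= u < p) ((row u == i) && (L u == j)))%N.
    by apply: eq_bigr => i _; rewrite L_mat// xpair_eqE negb_and orbC; case: (j) j0.
  rewrite E exchange_big; apply: eq_bigr => u _.
  case: (L u == j); last by under eq_bigr do rewrite andbF; rewrite big1.
  under eq_bigr do rewrite andbT; rewrite sum_delta// -ylE.
  exact: lab_lt_wK.
exists x; last first.
  move=> u v cuv ruv; rewrite !xE /L.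
  have rv : (0 < row v)%N by apply: leq_trans ruv.
  have vM : (v < M)%N by rewrite ltnNge -row0 -lt0n.
  have cv := col_lt (ltn_ord v) rv.
  rewrite vM; case: (ltnP u M) => [uM|Mu]; last by rewrite ltn_ord; apply: (runs_pos TK Tw ldom ss).
  by rewrite cuv; apply: (runs_mono TK Tw ldom ss) => //; rewrite lt0n row0 -ltnNge.
apply/funext => i; apply/funext => j.
have [/eqP[-> ->]|ij] := boolP ((i, j) == (0, 0)%N); first by rewrite /T !cmat00.
have xp : supp_le p (lab x) by move=> u /Lp; rewrite xE.
rewrite (cmatE ylp xp ij) -L_mat//.
by apply: eq_bigr => u _; rewrite ylE xE.
Qed.

End Filling.

(** The functional attached to a semistandard pair: antisymmetrize and evaluate at its two
    column-strict fillings. Among codeterminants of no larger depth it detects only those of weight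
    [l] that are no higher in both factors. *)
Lemma triangular_functional (d b : weight n t) (y1 y2 : orbit_set l)
    (z1 : orbit_set d) (x2 : orbit_set b) : SSm (cmat y1 z1) -> SSm (cmat y2 x2) ->
  exists z x,
    altf (hom_comp t (ker d l (trm (cmat y1 z1))) (ker l b (cmat y2 x2))) z x = 1 /\
    forall (c : weight n t) (y1' y2' : orbit_set c) (z1' : orbit_set d) (x2' : orbit_set b),
      (wdepth c <= wdepth l)%N ->
      altf (hom_comp t (ker d c (trm (cmat y1' z1'))) (ker c b (cmat y2' x2'))) z x != 0 ->
      [/\ c = l, cmat y1' z1' = cmat y1 z1 \/ (wt y1' z1' < wt y1 z1)%N &
        cmat y2' x2' = cmat y2 x2 \/ (wt y2' x2' < wt y2 x2)%N].
Proof.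
move=> ss1 ss2; have [z zE zs] := filling ss1; have [x xE xs] := filling ss2.
exists z, x; split.
  rewrite altf_diag -[trm (trm _)]/(cmat y1 z1) -zE -xE.
  by rewrite (alt_strict zs).2 (alt_strict xs).2 mulr1.
move=> c y1' y2' z1' x2' cl H; have cE := altf_other cl H; subst c; move: H.
rewrite altf_diag mulf_eq0 negb_or => /andP[/(alt_strict zs).1 h1 /(alt_strict xs).1 h2].
by split=> //; [rewrite -zE -(wt_cmat zE)|rewrite -xE -(wt_cmat xE)].
Qed.

End Antisymmetrizer.

(** * Codeterminants are independent *)

Section Independence.
Variables (k : fieldType) (char0 : [pchar k] =i pred0) (t : k) (n : option nat).
Variables (d b : weight n t).

Definition mat_wt (l b : weight n t) (m : nmat) : nat :=
  let z := choose_or (coset_base (young l) : orbit_set l, coset_base (young b) : orbit_set b)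
    (fun z : orbit_set l * orbit_set b => cmat z.1 z.2 = m) in
  wt z.1 z.2.

Lemma mat_wtE (l c : weight n t) (y : orbit_set l) (x : orbit_set c) m :
  cmat y x = m -> mat_wt l c m = wt y x.
Proof.
move=> yx; rewrite /mat_wt; set z := choose_or _ _; apply: wt_cmat.
rewrite yx; exact: (@choose_orP _ _ (fun z => cmat z.1 z.2 = m) (y, x) yx).
Qed.

Local Notation idx := (weight n t * (nmat * nmat))%type.

Definition codet_at (i : idx) : perm_hom k (orbit_set b) (orbit_set d) :=
  hom_comp t (ker d i.1 i.2.1) (ker i.1 b i.2.2).

Lemma codet_free (s : seq idx) (a : idx -> k) : uniq s ->
  (forall i, i \in s -> ss_pair d b i.1 i.2) ->
  \sum_(i <- s) a i *: codet_at i = 0 -> forall i, i \in s -> a i = 0.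
Proof.
have aux (D' x y : nat) : (D' - x <= D' - y -> y <= D' -> x <= D' -> y <= x)%N by lia.
have aux2 (A B A' B' : nat) : (A + B <= A' + B' -> A' < A -> B' <= B -> False)%N by lia.
move=> us ss sum0 i0 i0s; apply: contrapT => /eqP ai0.
pose D := \max_(i <- s) wdepth i.1.
have Dle i : i \in s -> (wdepth i.1 <= D)%N.
  by move=> is_; apply: (@leq_bigmax_seq _ _ predT (fun i => wdepth i.1)).
(* Minimizing D - depth selects a term of maximal depth. *)
have [i1 [i1s ai1 i1max]] :=
  @seq_argmin _ s (fun i => a i != 0) (fun i => D - wdepth i.1)%N _ i0s ai0.
pose W (i : idx) := (mat_wt i.1 d (trm i.2.1) + mat_wt i.1 b i.2.2)%N.
pose P (i : idx) := (a i != 0) && (wdepth i.1 == wdepth i1.1).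
have Pi1 : P i1 by rewrite /P ai1 eqxx.
(* Among the terms of maximal depth, one with the smallest sum of both [wt] values. Another term
   seen by its functional has neither value larger, so by minimality both are equal, and so are the
   matrices. *)
have [[l [m1 m2]] [js /andP[aj /eqP jd] jmin]] := @seq_argmin _ s P W _ i1s Pi1.
rewrite /= in jd.
have [ldom [z1 [y1 zy1]] [y2 [x2 yx2]] ss1 ss2] := ss _ js.
rewrite /= in ldom zy1 yx2 ss1 ss2.
have zy1' : cmat y1 z1 = trm m1.
  by apply/funext => i; apply/funext => j; rewrite -cmat_tr zy1.
rewrite -zy1' in ss1; rewrite -yx2 in ss2.
have [z [x [F1 F2]]] := triangular_functional char0 ldom ss1 ss2.
have := congr1 (fun f => altf l f z x) sum0.
rewrite altf_sum (bigD1_seq (l, (m1, m2)))//= big1_seq ?addr0.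
  rewrite /codet_at /= in F1 *; rewrite zy1' yx2 in F1; rewrite [altf _ _ _ _]F1 mulr1.
  rewrite /altf big1 => [a0|s' _]; last by rewrite -[X in _ * X]/0 mulr0.
  by rewrite a0 eqxx in aj.
move=> [c [p1 p2]] /andP[ji cs]; have [->|ac] := eqVneq (a (c, (p1, p2))) 0.
  by rewrite mul0r.
apply/eqP; rewrite mulf_eq0 (negPf ac) /=; apply/negPn/negP => alt0.
have [_ [z1' [y1' zy1c]] [y2' [x2' yx2c]] _ _] := ss _ cs.
rewrite /= in zy1c yx2c.
have zy1c' : cmat y1' z1' = trm p1.
  by apply/funext => i; apply/funext => j; rewrite -cmat_tr zy1c.
have cd : (wdepth c <= wdepth l)%N.
  by rewrite jd; apply: aux (i1max _ cs ac) (Dle _ cs) (Dle _ i1s).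
have := F2 c y1' y2' z1' x2' cd; rewrite zy1c' yx2c => /(_ alt0)[cl h1 h2].
subst c; have := jmin _ cs; rewrite /P /W /= ac jd eqxx => /(_ isT).
rewrite (mat_wtE zy1') (mat_wtE zy1c') (mat_wtE yx2) (mat_wtE yx2c).
move=> Wle.
have w1 : trm p1 = cmat y1 z1 -> wt y1' z1' = wt y1 z1.
  by move=> e; apply: wt_cmat; rewrite zy1c'.
have w2 : p2 = cmat y2 x2 -> wt y2' x2' = wt y2 x2.
  by move=> e; apply: wt_cmat; rewrite yx2c.
have e1 : trm p1 = cmat y1 z1.
  case: h1 => // l1; exfalso; apply: (aux2 _ _ _ _ Wle l1).
  by case: h2 => [/w2 ->//|/ltnW].
have e2 : p2 = cmat y2 x2.
  case: h2 => // l2; exfalso; rewrite addnC [leqRHS]addnC in Wle.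
  by apply: (aux2 _ _ _ _ Wle l2); rewrite w1.
case/eqP: ji; rewrite e2 yx2 -[p1]/(trm (trm p1)) e1 zy1'.
by [].
Qed.

End Independence.

(** * The algebra S(n, t) *)

Section DirectSumTheory.
Variables (k : fieldType) (J : choiceType) (V : J -> lmodType k).
Local Notation A := (dsum V).

Lemma dsum_inE j (v : V j) : dsum_in v j = v.
Proof. exact: dfwithin. Qed.

Lemma dsum_in_neq j (v : V j) i : i != j -> dsum_in v i = 0.
Proof. by move=> ij; rewrite /= dfwithout// eq_sym. Qed.

Lemma dsum_in_linear j : linear (@dsum_in k J V j).
Proof.
move=> a u v; apply: dsum_eq => i.
rewrite -[RHS]/(a *: dsum_in u i + dsum_in v i).
have [->|ij] := eqVneq i j; first by rewrite !dsum_inE.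
by rewrite !dsum_in_neq// scaler0 addr0.
Qed.

Lemma dsum_sumE (I : Type) (r : seq I) (F : I -> A) i :
  (\sum_(x <- r) F x) i = \sum_(x <- r) F x i.
Proof. by elim: r => [|x r IH]; rewrite ?big_nil// !big_cons -IH. Qed.

Lemma dsum_in_comp (c : J -> A) r (a : A) : uniq r ->
  (forall j, c j = dsum_in (c j j)) -> (forall j, c j j != 0 -> j \in r) ->
  (a = \sum_(j <- r) c j <-> forall j, c j j = a j).
Proof.
move=> ur cE cr.
have sumE i : (\sum_(j <- r) c j) i = c i i.
  rewrite dsum_sumE; have [ir|ir] := boolP (i \in r).
    rewrite (bigD1_seq i)//= big1 ?addr0// => j ji.
    by rewrite cE dsum_in_neq// eq_sym.
  rewrite big1_seq => [|j /andP[_ jr]].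
    by apply/esym/eqP/negPn/negP => /cr; rewrite (negPf ir).
  by rewrite cE dsum_in_neq//; apply: contraNneq ir => ->.
by split=> [-> j|E]; [rewrite sumE|apply: dsum_eq => j; rewrite sumE E].
Qed.

Lemma dsum_decomp (a : A) : exists2 r : seq J, uniq r &
  a = \sum_(j <- r) dsum_in (a j).
Proof.
have /finite_seqP[s sE] := dsum_fin a; exists (undup s); first exact: undup_uniq.
apply/(dsum_in_comp (c := fun j => dsum_in (a j))).
- exact: undup_uniq.
- by move=> j; rewrite dsum_inE.
- move=> j; rewrite dsum_inE mem_undup => aj.
  by have : [set` s] j by rewrite -sE.
by move=> j; rewrite dsum_inE.
Qed.

End DirectSumTheory.

Section SchurAlgebra.
Variables (k : fieldType) (char0 : [pchar k] =i pred0) (t : k) (n : option nat).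
Local Notation W := (weight n t).
Local Notation A := (@schur k n t).
Local Notation mul := (@schur_mul k n t).
Local Notation e := (@schur_one k n t).
Local Notation Hom b d := (perm_hom k (orbit_set b) (orbit_set d)).
Implicit Types (a g f : A) (b d c : W).

Lemma schur_mulE (g f : A) (d b : W) (r : seq W) : uniq r ->
  (forall c, hom_comp t (g (d, c)) (f (c, b)) != 0 -> c \in r) ->
  mul g f (d, b) = \sum_(c <- r) (hom_comp t (g (d, c)) (f (c, b)) : Hom b d).
Proof.
move=> ur cr; rewrite /= /schur_mul_val /= [RHS]fsbig_seq//.
symmetry; apply: fsbig_widen => // c [_ /= cNr].
by apply/eqP/negPn/negP => /cr.
Qed.

Lemma supp_left (g : A) d : exists2 r : seq W, uniq r & forall c, g (d, c) != 0 -> c \in r.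
Proof.
have /finite_seqP[s sE] := dsum_fin g; exists (undup [seq p.2 | p <- s]); first exact: undup_uniq.
move=> c gc; rewrite mem_undup; apply/mapP; exists (d, c) => //.
by have : [set` s] (d, c) by rewrite -sE.
Qed.

Lemma supp_right (f : A) b : exists2 r : seq W, uniq r & forall c, f (c, b) != 0 -> c \in r.
Proof.
have /finite_seqP[s sE] := dsum_fin f; exists (undup [seq p.1 | p <- s]); first exact: undup_uniq.
move=> c gc; rewrite mem_undup; apply/mapP; exists (c, b) => //.
by have : [set` s] (c, b) by rewrite -sE.
Qed.

Lemma schur_mul_linl f : linear (mul^~ f).
Proof.
move=> a g g'; apply: dsum_eq => -[d b].
have [r ur rP] := supp_right f b.
have H (h : A) : mul h f (d, b) = \sum_(c <- r) (hom_comp t (h (d, c)) (f (c, b)) : Hom b d).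
  apply: schur_mulE => // c; apply: contra_neqT => cr.
  have /eqP -> : f (c, b) == 0 by apply: contraNT cr => /rP.
  exact: hom_compEr0.
rewrite -[RHS]/(a *: mul g f (d, b) + mul g' f (d, b)) !H scaler_sumr -big_split /=.
by apply: eq_bigr => c _; apply: (hom_comp_linl char0).
Qed.

Lemma schur_mul_linr g : linear (mul g).
Proof.
move=> a f f'; apply: dsum_eq => -[d b].
have [r ur rP] := supp_left g d.
have H (h : A) : mul g h (d, b) = \sum_(c <- r) (hom_comp t (g (d, c)) (h (c, b)) : Hom b d).
  apply: schur_mulE => // c; apply: contra_neqT => cr.
  have /eqP -> : g (d, c) == 0 by apply: contraNT cr => /rP.
  exact: hom_compEl0.
rewrite -[RHS]/(a *: mul g f (d, b) + mul g f' (d, b)) !H scaler_sumr -big_split /=.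
by apply: eq_bigr => c _; apply: (hom_comp_linr char0).
Qed.

Lemma linear_big_sum (U V : lmodType k) (phi : U -> V) (I : Type) (r : seq I) (F : I -> U) :
  linear phi -> phi (\sum_(i <- r) F i) = \sum_(i <- r) phi (F i).
Proof.
move=> lphi; elim: r => [|i r IH]; last first.
  by rewrite !big_cons -IH -[F i]scale1r lphi !scale1r.
rewrite !big_nil; have := lphi (-1) 0 0.
by rewrite scaleN1r oppr0 addr0 => ->; rewrite scaleN1r addNr.
Qed.

Lemma schur_mulA : associative mul.
Proof.
move=> h g f; apply: dsum_eq => -[d b].
have [r ur rP] := supp_left h d; have [r' ur' r'P] := supp_right f b.
transitivity (\sum_(c <- r) \sum_(c' <- r')
    (hom_comp t (h (d, c)) (hom_comp t (g (c, c')) (f (c', b))) : Hom b d)).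
  rewrite (@schur_mulE _ _ _ _ r)// => [|c]; last first.
    apply: contra_neqT => cr; have /eqP -> : h (d, c) == 0 by apply: contraNT cr => /rP.
    exact: hom_compEl0.
  apply: eq_bigr => c _; rewrite (@schur_mulE _ _ _ _ r')// => [|c']; last first.
    apply: contra_neqT => cr; have /eqP -> : f (c', b) == 0 by apply: contraNT cr => /r'P.
    exact: hom_compEr0.
  exact: linear_big_sum (hom_comp_linr char0 _).
rewrite exchange_big /= [RHS](@schur_mulE _ _ _ _ r')// => [|c]; last first.
  apply: contra_neqT => cr; have /eqP -> : f (c, b) == 0 by apply: contraNT cr => /r'P.
  exact: hom_compEr0.
apply: eq_bigr => c' _; rewrite (@schur_mulE _ _ _ _ r)// => [|c]; last first.
  apply: contra_neqT => cr; have /eqP -> : h (d, c) == 0 by apply: contraNT cr => /rP.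
  exact: hom_compEl0.
rewrite (linear_big_sum _ _ (hom_comp_linl char0 (f (c', b)))).
by apply: eq_bigr => c _; rewrite (hom_compA char0).
Qed.

Lemma schur_one_mul d a c b : mul (e d) a (c, b) = if c == d then a (c, b) else 0.
Proof.
rewrite (@schur_mulE _ _ _ _ [:: d])// => [|c']; last first.
  apply: contra_neqT => c'd; rewrite /schur_one dsum_in_neq ?hom_compEl0//.
  by apply: contraNneq c'd => -[_ ->]; rewrite inE.
rewrite big_seq1; have [->|cd] := eqVneq c d.
  by rewrite /schur_one dsum_inE (hom_comp_idl char0).
by rewrite /schur_one dsum_in_neq ?hom_compEl0// xpair_eqE (negPf cd).
Qed.

Lemma schur_mul_one d a c b : mul a (e d) (c, b) = if b == d then a (c, b) else 0.
Proof.
rewrite (@schur_mulE _ _ _ _ [:: d])// => [|c']; last first.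
  apply: contra_neqT => c'd; rewrite /schur_one dsum_in_neq ?hom_compEr0//.
  by apply: contraNneq c'd => -[-> _]; rewrite inE.
rewrite big_seq1; have [->|bd] := eqVneq b d.
  by rewrite /schur_one dsum_inE (hom_comp_idr char0).
by rewrite /schur_one dsum_in_neq ?hom_compEr0// xpair_eqE (negPf bd) andbF.
Qed.

Lemma schur_peirce d b a : mul (mul (e d) a) (e b) = dsum_in (j := (d, b)) (a (d, b)).
Proof.
apply: dsum_eq => -[d' b']; rewrite schur_mul_one schur_one_mul.
have [[-> ->]|db] := eqVneq (d', b') (d, b); first by rewrite !eqxx dsum_inE.
rewrite dsum_in_neq//; move: db; rewrite xpair_eqE.
by case: (d' == d) => //=; case: (b' == b).
Qed.

Lemma schur_mul_in d c b (g : Hom c d) (f : Hom b c) :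
  mul (dsum_in (j := (d, c)) g) (dsum_in (j := (c, b)) f) =
  dsum_in (j := (d, b)) (hom_comp t g f : Hom b d).
Proof.
apply: dsum_eq => -[d' b']; rewrite (@schur_mulE _ _ _ _ [:: c])// => [|c']; last first.
  apply: contra_neqT => c'c; rewrite dsum_in_neq ?hom_compEl0//.
  by apply: contraNneq c'c => -[_ ->]; rewrite inE.
rewrite big_seq1; have [[-> ->]|db] := eqVneq (d', b') (d, b).
  by rewrite !dsum_inE.
rewrite [RHS]dsum_in_neq//; have [d'd|d'd] := eqVneq d' d.
  rewrite (@dsum_in_neq _ _ _ (c, b)) ?hom_compEr0//.
  by apply: contraNneq db => -[->]; rewrite d'd.
by rewrite (@dsum_in_neq _ _ _ (d, c)) ?hom_compEl0// xpair_eqE (negPf d'd).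
Qed.

Lemma schur_lua : locally_unital_algebra mul e.
Proof.
split.
- exact: schur_mul_linl.
- exact: schur_mul_linr.
- exact: schur_mulA.
- by move=> b; rewrite /schur_one schur_mul_in (hom_comp_idl char0).
- move=> c b cb; apply: dsum_eq => -[d' b']; rewrite schur_one_mul.
  case: eqVneq => [->|//]; rewrite /schur_one dsum_in_neq// xpair_eqE.
  by rewrite (negPf cb).
move=> a; pose c0 (p : W * W) : A := dsum_in (j := p) (a p).
have fsE (c : W * W -> A) (r : seq (W * W)) : uniq r -> (forall p, c p != 0 -> p \in r) ->
    \sum_(p \in [set: W * W]) c p = \sum_(p <- r) c p.
  move=> ur cr; rewrite [RHS]fsbig_seq//; symmetry; apply: fsbig_widen => // p [_ /= pr].
  by apply/eqP/negPn/negP => /cr.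
have /finite_seqP[s sE] := dsum_fin a.
have sP p : a p != 0 -> p \in undup s.
  by rewrite mem_undup => ap; have : [set` s] p by rewrite -sE.
have c0s p : c0 p != 0 -> p \in undup s.
  move=> cp; apply: sP; apply: contra_neq cp => ap; apply: dsum_eq => q.
  have [->|qp] := eqVneq q p; first by rewrite dsum_inE ap.
  by rewrite dsum_in_neq.
exists c0; split=> [|c' [c'p /finite_seqP[s' s'E] aE]].
  split.
  - by move=> [d b]; exists a => //; rewrite schur_peirce.
  - apply: (sub_finite_set _ (finite_seq (undup s))) => p; exact: c0s.
  rewrite (fsE _ (undup s)) ?undup_uniq//.
  apply/(dsum_in_comp (c := c0)); rewrite ?undup_uniq//.
  - by move=> p; rewrite /c0 dsum_inE.
  - by move=> p; rewrite /c0 dsum_inE; apply: sP.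
  by move=> p; rewrite /c0 dsum_inE.
have c'E p : c' p = dsum_in (c' p p).
  case: p => d b; have [x _ E] := c'p (d, b).
  rewrite [_ (e _)](@schur_peirce d b) in E.
  by rewrite -E dsum_inE.
have s'P p : c' p != 0 -> p \in undup s'.
  by rewrite mem_undup => ap; have : [set` s'] p by rewrite -s'E.
apply/funext => p; rewrite /c0 [RHS]c'E; congr dsum_in.
move: aE; rewrite (fsE _ (undup s')) ?undup_uniq//.
have s'Q q : c' q q != 0 -> q \in undup s'.
  by move=> c'q; apply: s'P; apply: contra_neq c'q => ->.
by move=> /(@dsum_in_comp _ _ _ c' _ a (undup_uniq s') c'E s'Q) ->.
Qed.

Fact schur_tr_fin (a : A) :
  finite_set [set p : W * W | (htr (a (p.2, p.1)) : Hom p.2 p.1) != 0].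
Proof.
have F : finite_set ((fun p : W * W => (p.2, p.1)) @` [set p | a p != 0]).
  exact/finite_image/dsum_fin.
apply: (sub_finite_set _ F) => -[d b] /= h; exists (b, d) => //=.
by apply: contra_neq h => ->; apply/val_inj/funext.
Qed.
Definition schur_tr (a : A) : A := Dsum (schur_tr_fin a).

Lemma schur_tr_in d b (f : Hom b d) :
  schur_tr (dsum_in (j := (d, b)) f) = dsum_in (j := (b, d)) (htr f : Hom d b).
Proof.
apply: dsum_eq => -[b' d']; rewrite -[LHS]/(htr (dsum_in (j := (d, b)) f (d', b'))).
have [[-> ->]|db] := eqVneq (b', d') (b, d); first by rewrite !dsum_inE.
rewrite [RHS]dsum_in_neq// dsum_in_neq; first exact/val_inj/funext.
by apply: contraNneq db => -[-> ->].
Qed.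

Lemma schur_tr_anti_involution : anti_involution mul schur_tr.
Proof.
split.
- by move=> a f g; apply: dsum_eq => -[d b]; apply: htr_linear.
- by move=> a; apply: dsum_eq => -[d b]; apply: htrK.
move=> g f; apply: dsum_eq => -[d b].
rewrite -[LHS]/(htr (mul g f (b, d))).
have [r ur rP] := supp_left g b.
rewrite (@schur_mulE _ _ _ _ r)// => [|c]; last first.
  apply: contra_neqT => cr; have /eqP -> : g (b, c) == 0 by apply: contraNT cr => /rP.
  exact: hom_compEl0.
rewrite (linear_big_sum _ _ (@htr_linear _ _ _)) [RHS](@schur_mulE _ _ _ _ r)//.
  by apply: eq_bigr => c _; rewrite htr_comp.
move=> c; apply: contra_neqT => cr.
have E : g (b, c) = 0 by apply/eqP; apply: contraNT cr => /rP.
have -> : schur_tr g (c, b) = 0.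
  by rewrite -[LHS]/(htr (g (b, c))) E; apply/val_inj/funext.
exact: hom_compEr0.
Qed.

Lemma schur_tr_one b : schur_tr (e b) = e b.
Proof.
rewrite /schur_one schur_tr_in; congr (dsum_in (j := (b, b)) _).
apply/val_inj/funext => -[y x] /=; congr (_%:R); congr (nat_of_bool _).
by apply: asbool_equiv_eq; split=> ->.
Qed.

End SchurAlgebra.

(** * Semistandard fillings *)

Lemma leq_sum_range (F G : nat -> nat) a b :
  (forall i, (a <= i < b)%N -> (F i <= G i)%N) ->
  (\sum_(a <= i < b) F i <= \sum_(a <= i < b) G i)%N.
Proof.
move=> FG; rewrite big_nat_cond [leqRHS]big_nat_cond.
by apply: leq_sum => i /andP[/FG].
Qed.

Lemma count_ltn (s : seq nat) r :
  count (fun x => x < r)%N s = (\sum_(0 <= j < r) count_mem j s)%N.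
Proof.
elim: s => [|x s IH] /=; first by rewrite big1.
rewrite big_split -IH /=; congr addn.
have [xr|rx] := ltnP x r; first by rewrite sum_delta.
rewrite big1_seq// => j; rewrite mem_index_iota => /andP[_ /andP[_ jr]].
by case: eqP => // xj; move: jr; rewrite -xj ltnNge rx.
Qed.

Lemma mono_count (f : nat -> nat) N c r :
  (forall i j, (i <= j)%N -> (j < N)%N -> (f i <= f j)%N) -> (c < N)%N ->
  (f c < r)%N = (c < count (fun x => x < r)%N (mkseq f N))%N.
Proof.
move=> fm cN; rewrite /mkseq count_map.
have -> : iota 0 N = iota 0 c ++ iota c (N - c) by rewrite -iotaD subnKC// ltnW.
rewrite count_cat; have [fc|rf] := ltnP (f c) r.
  have -> : iota c (N - c) = c :: iota c.+1 (N - c).-1 by case: (N - c)%N (subn_gt0 c N) => //; rewrite cN.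
  rewrite /= fc (eq_in_count (a2 := predT)) ?count_predT ?size_iota; first lia.
  move=> i; rewrite mem_iota => /andP[_ ic] /=; apply: leq_ltn_trans fc.
  by apply: fm => //; apply: ltnW.
rewrite [X in (_ + X)%N](eq_in_count (a2 := pred0)) ?count_pred0 ?addn0.
  apply/esym/negbTE; rewrite -leqNgt -[leqRHS](size_iota 0 c); exact: count_size.
move=> i; rewrite mem_iota => /andP[ci iN] /=; apply/negbTE; rewrite -leqNgt.
by apply: leq_trans rf _; apply: fm => //; lia.
Qed.

Section Semistandard.
Variables (k : fieldType) (char0 : [pchar k] =i pred0) (t : k) (n : option nat).
Hypothesis n_gt0 : n != Some 0%N.
Local Notation W := (weight n t).
Implicit Types l b m : W.

(** Partial sums live in [k]; passing to tails expresses dominance by sums of natural numbers, with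
    the inequality reversed. *)
Lemma partial_sum b K i : (wK b <= K)%N -> (i < K)%N ->
  \sum_(j < i.+1) b j = t - (\sum_(i.+1 <= j < K) tw b j)%N%:R.
Proof.
move=> bK iK; have E := weight_sumE bK.
rewrite -(big_mkord xpredT b); apply/eqP; rewrite eq_sym subr_eq; apply/eqP.
apply: (etrans (esym E)); rewrite (@big_cat_nat _ _ _ i.+1)//=; congr (_ + _).
by rewrite natr_sum; apply: eq_big_nat => j /andP[ij _]; rewrite twE//; lia.
Qed.

Lemma weight0E b : b 0%N = t - (wsize b)%:R.
Proof.
have := @partial_sum b (wK b) 0 (leqnn _) (wK_gt0 b); rewrite big_ord1 => ->.
by congr (_ - _%:R); rewrite /wsize /wsum; apply: eq_bigr => j _; rewrite mul1n.
Qed.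

Section OneMatrix.
Variables (l b : W) (q : nat -> nat -> k).
Hypotheses (ldom : dominant l) (qm : is_mat l b q).
Let K := wK b.
Let S := (\sum_(1 <= j < K) nq q 0 j)%N.
(** For d at least [wsize l + S] the corner entry of q(d) is a natural number; the further [tw l 1]
    gives row 0 enough entries 0 to stand over every box of the other rows. *)
Let D0 := (wsize l + S + tw l 1)%N.

Let ldom' i : (0 < i)%N -> (tw l i.+1 <= tw l i)%N. Proof. exact: ldom. Qed.

Let qK i j : (K <= j)%N -> nq q i j = 0%N.
Proof.
have [y [x <-]] := mat_realize char0 qm; move=> Kj.
have ij : (i, j) != (0, 0)%N.
  by rewrite xpair_eqE negb_and; have := wK_gt0 b; move: Kj; rewrite /K; lia.
by apply/cmat_eq0 => // u [_ xj]; have := lab_lt_wK x u; rewrite xj ltnNge Kj.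
Qed.

Let q_row i : (0 < i)%N -> (\sum_(0 <= j < K) nq q i j = tw l i)%N.
Proof. by have [y [x <-]] := mat_realize char0 qm => i0; apply: cmat_row. Qed.

Let q00 : q 0%N 0%N = t - (wsize l)%:R - S%:R.
Proof.
have := mat_row qm 0; rewrite (@fsbig_nat _ _ K); last first.
  move=> j Kj; rewrite (nqE char0 qm) ?qK// xpair_eqE.
  by have := wK_gt0 b; move: Kj; rewrite /K; lia.
rewrite weight0E => <-; rewrite (@big_cat_nat _ _ _ 1) ?wK_gt0//= big_nat1.
rewrite /S natr_sum -addrA [X in _ + X](_ : _ = 0) ?addr0//.
rewrite [X in X - _](eq_big_nat _ _ (F2 := fun j => (nq q 0 j)%:R)) ?subrr//.
by move=> j /andP[j0 _]; rewrite (nqE char0 qm)// xpair_eqE; case: (j) j0.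
Qed.

Let w_pos d i : (0 < i)%N -> weight_at l d i = tw l i.
Proof. by move=> i0; rewrite /weight_at gtn_eqF// addr0. Qed.

Let w_0 d : (D0 <= d)%N -> weight_at l d 0 = (d - wsize l)%N.
Proof.
move=> Dd; rewrite /weight_at eqxx weight0E addrC addrA subrK -natrB ?natvalE//.
by move: Dd; rewrite /D0; lia.
Qed.

Let m_pos d i j : (i, j) != (0, 0)%N -> mat_at t q d i j = nq q i j.
Proof. by move=> ij; rewrite /mat_at /nq (negPf ij) addr0. Qed.

Let m_0 d : (D0 <= d)%N -> mat_at t q d 0 0 = (d - (wsize l + S))%N.
Proof.
move=> Dd; have le : (wsize l + S <= d)%N by move: Dd; rewrite /D0; lia.
rewrite /mat_at eqxx q00 -[RHS](natvalE char0) natrB// natrD; congr natval; ring.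
Qed.

Let m_posf d i : (0 < i)%N -> mat_at t q d i = nq q i.
Proof. by move=> i0; apply/funext => j; rewrite m_pos// xpair_eqE; case: (i) i0. Qed.

Let mK d i j : (K <= j)%N -> mat_at t q d i j = 0%N.
Proof.
move=> Kj; rewrite m_pos ?qK// xpair_eqE negb_and.
by have := wK_gt0 b; move: Kj; rewrite /K; lia.
Qed.

Let m_row d i : (D0 <= d)%N -> (\sum_(0 <= j < K) mat_at t q d i j = weight_at l d i)%N.
Proof.
move=> Dd; have [->|i0] := posnP i; last by rewrite m_posf// w_pos// q_row.
rewrite w_0// (@big_cat_nat _ _ _ 1) ?wK_gt0//= big_nat1 m_0//.
rewrite [X in (_ + X)%N](_ : _ = S); first by move: Dd; rewrite /D0; lia.
by apply: eq_big_nat => j /andP[j0 _]; rewrite m_pos// xpair_eqE; case: (j) j0.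
Qed.

Lemma semistandardE : semistandard l q <-> SSm (nq q).
Proof.
split=> [[D HD]|ss].
  pose d := maxn D D0; have Dd : (D0 <= d)%N := leq_maxr _ _.
  have [T [Tmono Tcount] Tcol] := HD d (leq_maxl _ _).
  have w1 : (tw l 1 <= weight_at l d 0)%N by rewrite w_0//; move: Dd; rewrite /D0; lia.
  split.
    rewrite -(@m_pos d)//; apply/eqP; rewrite -leqn0 leqNgt; apply/negP => pos.
    have : 0%N \in mkseq (T 1%N) (weight_at l d 1) by rewrite -has_pred1 has_count Tcount.
    move=> /mapP[c]; rewrite mem_iota w_pos// => /andP[_ c1] Tc.
    have := @Tcol 0%N 1%N c isT; rewrite (w_pos d (isT : 0 < 1)%N) (leq_trans c1 w1) => /(_ isT c1).
    by rewrite -Tc ltn0.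
  move=> a r a0; rewrite leqNgt; apply/negP => lt.
  (* Box m of row a has an entry at least r, whereas box m of row a+1 has an entry at most r: this
     contradicts strictness. *)
  set m := (\sum_(0 <= j < r) _)%N in lt.
  have cnt i r' : (0 < i)%N -> count (fun x => x < r')%N (mkseq (T i) (tw l i)) =
      (\sum_(0 <= j < r') nq q i j)%N.
    move=> i0; rewrite count_ltn; apply: eq_bigr => j _.
    by rewrite -(w_pos d i0) Tcount m_posf.
  have mono i : (0 < i)%N -> forall c c', (c <= c')%N -> (c' < tw l i)%N -> (T i c <= T i c')%N.
    by move=> i0 c c' cc' c'i; apply: Tmono; rewrite ?w_pos.
  have mb : (m < tw l a.+1)%N.
    apply: leq_trans lt _; rewrite -cnt//; apply: leq_trans (count_size _ _) _.
    by rewrite size_mkseq.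
  have ma : (m < tw l a)%N := leq_trans mb (ldom' a0).
  have Tb : (T a.+1 m < r.+1)%N by rewrite (mono_count _ (mono a.+1 isT) mb) cnt.
  have Ta := @Tcol a a.+1 m (ltnSn a); rewrite !w_pos// in Ta.
  have : (T a m < r)%N by apply: leq_trans (Ta ma mb) _.
  by rewrite (mono_count _ (mono a a0) ma) cnt// ltnn.
exists D0 => d Dd; pose T i c := nth 0%N (runs (mat_at t q d i) K) c.
have size_T i : size (runs (mat_at t q d i) K) = weight_at l d i.
  by rewrite size_runs m_row.
exists T; first split.
- move=> i c c' cc' c'i; rewrite leqNgt; apply/negP => lt.
  have c'i' : (c' < size (runs (mat_at t q d i) K))%N by rewrite size_T.
  have h1 := nth_runs (T i c').+1 (mK d i) c'i'.
  have h2 := nth_runs (T i c').+1 (mK d i) (leq_ltn_trans cc' c'i').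
  move: h1; rewrite /T ltnSn => /esym h1; move: h2.
  by rewrite (leq_ltn_trans cc' h1) ltnS leqNgt lt.
- move=> i j; rewrite -size_T mkseq_nth count_runs; case: ltnP => // Kj.
  by rewrite mK.
move=> i i' c ii' ci ci'.
have i'0 : (0 < i')%N by apply: leq_trans ii'.
rewrite w_pos// in ci'; have [i0|i0] := posnP i; last first.
  by rewrite /T !m_posf//; apply: (runs_mono qK q_row ldom' ss).
have Tp : (0 < T i' c)%N by rewrite /T m_posf//; apply: (runs_pos qK q_row ldom' ss).
apply: leq_trans Tp; rewrite ltnS leqn0 -leqn0 -ltnS.
rewrite /T nth_runs; [|exact: mK|by rewrite size_T].
rewrite big_nat1 i0 m_0//; have := dom_le ldom' (isT : 0 < 1)%N i'0.
by move: Dd ci'; rewrite /D0; lia.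
Qed.

End OneMatrix.

Lemma is_mat_transpose (d b : W) q : is_mat d b q -> is_mat b d (transpose q).
Proof.
move=> qm; have [K qK] := mat_bound qm; rewrite /transpose.
have qK' i j : (K <= i)%N || (K <= j)%N -> q j i = 0 by rewrite orbC; apply: qK.
split.
- by move=> i j; rewrite andbC; apply: (mat_range qm).
- exact: (mat_head qm).
- by move=> i j ij; apply: (mat_nat qm); rewrite xpair_eqE andbC -xpair_eqE.
- have F : finite_set (`I_K `*` `I_K : set (nat * nat)).
    by apply: finite_setX; apply: finite_II.
  apply: (sub_finite_set _ F) => -[i j] /= qij; split=> /=; rewrite ltnNge;
    by apply: contra_neqN qij => h; rewrite qK' ?h ?orbT.
- rewrite (@fsbig_nat2 _ (fun i j => q j i) K)// exchange_big -(@fsbig_nat2 _ q K)//.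
  exact: (mat_sum qm).
- by move=> j; apply: (mat_row qm).
by move=> i; apply: (mat_col qm).
Qed.

Lemma in_range0 : in_range n 0.
Proof. by move: n_gt0; rewrite /in_range; case: n => // -[]. Qed.

(** By triangularity the rows beyond i of the matrix sit in the columns beyond i, so each tail of
    [l] is at most that of [m]. *)
Lemma semistandard_dominance l m (y : orbit_set l) (x : orbit_set m) :
  SSm (cmat y x) -> dominance m l.
Proof.
move=> ss i _; pose K := maxn (maxn (wK l) (wK m)) i.+1.
have [lK mK iK] : [/\ (wK l <= K)%N, (wK m <= K)%N & (i < K)%N].
  by rewrite /K; split; lia.
pose tl (b : W) := (\sum_(i.+1 <= j < K) tw b j)%N.
have le : (tl l <= tl m)%N.
  have -> : tl l = (\sum_(i.+1 <= a < K) \sum_(i.+1 <= j < K) cmat y x a j)%N.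
    apply: eq_big_nat => a /andP[ia _]; rewrite -(cmat_row y x _ mK); last lia.
    rewrite (@big_cat_nat _ _ _ i.+1)//= big1_seq ?add0n// => j.
    rewrite mem_index_iota => /andP[_ /andP[_ ji]].
    by apply: SSm_triangular => //; apply: leq_trans ia.
  rewrite exchange_big /=; apply: leq_sum_range => j /andP[ij _].
  rewrite -(cmat_col y x _ lK); last lia.
  by rewrite [leqRHS](@big_cat_nat _ _ _ i.+1)//= leq_addl.
exists (tl m - tl l)%N; rewrite sumrB !(@partial_sum _ K)// natrB//.
by rewrite opprB addrC addrA subrK.
Qed.

(** A larger weight has a larger entry at 0, hence size at most that of [l]; a dominant weight of
    size at most S has at most S nonzero rows i > 0, of length at most S. *)
Lemma dominance_finite l : finite_set [set m | @dominant k n t m /\ dominance l m].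
Proof.
pose S := wsize l.
have Sle m : dominance l m -> (wsize m <= S)%N.
  move=> /(_ 0%N in_range0)[N]; rewrite big_ord1 !weight0E => E.
  have : (S%:R : k) = (wsize m + N)%N%:R.
    by rewrite natrD -E /S; ring.
  by move=> /(natr_inj char0) ->; apply: leq_addr.
have le_size m i : (0 < i)%N -> (tw m i <= wsize m)%N.
  move=> i0; have [iK|Ki] := ltnP i (wK m); last by rewrite tw_wK.
  by rewrite /wsize /wsum (bigD1_seq i) ?mem_index_iota ?iota_uniq ?i0//= mul1n leq_addr.
have dom_size m i : dominant m -> (wsize m < i)%N -> tw m i = 0%N.
  move=> mdom mi; apply/eqP; rewrite -leqn0 leqNgt; apply/negP => pos.
  move: mi; apply/negP; rewrite -leqNgt.
  have iK : (i < wK m)%N by rewrite ltnNge; apply/negP => /tw_wK E; rewrite E in pos.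
  rewrite /wsize /wsum (@big_cat_nat _ _ _ i.+1)//=.
  apply: leq_trans (leq_addr _ _).
  apply: (@leq_trans (\sum_(1 <= j < i.+1) 1)%N).
    by rewrite sum_nat_const_nat muln1 subn1.
  apply: leq_sum_range => j /andP[j0 ji]; rewrite mul1n.
  by apply: leq_trans pos _; apply: dom_le.
pose f m : {ffun 'I_S -> 'I_S.+1} := [ffun i : 'I_S => inord (tw m i.+1)].
pose P m := @dominant k n t m /\ dominance l m.
pose g w := choose_or l (fun m => P m /\ f m = w).
have F : finite_set [set: {ffun 'I_S -> 'I_S.+1}] by exact: finite_finset.
apply: (sub_finite_set _ (finite_image g F)).
move=> m Pm; exists (f m) => //.
have [[mdom' ldom'] fE] : P (g (f m)) /\ f (g (f m)) = f m.
  by apply: (@choose_orP _ l (fun m' => P m' /\ f m' = f m) m).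
case: Pm => mdom lm; apply: weight_eq => // i i0.
have [iS|Si] := leqP i S; last first.
  by rewrite !dom_size//; apply: leq_ltn_trans Si; apply: Sle.
have iS' : (i.-1 < S)%N by lia.
have tS m' : dominance l m' -> (tw m' i < S.+1)%N.
  by move=> lm'; rewrite ltnS; apply: leq_trans (Sle _ lm'); apply: le_size.
have := congr1 (fun h : {ffun 'I_S -> 'I_S.+1} => nat_of_ord (h (Ordinal iS'))) fE.
by rewrite !ffunE /= prednK// (inordK (tS _ ldom')) (inordK (tS _ lm)) => ->.
Qed.

Lemma dominance_poset : upper_finite_poset_on (@dominant k n t) (@dominance k n t).
Proof.
(* Antisymmetry produces two natural numbers that are opposite in [k]. *)
have natN (m m' : nat) : (m%:R : k) = - m'%:R -> m = 0%N.
  move=> E; have : ((m + m')%N%:R : k) = 0%:R by rewrite natrD E addNr.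
  by move=> /(natr_inj char0)/eqP; rewrite addn_eq0 => /andP[/eqP].
split.
- by move=> l _ i _; exists 0%N; rewrite big1// => j _; rewrite subrr.
- move=> l m _ _ lm ml; apply: weight_eq => //.
  have E i : in_range n i -> \sum_(j < i.+1) m j = \sum_(j < i.+1) l j.
    move=> ni; have [a aE] := lm i ni; have [b bE] := ml i ni.
    have a0 : a = 0%N.
      by apply: (natN a b); rewrite -aE -bE !sumrB opprB.
    by apply/eqP; rewrite -subr_eq0 -sumrB aE a0.
  move=> i i0; rewrite /tw; congr natval.
  have [ni|ni] := boolP (in_range n i); last by rewrite !weight_range.
  have ni' : in_range n i.-1.
    by move: ni; rewrite /in_range; case: n => // N; case: (i) => //= i' /ltnW.
  have := E _ ni; rewrite !big_ord_recr /=.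
  by have := E _ ni'; rewrite prednK// => -> /addrI.
- move=> l m p _ _ _ lm mp i ni; have [a aE] := lm i ni; have [b bE] := mp i ni.
  exists (a + b)%N; rewrite natrD -aE -bE -big_split; apply: eq_bigr => j _.
  by rewrite /= addrC addrA subrK.
by move=> l _; apply: dominance_finite.
Qed.

End Semistandard.

(** * The based quasi-hereditary structure *)

Section BasisCriterion.
Variables (k : fieldType) (A : lmodType k) (J : choiceType) (D : set J) (v : J -> A).

Lemma is_basis_crit :
  (forall a, spanned (fun u => exists2 j, D j & u = v j) a) ->
  (forall (s : seq J) (c : J -> k), uniq s -> (forall j, j \in s -> D j) ->
     \sum_(j <- s) c j *: v j = 0 -> forall j, j \in s -> c j = 0) ->
  is_basis D v.
Proof.
move=> span free a.
have fsE (s : seq J) (c : J -> k) : uniq s -> (forall j, j \in s -> D j) ->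
    (forall j, c j != 0 -> j \in s) -> \sum_(j \in D) c j *: v j = \sum_(j <- s) c j *: v j.
  move=> us sD cs; rewrite [RHS]fsbig_seq//; symmetry; apply: fsbig_widen => [j /sD//|j [_ /= js]].
  have [->|/cs//] := eqVneq (c j) 0; exact: scale0r.
have [s [c [us sD cs aE]]] : exists (s : seq J) (c : J -> k), [/\ uniq s,
    forall j, j \in s -> D j, forall j, c j != 0 -> j \in s & a = \sum_(j <- s) c j *: v j].
  elim: (span a) => [|x _ w [j Dj ->] _ [s [c [us sD cs ->]]]].
    by exists [::], (fun=> 0); split=> // [j|]; rewrite ?eqxx ?big_nil.
  pose c' i := c i + (if i == j then x else 0).
  pose r := undup (j :: s).
  have ur : uniq r := undup_uniq _.
  have rE i : (i \in r) = (i == j) || (i \in s) by rewrite mem_undup inE.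
  exists r, c'; split=> //.
  - by move=> i; rewrite rE => /predU1P[->|/sD].
  - move=> i; rewrite rE /c'; case: (eqVneq i j) => //= _.
    by rewrite addr0 => /cs.
  rewrite [RHS](eq_bigr (fun i => c i *: v i + (if i == j then x else 0) *: v i)); last first.
    by move=> i _; rewrite -scalerDl.
  rewrite [RHS]big_split [LHS]addrC /=; congr (_ + _).
    rewrite [RHS](bigID (mem s)) /= [X in _ + X]big1 ?addr0 => [|i is_]; last first.
      by have [->|/cs] := eqVneq (c i) 0; rewrite ?scale0r// (negPf is_).
    rewrite -[RHS]big_filter; apply: perm_big; apply: uniq_perm => //.
      by rewrite filter_uniq.
    by move=> i; rewrite mem_filter rE; case: (i \in s); rewrite ?orbT.
  rewrite [RHS](bigD1_seq j) ?rE ?eqxx//= big1 ?addr0// => i ij.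
  by rewrite (negPf ij) scale0r.
exists c; split=> [|c' [c'0 /finite_seqP[s' s'E] aE']].
  split; [|apply: (sub_finite_set _ (finite_seq s)) => j; exact: cs|by rewrite (fsE s)].
  move=> j Dj; apply/eqP/negPn/negP => /cs /sD; exact: Dj.
have c's' j : c' j != 0 -> j \in s' by move=> cj; have : [set` s'] j by rewrite -s'E.
have s'D j : j \in s' -> D j.
  move=> js'; have : c' j != 0 by have : [set j | c' j != 0] j by rewrite s'E.
  by apply: contraNP => /c'0 ->.
pose r := undup (s ++ s').
have rD j : j \in r -> D j by rewrite mem_undup mem_cat => /orP[/sD|/s'D].
have rsum (c1 : J -> k) s1 : uniq s1 -> {subset s1 <= r} ->
    (forall j, c1 j != 0 -> j \in s1) ->
    \sum_(j <- r) c1 j *: v j = \sum_(j <- s1) c1 j *: v j.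
  move=> us1 s1r c1s.
  rewrite (bigID (mem s1)) /= [X in _ + X]big1 ?addr0 => [|i is_]; last first.
    by have [->|/c1s] := eqVneq (c1 i) 0; rewrite ?scale0r// (negPf is_).
  rewrite -[LHS]big_filter; apply: perm_big; apply: uniq_perm => //.
    by rewrite filter_uniq ?undup_uniq.
  by move=> i; rewrite mem_filter andb_idr// => /s1r.
have E : \sum_(j <- r) (c j - c' j) *: v j = 0.
  under eq_bigr do rewrite scalerBl.
  rewrite sumrB (rsum c s)//; last by move=> j js; rewrite mem_undup mem_cat js.
  rewrite (rsum c' (undup s')) ?undup_uniq//.
  - rewrite -aE aE' (fsE (undup s')) ?undup_uniq ?subrr//.
    + by move=> j; rewrite mem_undup; apply: s'D.
    by move=> j; rewrite mem_undup; apply: c's'.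
  - by move=> j; rewrite !mem_undup mem_cat => ->; rewrite orbT.
  by move=> j; rewrite mem_undup; apply: c's'.
apply/funext => j; have [jr|jr] := boolP (j \in r).
  by apply/eqP; rewrite -subr_eq0; apply/eqP; apply: free E j jr; rewrite ?undup_uniq.
have -> : c j = 0.
  by apply/eqP/negPn/negP => /cs js; move: jr; rewrite mem_undup mem_cat js.
by apply/esym/eqP/negPn/negP => /c's' js; move: jr; rewrite mem_undup mem_cat js orbT.
Qed.

End BasisCriterion.

Section Main.
Variables (k : fieldType) (char0 : [pchar k] =i pred0) (t : k) (n : option nat).
Hypothesis n_gt0 : n != Some 0%N.
Local Notation W := (weight n t).
Local Notation A := (@schur k n t).
Local Notation mul := (@schur_mul k n t).
Local Notation e := (@schur_one k n t).
Local Notation Hom b d := (perm_hom k (orbit_set b) (orbit_set d)).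
Implicit Types b d l : W.

Lemma schur_tr_xi d b q : is_mat d b q -> schur_tr (xi d b q) = xi b d (transpose q).
Proof.
move=> qm; rewrite (xi_ker char0 qm) (xi_ker char0 (is_mat_transpose qm)).
by rewrite schur_tr_in htr_ker nq_transpose.
Qed.

Lemma XsetE l b u : dominant l -> Xset l b u <->
  exists2 m, (exists (y : orbit_set l) (x : orbit_set b), cmat y x = m) /\ SSm m &
    u = dsum_in (j := (l, b)) (ker l b m : Hom b l).
Proof.
move=> ldom; split=> [[r [rm rs] <-]|[m [[y [x <-]] ss] ->]].
  exists (nq r); last exact: xi_ker.
  split; first exact: mat_realize.
  exact/(semistandardE char0 n_gt0 ldom rm).
have [q qm qE] := realize_is_mat char0 n_gt0 y x.
exists q; last by rewrite (xi_ker char0 qm) qE.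
by split=> //; apply/(semistandardE char0 n_gt0 ldom qm); rewrite qE.
Qed.

Lemma schur_tr_Xset l b : dominant l -> @schur_tr k t n @` Xset l b = Yset b l.
Proof.
move=> ldom; apply/seteqP; split=> [_ [_ [r [rm rs] <-] <-]|_ [q [qm qs] <-]].
  rewrite schur_tr_xi//; exists (transpose r) => //.
  by split=> //; apply: is_mat_transpose.
have qm' := is_mat_transpose qm.
exists (xi l b (transpose q)); first by exists (transpose q).
by rewrite schur_tr_xi.
Qed.

Lemma YsetE b l u : dominant l -> Yset b l u <->
  exists2 m, (exists (x : orbit_set b) (y : orbit_set l), cmat x y = m) /\ SSm (trm m) &
    u = dsum_in (j := (b, l)) (ker b l m : Hom l b).
Proof.
move=> ldom; rewrite -schur_tr_Xset//; split.
  move=> [v /(XsetE _ _ ldom)[m [[y [x yx]] ss] ->] <-].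
  exists (trm m); last by rewrite schur_tr_in htr_ker.
  split=> //; exists x, y; apply/funext => i; apply/funext => j.
  by rewrite -cmat_tr yx.
move=> [m [[x [y xy]] ss] ->].
exists (dsum_in (j := (l, b)) (ker l b (trm m) : Hom b l)).
  apply/(XsetE _ _ ldom); exists (trm m) => //; split=> //; exists y, x.
  by apply/funext => i; apply/funext => j; rewrite -cmat_tr xy.
by rewrite schur_tr_in htr_ker.
Qed.

Lemma ker_id l (y : orbit_set l) : ker l l (cmat y y) = hom_id k (orbit_set l).
Proof.
apply/val_inj/funext => -[y' x] /=; congr (_%:R); congr (nat_of_bool _).
apply: asbool_equiv_eq; split=> [/cmat_conj[g [E1 E2]]|->].
  by rewrite -[y'](fs_actK g) -[x](fs_actK g) -E1 -E2.
by have [g ->] := orbit_transitive y x; rewrite cmat_act.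
Qed.

Lemma Xset_diag l : dominant l -> Xset l l = [set e l].
Proof.
move=> ldom; pose y0 : orbit_set l := coset_base (young l).
apply/seteqP; split=> [v /(XsetE _ _ ldom)[m [[y [x yx]] ss] ->]|_ ->] /=.
  suff xy : x = y by rewrite /schur_one -(ker_id y) -yx xy.
  pose p := maxn (bnd y) (bnd x).
  have [yp xp] : supp_le p (lab y) /\ supp_le p (lab x).
    by split; apply: bndP; rewrite ?leq_maxl ?leq_maxr.
  (* Triangularity gives the pointwise bound; as both labellings have weight [l], their label sums
     agree and equality follows. *)
  have le u : (lab y u <= lab x u)%N.
    rewrite leqNgt; apply/negP => lt; rewrite -yx in ss.
    have ij : (lab y u, lab x u) != (0, 0)%N by rewrite xpair_eqE; move: lt; lia.
    have /cmat_eq0 H := SSm_triangular ss lt.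
    exact: (H ij u).
  have E := @lab_sum _ _ _ _ _ _ _ id yp xp.
  apply: lab_inj => u; have [up|pu] := ltnP u p; last by rewrite yp// xp.
  apply/eqP; rewrite eq_sym eqn_leq le /= leqNgt; apply/negP => lt.
  have : (\sum_(0 <= u < p) lab y u < \sum_(0 <= u < p) lab x u)%N.
    rewrite (bigD1_seq u) ?mem_index_iota ?iota_uniq//=.
    rewrite [ltnRHS](bigD1_seq u) ?mem_index_iota ?iota_uniq//= -addSn.
    by apply: leq_add => //; apply: leq_sum.
  by rewrite E ltnn.
apply/(XsetE _ _ ldom); exists (cmat y0 y0); last by rewrite ker_id.
split; first by exists y0, y0.
have y0p := @bndP _ _ _ l y0 _ (leqnn _); split.
  by apply/cmat_eq0 => // u [-> ].
move=> a r a0; rewrite !(cmat_rowlt _ _ y0p y0p)//.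
(* For r <= a the left side is 0; for r > a both sides are full rows, compared by dominance. *)
have [ar|ra] := ltnP a r; last first.
  rewrite big1// => u _; case: eqP => // ->; by rewrite ltnS ltnNge ra.
have rowE i : (i < r.+1)%N -> (\sum_(0 <= u < bnd y0) ((lab y0 u == i) && (lab y0 u < r.+1)) =
    \sum_(0 <= u < bnd y0) (lab y0 u == i))%N.
  by move=> ir; apply: eq_bigr => u _; case: eqP => // ->; rewrite ir.
rewrite rowE// (lab_count y0p)//.
rewrite (eq_bigr (fun u => nat_of_bool (lab y0 u == a))) ?(lab_count y0p)//.
  exact: ldom.
by move=> u _; case: eqP => // ->; rewrite ar.
Qed.

Local Notation idx := ((W * W) * (W * (nmat * nmat)))%type.

Definition pair_of (i : idx) : A * A :=
  (dsum_in (j := (i.1.1, i.2.1)) (ker i.1.1 i.2.1 i.2.2.1 : Hom i.2.1 i.1.1),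
   dsum_in (j := (i.2.1, i.1.2)) (ker i.2.1 i.1.2 i.2.2.2 : Hom i.1.2 i.2.1)).

Definition good (i : idx) := ss_pair i.1.1 i.1.2 i.2.1 i.2.2.

Let D : set (A * A) := \bigcup_(l in @dominant k n t)
  ((\bigcup_(i in [set: W]) Yset i l) `*` (\bigcup_(i in [set: W]) Xset l i)).

Lemma good_pair (i : idx) : good i -> D (pair_of i).
Proof.
case: i => [[d b] [l [m1 m2]]] [/= ldom zy yx s1 s2]; exists l => //; split.
  by exists d => //; apply/(YsetE _ _ ldom); exists m1.
by exists b => //; apply/(XsetE _ _ ldom); exists m2.
Qed.

Lemma pair_good (j : A * A) : D j -> exists2 i, good i & j = pair_of i.
Proof.
case: j => u v [l ldom [/= [d _ /(YsetE _ _ ldom)[m1 [zy s1] ->]]]].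
move=> [b _ /(XsetE _ _ ldom)[m2 [yx s2] ->]].
by exists ((d, b), (l, (m1, m2))).
Qed.

Lemma mul_pair (i : idx) : mul (pair_of i).1 (pair_of i).2 =
  dsum_in (j := (i.1.1, i.1.2)) (codet_at i.1.1 i.1.2 i.2 : Hom i.1.2 i.1.1).
Proof. exact: schur_mul_in. Qed.

Lemma mul_pair_val (i : idx) d b : mul (pair_of i).1 (pair_of i).2 (d, b) =
  if i.1 == (d, b) then codet_at d b i.2 else 0.
Proof.
rewrite mul_pair; case: i => [[d' b'] r]; case: eqVneq => [[<- <-]|db].
  exact: dsum_inE.
by apply: dsum_in_neq; rewrite eq_sym.
Qed.

Lemma schur_basis : is_basis D (fun yx : A * A => mul yx.1 yx.2).
Proof.
apply: is_basis_crit => [a|s c us sD sum0 j0 j0s].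
  have [r _ ->] := dsum_decomp a; apply: spanned_sum => -[d b].
  apply: spanned_linear (@dsum_in_linear _ _ _ (d, b)) _ (codet_spans char0 n_gt0 (a (d, b))).
  move=> f [l [m [ss ->]]]; exists (pair_of ((d, b), (l, m))).
    exact: good_pair.
  by rewrite mul_pair.
have [i0 _ j0E] := pair_good (sD _ j0s).
have /choice[h hE] j : exists i, D j -> good i /\ j = pair_of i.
  by have [/pair_good[i gi ->]|nD] := pselect (D j); [exists i|exists i0].
have hs j : j \in s -> good (h j) /\ j = pair_of (h j) by move=> /sD/hE.
have hinj : {in s &, injective h}.
  by move=> i j /hs[_ {2}->] /hs[_ {2}->] ->.
pose d := (h j0).1.1; pose b := (h j0).1.2.
(* Only the terms in the component of [j0] are kept, since [codet_free] treats one component at a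
   time. *)
pose s' := [seq i.2 | i <- [seq h j | j <- s] & i.1 == (d, b)].
pose a' r := c (pair_of ((d, b), r)).
have us' : uniq s'.
  rewrite map_inj_in_uniq ?filter_uniq ?map_inj_in_uniq//.
  move=> [p r] [p' r']; rewrite !mem_filter /= => /andP[/eqP -> _] /andP[/eqP -> _] ->.
  by [].
have ss r : r \in s' -> ss_pair d b r.1 r.2.
  move=> /mapP[[p r'] + ->]; rewrite mem_filter /= => /andP[/eqP -> /mapP[j js jE]].
  by have [+ _] := hs j js; rewrite -jE.
have sum' : \sum_(r <- s') a' r *: codet_at d b r = 0.
  have := congr1 (fun x : A => x (d, b)) sum0; rewrite dsum_sumE => E.
  apply: etrans E; rewrite big_map big_filter big_map big_mkcond /=.
  rewrite big_seq [RHS]big_seq; apply: eq_bigr => j js.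
  rewrite -[RHS]/(c j *: mul j.1 j.2 (d, b)); have [_ jE] := hs j js.
  rewrite [in RHS]jE mul_pair_val /a'; case: eqP => [E'|_]; last by rewrite scaler0.
  by congr (c (pair_of _) *: _); rewrite [RHS]surjective_pairing E'.
have := codet_free char0 us' ss sum'; move=> /(_ (h j0).2).
have [_ j0E'] := hs j0 j0s.
rewrite /a' /d /b -!surjective_pairing -j0E'; apply.
apply/mapP; exists (h j0) => //; rewrite mem_filter /d /b -surjective_pairing eqxx.
exact: map_f.
Qed.

Lemma Xset_triangular l m : dominant l -> dominant m -> ~ dominance m l -> Xset l m = set0.
Proof.
move=> ldom mdom ml; apply/seteqP; split=> // u /(XsetE _ _ ldom)[_ [[y [x <-]] ss] _].
exact/ml/semistandard_dominance/ss.
Qed.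

Lemma schur_bqh : upper_finite_based_quasi_hereditary mul e
  (@dominant k n t) (@dominance k n t) (@Xset k n t) (@Yset k n t).
Proof.
split.
- exact: schur_lua.
- exact: dominance_poset.
- move=> l b ldom _ /(XsetE _ _ ldom)[m _ ->].
  exists (dsum_in (j := (l, b)) (ker l b m : Hom b l)) => //.
  by rewrite (schur_peirce char0) dsum_inE.
- move=> l b ldom _ /(YsetE _ _ ldom)[m _ ->].
  exists (dsum_in (j := (b, l)) (ker b l m : Hom l b)) => //.
  by rewrite (schur_peirce char0) dsum_inE.
- exact: schur_basis.
- move=> l m ldom mdom ml; have X0 := Xset_triangular ldom mdom ml; split=> //.
  by rewrite -schur_tr_Xset// X0 image_set0.
move=> l ldom; split; first exact: Xset_diag.
by rewrite -schur_tr_Xset// Xset_diag// image_set1 schur_tr_one.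
Qed.

End Main.

Theorem theorem7p3p1 (k : fieldType) (char0 : [pchar k] =i pred0) (t : k)
    (n : option nat) (n_gt0 : n != Some 0%N) :
  exists tau : schur n t -> schur n t,
    (forall (d b : weight n t) (q : nat -> nat -> k), is_mat d b q ->
       tau (xi d b q) = xi b d (transpose q)) /\
    upper_finite_symmetrically_based_quasi_hereditary
      (@schur_mul k n t) (@schur_one k n t)
      (@dominant k n t) (@dominance k n t)
      (@Xset k n t) (@Yset k n t) tau.
Proof.
exists (@schur_tr k t n); split; first by move=> d b q; apply: schur_tr_xi.
split.
- exact: schur_bqh.
- exact: schur_tr_anti_involution.
- exact: schur_tr_one.
by move=> l b ldom; apply: schur_tr_Xset.
Qed.
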